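(* Let $n\geqslant 1$ be an integer and $k$ a field. Consider rings $R$ with residue field $k$ and minimal regular presentation $Q/I$, where $I$ is minimally generated by monomials $\boldsymbol f=f_1,\dots,f_n$ on a regular sequence $\boldsymbol x$ of $Q$, and regard $\mathrm V_R(R)$ as a closed subset of $\mathbb A^n_k$ with $f_1,\dots,f_n$ corresponding to the standard basis. Then only finitely many closed subsets of $\mathbb A_k^n$ are realizable as $\mathrm V_R(R)$ for such $R$; the closed subsets that are realizable depend only on $n$, and are independent of $\boldsymbol x$ or $Q$. If $n\leqslant 5$, then the cohomological support variety of $R$ is a union of coordinate subspaces. More precisely, there are two cases: (The exceptional case) If $n=5$ and, up to reordering of $f_1,\dots,f_5$, the GCD graph of $\boldsymbol f$ is one of the two graphs on vertices $\{1,2,3,4,5\}$ with edge set \[ \{12,\,23,\,34,\,45\}\quad\text{or}\quad \{12,\,23,\,24,\,34,\,45\}, \] and $f_3$ divides $\operatorname{lcm}(f_2,f_4)$, then \[ \mathrm V_R(R)=\{a\in\mathbb A_k^5\mid a_1=0\text{ or }a_5=0\}. \] (The generic case) In all other cases with $n\leqslant 5$, \[ \mathrm V_R(R)=\{a\in\mathbb A_k^n\mid a_i=0\text{ for all }i\in S\} \] for some $S\subseteq\{1,\dots,n\}$, where $c=|S|$ is the largest codimension of an embedded deformation of $R$.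
   Context: Minimal regular presentation. One of two cases holds. Local case: $R$ is a commutative noetherian local ring with residue field $k$, $(Q,\mathfrak m,k)$ is a regular local ring, $I\subseteq \mathfrak m^2$ is an ideal, and $\widehat R\cong Q/I$. Graded case: $Q$ is a polynomial ring in finitely many variables of positive degree over a field $k$, $\mathfrak m$ is its homogeneous maximal ideal, $I\subseteq\mathfrak m^2$ is a homogeneous ideal and $R=Q/I$; here all elements, ideals and sequences are taken to be homogeneous. In either case $Q/I$ is called a minimal regular presentation of $R$. A monomial on a regular sequence $x_1,\dots,x_d\in\mathfrak m$ of $Q$ is an element $x_1^{a_1}\cdots x_d^{a_d}$ with all $a_i\geqslant 0$. The GCD graph of $\boldsymbol f$ is the simple graph with vertices $1,\dots,n$ having an edge $ij$ (for $i\ne j$) if and only if $\gcd(f_i,f_j)$ is not a unit. $R$ has an embedded deformation of codimension $c$ if there is an ideal $J\subseteq I$ such that the ideal $I/J$ of $Q/J$ is generated by a $Q/J$-regular sequence of length $c$ (for $c=0$ this is no condition). Cohomological support. Let $E=Q[e_1,\dots,e_n\mid \partial e_i=f_i]$ be the Koszul complex on $f_1,\dots,f_n$ (a dg algebra), and $\mathcal S=k[\chi_1,\dots,\chi_n]$ with each $\chi_i$ of cohomological degree $2$. The ring $Q/I$ is a dg $E$-module through the augmentation $E\to Q/I$. There is a dg $E$-module $F$ that is a bounded complex of finite rank free $Q$-modules and is quasi-isomorphic to $Q/I$ as a dg $E$-module, and $\operatorname{Ext}_E(Q/I,k)$ is, as a graded $\mathcal S$-module, the homology of $\mathcal S\otimes_k\operatorname{Hom}_Q(F,k)$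 with differential $1\otimes\partial^{\operatorname{Hom}_Q(F,k)}+\sum_i\chi_i\otimes e_i$ (independent of $F$). Then \[ \mathrm V_R(R)=\operatorname{Supp}_{\mathcal S}\operatorname{Ext}_E(Q/I,k)=\{\mathfrak p : \mathfrak p\supseteq \operatorname{ann}_{\mathcal S}\operatorname{Ext}_E(Q/I,k)\}, \] a closed subset of the space of homogeneous primes of $\mathcal S$ (including the irrelevant ideal), identified with the corresponding conical closed subset of $\mathbb A^n_k=\operatorname{Spec}\mathcal S$, where $\chi_i$ is the $i$-th coordinate function $a\mapsto a_i$. Sets described by points $a\in\mathbb A^n_k$ are to be read as the closed subsets defined by the given equations (equivalently, by points over an algebraic closure of $k$). *)

(* Defs.v *)
From HB Require Import structures.
From mathcomp Require Import all_boot all_order all_algebra.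
From mathcomp Require Import mpoly.

Set Implicit Arguments.
Unset Strict Implicit.
Unset Printing Implicit Defensive.

Import GRing.Theory.
Local Open Scope ring_scope.

(* Ideals and primes are Prop-valued, so that quantifying over all ideals of a
   ring (noetherianity, Krull dimension) is not restricted to decidable ones. *)
Section Ideals.
Variable A : comUnitRingType.
Implicit Types (I J K P : A -> Prop).

Definition ideal I : Prop :=
  [/\ I 0, forall a b, I a -> I b -> I (a + b) & forall r a, I a -> I (r * a)].

Definition prime_ideal P : Prop :=
  [/\ ideal P, ~ P 1 & forall a b, P (a * b) -> P a \/ P b].

Definition span (r : nat) (g : 'I_r -> A) : A -> Prop :=
  fun a => exists c : 'I_r -> A, a = \sum_(i < r) c i * g i.

Definition span_mod J (r : nat) (g : 'I_r -> A) (s : pred 'I_r) : A -> Prop :=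
  fun a => exists b, J b /\
    exists c : 'I_r -> A, a = b + \sum_(i < r | s i) c i * g i.

Definition generates (r : nat) (g : 'I_r -> A) I : Prop :=
  forall a, I a <-> span g a.

Definition minimally_generates (r : nat) (g : 'I_r -> A) I : Prop :=
  generates g I /\
  forall i, ~ exists c : 'I_r -> A, g i = \sum_(j < r | j != i) c j * g j.

Definition ideal_mul I J : A -> Prop := fun a =>
  exists (r : nat) (b c : 'I_r -> A),
    [/\ forall i, I (b i), forall i, J (c i) & a = \sum_(i < r) b i * c i].

Fixpoint ideal_pow I (m : nat) : A -> Prop :=
  if m is m'.+1 then ideal_mul I (ideal_pow I m') else fun=> True.

(* g_0, ..., g_(r-1) represents an (A/J)-regular sequence. *)
Definition regular_seq_mod J (r : nat) (g : 'I_r -> A) : Prop :=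
  (forall (i : 'I_r) a, span_mod J g (fun j => (j < i)%N) (g i * a) ->
                        span_mod J g (fun j => (j < i)%N) a) /\
  ~ span_mod J g predT 1.

Definition regular_seq (r : nat) (g : 'I_r -> A) : Prop :=
  regular_seq_mod (fun a => a = 0) g.

Definition noetherian : Prop :=
  forall I, ideal I -> exists (r : nat) (g : 'I_r -> A), generates g I.

Definition prime_chain (d : nat) (C : nat -> A -> Prop) : Prop :=
  (forall i, (i <= d)%N -> prime_ideal (C i)) /\
  (forall i, (i < d)%N ->
     (forall a, C i a -> C i.+1 a) /\ exists a, C i.+1 a /\ ~ C i a).

Definition krull_dim (d : nat) : Prop :=
  (exists C, prime_chain d C) /\
  (forall e C, prime_chain e C -> (e <= d)%N).

Definition dvd (a b : A) : Prop := exists c, b = c * a.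

Definition is_gcd (g a b : A) : Prop :=
  [/\ dvd g a, dvd g b & forall h, dvd h a -> dvd h b -> dvd h g].

Definition is_lcm (l a b : A) : Prop :=
  [/\ dvd a l, dvd b l & forall h, dvd a h -> dvd b h -> dvd l h].

End Ideals.

Section Local.
Variable k : fieldType.

Definition res_ker (A : comUnitRingType) (res : A -> k) : A -> Prop :=
  fun a => res a = 0.

(* [res] presents k as the residue field of the local ring A. *)
Definition local_ring (A : comUnitRingType) (res : {rmorphism A -> k}) : Prop :=
  (forall c, exists a, res a = c) /\
  (forall a, (a \is a GRing.unit) = (res a != 0)).

Definition regular_local_ring
    (A : comUnitRingType) (res : {rmorphism A -> k}) : Prop :=
  [/\ local_ring res, noetherian A &
      exists d, krull_dim A d /\
        exists g : 'I_d -> A, generates g (res_ker res)].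

End Local.

(* Ring isomorphism between Q/I and the m-adic completion lim_i R/m^i.
   An element of the limit is represented by a sequence u with
   u_(i+1) = u_i modulo m^i; two sequences u, v are the same element when
   u_i = v_i modulo m^i for all i.  [phi] is a ring morphism from Q to the
   limit (up to that equality), surjective with kernel I. *)
Definition completion_iso_quotient (R : comUnitRingType) (m : R -> Prop)
    (Q : comUnitRingType) (I : Q -> Prop) : Prop :=
  let coherent (u : nat -> R) := forall i, ideal_pow m i (u i.+1 - u i) in
  let same (u v : nat -> R) := forall i, ideal_pow m i (u i - v i) in
  exists phi : Q -> nat -> R,
    [/\ forall a, coherent (phi a),
        [/\ forall a b, same (phi (a + b)) (fun i => phi a i + phi b i),
            forall a b, same (phi (a * b)) (fun i => phi a i * phi b i) &
            same (phi 1) (fun=> 1)],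
        forall u, coherent u -> exists a, same (phi a) u &
        forall a, same (phi a) (fun=> 0) <-> I a].

Definition whomog (k : fieldType) (N : nat) (w : 'I_N -> nat)
    (p : {mpoly k[N]}) : Prop :=
  exists D : nat, forall mon, mon \in msupp p -> (\sum_(i < N) w i * mon i)%N = D.

(* The predicate [hom] below singles out the elements one is allowed to use:
   all elements in the local case, the homogeneous ones in the graded case. *)
Definition hom_ideal (A : comUnitRingType) (hom : A -> Prop) (I : A -> Prop) :=
  ideal I /\
  forall a, I a -> exists (r : nat) (b : 'I_r -> A),
    (forall i, I (b i) /\ hom (b i)) /\ span b a.

Inductive min_regular_presentation (k : fieldType) :
    forall Q : comUnitRingType,
      {rmorphism Q -> k} -> (Q -> Prop) -> (Q -> Prop) -> Prop :=
| LocalPresentation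
    (R : comUnitRingType) (resR : {rmorphism R -> k})
    (Q : comUnitRingType) (res : {rmorphism Q -> k}) (I : Q -> Prop) :
    local_ring resR -> noetherian R ->
    regular_local_ring res ->
    ideal I -> (forall a, I a -> ideal_pow (res_ker res) 2 a) ->
    completion_iso_quotient (res_ker resR) I ->
    min_regular_presentation res (fun=> True) I
| GradedPresentation
    (N : nat) (w : 'I_N -> nat) (I : {mpoly k[N]} -> Prop) :
    let res : {rmorphism {mpoly k[N]} -> k} := mcoeff 0%MM in
    (forall i, (0 < w i)%N) ->
    hom_ideal (whomog w) I -> (forall a, I a -> ideal_pow (res_ker res) 2 a) ->
    min_regular_presentation res (whomog w) I.

Record monomial_presentation (k : fieldType) (n : nat) := MonomialPresentation {
  mp_ring : comUnitRingType;
  mp_res : {rmorphism mp_ring -> k};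
  mp_hom : mp_ring -> Prop;
  mp_ideal : mp_ring -> Prop;
  mp_length : nat;
  mp_x : 'I_mp_length -> mp_ring;
  mp_exp : 'M[nat]_(n, mp_length);
  mp_f : 'I_n -> mp_ring := fun i => \prod_(j < mp_length) mp_x j ^+ mp_exp i j;
  mp_presentation : min_regular_presentation mp_res mp_hom mp_ideal;
  mp_x_hom : forall j, mp_hom (mp_x j);
  mp_x_max : forall j, mp_res (mp_x j) = 0;
  mp_x_regular : regular_seq mp_x;
  mp_f_generates : minimally_generates mp_f mp_ideal
}.

Arguments mp_hom {k n} P _ : rename.
Arguments mp_ideal {k n} P _ : rename.
Arguments mp_x {k n} P _ : rename.
Arguments mp_exp {k n} P : rename.
Arguments mp_f {k n} P _ : rename.

Definition embedded_deformation (k : fieldType) (n : nat)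
    (P : monomial_presentation k n) (c : nat) : Prop :=
  exists J : mp_ring P -> Prop,
    [/\ hom_ideal (mp_hom P) J, forall a, J a -> mp_ideal P a &
    exists g : 'I_c -> mp_ring P,
      [/\ forall i, mp_hom P (g i), regular_seq_mod J g &
          forall a, mp_ideal P a <-> span_mod J g predT a]].

(* A dg module over the Koszul complex E = Q[e_1, ..., e_n | d e_j = f_j], in
   homological grading over int.  As E is the exterior algebra on the e_j, an
   E-module structure amounts to operators of degree 1 subject to
   e_j e_j = 0 and e_j e_l = - e_l e_j; the last field is the Leibniz rule
   d (e_j x) = f_j x - e_j (d x).  Every integer is of the form i + 1, so
   indexing d by its target degree loses nothing and avoids casts. *)
Record dgE (Q : comUnitRingType) (n : nat) (f : 'I_n -> Q) := DgE {
  dg_mod : int -> lmodType Q;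
  dg_d : forall i, {linear dg_mod (i + 1) -> dg_mod i};
  dg_e : forall (j : 'I_n) i, {linear dg_mod i -> dg_mod (i + 1)};
  dg_dd : forall i x, dg_d i (dg_d (i + 1) x) = 0;
  dg_ee : forall j i x, dg_e j (i + 1) (dg_e j i x) = 0;
  dg_eC : forall j l i x,
    dg_e j (i + 1) (dg_e l i x) = - dg_e l (i + 1) (dg_e j i x);
  dg_de : forall j i x,
    dg_d (i + 1) (dg_e j (i + 1) x) = f j *: x - dg_e j i (dg_d i x)
}.

Section DgModules.
Variables (Q : comUnitRingType) (n : nat) (f : 'I_n -> Q).

Record dg_hom (M N : dgE f) := DgHom {
  dgh_map : forall i, {linear dg_mod M i -> dg_mod N i};
  dgh_d : forall i x, dgh_map i (dg_d M i x) = dg_d N i (dgh_map (i + 1) x);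
  dgh_e : forall j i x, dgh_map (i + 1) (dg_e M j i x) = dg_e N j i (dgh_map i x)
}.

Definition is_cycle (M : dgE f) i (x : dg_mod M (i + 1)) : Prop :=
  dg_d M i x = 0.

Definition is_boundary (M : dgE f) i (x : dg_mod M i) : Prop :=
  exists y, dg_d M i y = x.

(* Bijectivity on homology in degree i + 1, for all integers i. *)
Definition quasi_iso (M N : dgE f) (h : dg_hom M N) : Prop :=
  forall i,
    (forall x, is_cycle x -> is_boundary (dgh_map h (i + 1) x) ->
               is_boundary x) /\
    (forall y, is_cycle y ->
       exists x, is_cycle x /\ is_boundary (y - dgh_map h (i + 1) x)).

Inductive quasi_isomorphic : dgE f -> dgE f -> Prop :=
| QisoRefl M : quasi_isomorphic M M
| QisoForward M N P (h : dg_hom M N) :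
    quasi_iso h -> quasi_isomorphic N P -> quasi_isomorphic M P
| QisoBackward M N P (h : dg_hom N M) :
    quasi_iso h -> quasi_isomorphic N P -> quasi_isomorphic M P.

(* M is, up to isomorphism, Q/I concentrated in degree 0; for degree reasons
   the e_j then act by zero, i.e. E acts through the augmentation E -> Q/I. *)
Definition is_quotient_dgE (I : Q -> Prop) (M : dgE f) : Prop :=
  (forall i : int, i != 0 -> forall x : dg_mod M i, x = 0) /\
  exists pr : {linear Q^o -> dg_mod M 0},
    (forall x, exists q, pr q = x) /\ (forall q, pr q = 0 <-> I q).

(* A dg E-module whose underlying complex is a bounded complex of finite rank
   free Q-modules F_i = Q^(rk i), written as row vectors: the differential and
   the e_j act by right multiplication by matrices. *)
Record free_dgE := FreeDgE {
  fr_rk : int -> nat;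
  fr_d : forall i, 'M[Q]_(fr_rk (i + 1), fr_rk i);
  fr_e : forall (j : 'I_n) i, 'M[Q]_(fr_rk i, fr_rk (i + 1));
  fr_bounded : exists b : nat, forall i : int, (b < `|i|)%N -> fr_rk i = 0%N;
  fr_dd : forall i, fr_d (i + 1) *m fr_d i = 0;
  fr_ee : forall j i, fr_e j i *m fr_e j (i + 1) = 0;
  fr_eC : forall j l i, fr_e l i *m fr_e j (i + 1) = - (fr_e j i *m fr_e l (i + 1));
  fr_de : forall j i,
    fr_e j (i + 1) *m fr_d (i + 1) = (f j)%:M - fr_d i *m fr_e j i
}.

Definition dgE_of_free (F : free_dgE) : dgE f.
Proof.
refine (@DgE Q n f (fun i => 'rV[Q]_(fr_rk F i))
  (fun i => mulmxr (fr_d F i)) (fun j i => mulmxr (fr_e F j i)) _ _ _ _).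
- by move=> i x; rewrite /= -mulmxA fr_dd mulmx0.
- by move=> j i x; rewrite /= -mulmxA fr_ee mulmx0.
- by move=> j l i x; rewrite /= -!mulmxA fr_eC mulmxN.
- by move=> j i x; rewrite /= -!mulmxA fr_de mulmxBr mul_mx_scalar.
Defined.

Definition resolves (I : Q -> Prop) (F : free_dgE) : Prop :=
  exists M, is_quotient_dgE I M /\ quasi_isomorphic (dgE_of_free F) M.

End DgModules.

Record spec (A : comUnitRingType) := Spec {
  spec_ideal :> A -> Prop;
  spec_prime : prime_ideal spec_ideal
}.

Notation affine k n := (spec {mpoly k[n]}).

Section Support.
Variables (k : fieldType) (n : nat).
Local Notation S := {mpoly k[n]}.

Section Ext.
Variables (Q : comUnitRingType) (res : {rmorphism Q -> k}) (f : 'I_n -> Q).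
Variable F : free_dgE f.

Definition resS (a b : nat) (B : 'M[Q]_(a, b)) : 'M[S]_(a, b) :=
  map_mx (fun q => (res q)%:MP_[n]) B.

(* Hom_Q(F_i, k) is the space of columns of height rk i (a column acts on the
   rows of F_i), and an element of S (x) Hom_Q(F, k) is a family of columns over
   S.  With the usual signs, for phi in Hom_Q(F_i, k), i.e. of degree - i,
     (d phi)(x) = - (-1)^i phi (d x)   and   (e_j phi)(x) = (-1)^i phi (e_j x).
   [ext_diff phi psi] says that psi is the image of phi under
   1 (x) d + \sum_j chi_j (x) e_j: the component of psi in Hom_Q(F_(i+1), k)
   collects d phi_i and the chi_j e_j phi_(i+2). *)
Definition ext_cochain := forall i : int, 'cV[S]_(fr_rk F i).

Definition ext_diff (phi psi : ext_cochain) : Prop :=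
  forall i : int,
    psi (i + 1) =
      (-1) ^+ `|i|%N *:
        (\sum_(j < n) 'X_j *: (resS (fr_e F j (i + 1)) *m phi (i + 1 + 1))
         - resS (fr_d F i) *m phi i).

(* The annihilator of the homology Ext_E(Q/I, k). *)
Definition ext_ann (s : S) : Prop :=
  forall phi : ext_cochain, ext_diff phi (fun=> 0) ->
    exists psi : ext_cochain, ext_diff psi (fun i => s *: phi i).

Definition ext_support (p : affine k n) : Prop := forall s, ext_ann s -> p s.

End Ext.

(* Z is the closed subset V_R(R) of affine space: F as required exists, and
   every such F computes Z. *)
Definition is_cohomological_support
    (P : monomial_presentation k n) (Z : affine k n -> Prop) : Prop :=
  (exists F : free_dgE (mp_f P), resolves (mp_ideal P) F) /\
  (forall F : free_dgE (mp_f P), resolves (mp_ideal P) F ->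
     forall p, ext_support (mp_res P) F p <-> Z p).

Definition realizable (Z : affine k n -> Prop) : Prop :=
  exists P : monomial_presentation k n, is_cohomological_support P Z.

Definition zero_locus (l : seq {mpoly int[n]}) : affine k n -> Prop :=
  fun p => forall g, g \in l -> p (map_mpoly intr g).

Definition coordinate_subspace (T : {set 'I_n}) : affine k n -> Prop :=
  fun p => forall i, i \in T -> p 'X_i.

Definition gcd_edge (P : monomial_presentation k n) (i j : 'I_n) : Prop :=
  i != j /\ exists g, is_gcd g (mp_f P i) (mp_f P j) /\ g \isn't a GRing.unit.

End Support.

(* Vertices 1, ..., 5 are numbered 0, ..., 4. *)
Definition exceptional_edges : seq (seq (nat * nat)) :=
  [:: [:: (0, 1); (1, 2); (2, 3); (3, 4)];
      [:: (0, 1); (1, 2); (1, 3); (2, 3); (3, 4)] ]%N.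

(* v is a reordering of f_1, ..., f_n (which forces n = 5) for which the
   conditions of the exceptional case hold. *)
Definition exceptional (k : fieldType) (n : nat)
    (P : monomial_presentation k n) (v : 'I_5 -> 'I_n) : Prop :=
  [/\ bijective v,
      exists2 es, es \in exceptional_edges &
        forall i j : 'I_5, gcd_edge P (v i) (v j) <->
          ((i : nat, j : nat) \in es) || ((j : nat, i : nat) \in es) &
      exists l, is_lcm l (mp_f P (v (inord 1))) (mp_f P (v (inord 3))) /\
                dvd (mp_f P (v (inord 2))) l].

(* Main.v *)
(* The Taylor complex on f_1, ..., f_n, with basis indexed by the subsets A of
   {1, ..., n}, is a dg E-module via e_j * A = +- (f_j lcm_A / lcm_(A + j)) (A + j)
   and resolves Q/I.  Any two such resolutions give matrices
   D = \sum_j chi_j e_j - d over k[chi] with the same annihilator of homology: a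
   chain map extends to a map of matrix factorizations, unique up to homotopy.
   For the Taylor complex the entries of D are 0, +-1 and +-chi_j, according to
   which f_j are coprime to, or divide, lcm_A.  As D^2 = 0 and D has even size 2r,
   with r = 2^(n-1), a prime p lies in the support if and only if it contains all
   r x r minors of D: such a minor annihilates the homology, and conversely an
   annihilator outside p makes D exact, hence of rank r, over the residue field
   of p.  This bounds the number of supports.

   Let n <= 5.  A vertex i isolated in the GCD graph gives the minor +-chi_i^r, so
   that chi_i vanishes on the support.  For the converse, p contains every r x r
   minor as soon as all entries of D outside p are covered by fewer than r rows and
   columns; unless some vertex is adjacent to all others (then the annihilator is
   0) or the graph is one of the two exceptional ones, such covers exist for every
   graph.  If f_3 does not divide lcm (f_2, f_4) they also exist for the exceptional
   graphs; otherwise they exist once chi_1 or chi_5 is in p, while a triangular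
   r x r submatrix with diagonal entries +-1, +-chi_1, +-chi_5 shows that one of
   them has to be.

   Isolated generators form a regular sequence modulo the other ones.  Conversely,
   if I/J is generated by a regular sequence g_1, ..., g_c, write f_j = \sum_t b_jt g_t
   modulo J; for j adjacent to l the relation m f_j = m' f_l forces all b_jt to be in
   the maximal ideal, and since (b_jt) has rank c over k, at least c generators are
   isolated. *)
Require Import Defs.
From HB Require Import structures.
From mathcomp Require Import all_boot all_order all_algebra.
From mathcomp Require Import perm mpoly.
From mathcomp Require Import boolp.
From mathcomp Require Import ring zify.

Set Implicit Arguments.
Unset Strict Implicit.
Unset Printing Implicit Defensive.

Import GRing.Theory.
Local Open Scope ring_scope.

(** * Monomials on a regular sequence *)

(** Gcds, lcms and divisibility refer to all elements of [Q], while only monomials can be computed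
    with. One formula controls them, for the colon ideal of a monomial ideal by a monomial; it rests
    on the permutability of the regular sequence and so on Nakayama's lemma, proved separately in
    the local and the graded case.

    The complex [F] is arbitrary: it may reach into negative degrees and is tied to Q/I only by a
    zigzag. The zigzag serves to read off the homology of [F]; the comparison with the Taylor
    complex is made over Q[chi], where the homology for d still sits in degree 0, and just its
    result is reduced to k[chi].

    An annihilator outside p does not give exactness over the residue field K of p by localization
    alone, as homology does not commute with specialization. Over K, p comes from a rational point,
    whose coordinates are imposed one at a time.

    The graph alone does not decide which f_j divide lcm_A. The covers are therefore sought for a
    superset of the entries outside p, by computation over all graphs with at most five vertices. *)

Section MonomialIdeals.
Variables (Q : comUnitRingType) (d : nat) (x : 'I_d -> Q).
Implicit Types (m : 'I_d -> nat) (M : seq ('I_d -> nat)) (V : seq 'I_d).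

Definition mono m : Q := \prod_(j < d) x j ^+ m j.

(* The ideal generated by the monomials with exponents in M. *)
Fixpoint mid M (a : Q) : Prop :=
  if M is m :: M' then exists c, mid M' (a - c * mono m) else a = 0.

Definition lem m m' := [forall j, m j <= m' j]%N.

Definition wt m := (\sum_(j < d) m j)%N.
Definition Wt M := sumn [seq wt m | m <- M].

Lemma Wt_cons m M : Wt (m :: M) = (wt m + Wt M)%N.
Proof. by []. Qed.

Definition del (l : 'I_d) : 'I_d -> nat := fun j => (j == l : nat).

Lemma mono_ext m m' : m =1 m' -> mono m = mono m'.
Proof. by move=> e; apply: eq_bigr => j _; rewrite e. Qed.

Lemma monoD m m' : mono (fun j => m j + m' j)%N = mono m * mono m'.
Proof. by rewrite -big_split; apply: eq_bigr => j _; rewrite exprD. Qed.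

Lemma mono0 m : (forall j, m j = 0%N) -> mono m = 1.
Proof. by move=> e; apply: big1 => j _; rewrite e. Qed.

Lemma mono_del l : mono (del l) = x l.
Proof.
rewrite /mono (bigD1 l) //= /del eqxx expr1 big1 ?mulr1 // => j.
by move/negbTE=> ->.
Qed.

Lemma mono_lem m m' : lem m m' -> mono m' = mono (fun j => m' j - m j)%N * mono m.
Proof.
move=> /forallP h; rewrite -monoD; apply: mono_ext => j.
by rewrite subnK.
Qed.

Lemma mid0 M : mid M 0.
Proof. by elim: M => [|m M IH] //=; exists 0; rewrite mul0r subr0. Qed.

Lemma midD M a b : mid M a -> mid M b -> mid M (a + b).
Proof.
elim: M a b => [|m M IH] a b /=; first by move=> -> ->; rewrite addr0.
by move=> [c h] [c' h']; exists (c + c'); rewrite mulrDl opprD addrACA; apply: IH.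
Qed.

Lemma midM M r a : mid M a -> mid M (r * a).
Proof.
elim: M a => [|m M IH] a /=; first by move=> ->; rewrite mulr0.
by move=> [c h]; exists (r * c); rewrite -mulrA -mulrBr; apply: IH.
Qed.

Lemma midN M a : mid M a -> mid M (- a).
Proof. by move=> h; rewrite -mulN1r; apply: midM. Qed.

Lemma midB M a b : mid M a -> mid M b -> mid M (a - b).
Proof. by move=> ha hb; apply: midD => //; apply: midN. Qed.

Lemma mid_sum M (I : Type) (r : seq I) (P : pred I) (F : I -> Q) :
  (forall i, P i -> mid M (F i)) -> mid M (\sum_(i <- r | P i) F i).
Proof.
move=> h; elim: r => [|i r IH]; first by rewrite big_nil; apply: mid0.
by rewrite big_cons; case: ifP => // Pi; apply: midD => //; apply: h.
Qed.

Lemma mid_gen M c m : has (lem^~ m) M -> mid M (c * mono m).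
Proof.
elim: M => [|m' M IH] //= /orP [h|h].
  by exists (c * mono (fun j => m j - m' j)%N); rewrite (mono_lem h) mulrA subrr; apply: mid0.
by exists 0; rewrite mul0r subr0; apply: IH.
Qed.

Lemma mid_sub M M' a : all (fun m => has (lem^~ m) M') M -> mid M a -> mid M' a.
Proof.
elim: M a => [|m M IH] a /=; first by move=> _ ->; apply: mid0.
move=> /andP [h1 h2] [c h]; rewrite -(subrK (c * mono m) a).
by apply: midD; [apply: IH | apply: mid_gen].
Qed.

Lemma lem_refl m : lem m m. Proof. by apply/forallP. Qed.

Definition vid V := mid [seq del l | l <- V].

Lemma vid_cons l V a : vid (l :: V) a <-> exists c, vid V (a - c * x l).
Proof. by rewrite /vid /= mono_del. Qed.

Lemma vid_sub V V' a : {subset V <= V'} -> vid V a -> vid V' a.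
Proof.
move=> s; apply: mid_sub; rewrite all_map; apply/allP => l lV /=.
by rewrite has_map; apply/hasP; exists l; [exact: s | exact: lem_refl].
Qed.

Definition nzd_mod (J : Q -> Prop) (r : Q) := forall a, J (r * a) -> J a.

Definition initial_regular :=
  forall s : 'I_d, nzd_mod (vid [seq l : 'I_d <- enum 'I_d | (l < s)%N]) (x s).

(** Nakayama's lemma for the colon ideal K = (V : x_s): if K lies in V + x_l K, then K lies in V. It
    is a hypothesis of this section so that the local and the graded proof can both be plugged
    in. *)
Definition nakayama_vid := forall V (l s : 'I_d),
  (forall a, vid V (x s * a) -> exists a1, vid V (x s * a1) /\ vid V (a - x l * a1)) ->
  nzd_mod (vid V) (x s).

Hypothesis Hreg : initial_regular.
Hypothesis Hnak : nakayama_vid.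

(** Induction on the bound. The last index allowed is treated first, modulo any set of smaller ones:
    the set is enlarged until it holds all smaller indices, where [Hreg] applies. For any other
    entry the last one is moved past it by the usual exchange. *)
Lemma regular_permutable_bounded (t : nat) V (j : 'I_d) :
  all (fun l : 'I_d => l < t)%N V -> (j < t)%N -> j \notin V -> nzd_mod (vid V) (x j).
Proof.
elim: t V j => [|t IH] V j //.
have top (s : 'I_d) (W : seq 'I_d) : s = t :> nat ->
    all (fun l : 'I_d => l < t)%N W -> nzd_mod (vid W) (x s).
  move=> st.
  have [k le_k] := ubnP #|[pred l : 'I_d | (l < t)%N && (l \notin W)]|.
  elim: k W le_k => [|k IHk] W // le_k aW.
  have [l /andP [lt lW]|h] := pickP [pred l : 'I_d | (l < t)%N && (l \notin W)].
    have nl : nzd_mod (vid W) (x l) by apply: IH.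
    have nls : nzd_mod (vid (l :: W)) (x s).
      apply: IHk; last by rewrite /= lt.
      rewrite -ltnS; apply: leq_trans le_k; rewrite ltnS.
      rewrite [X in (_ < X)%N](cardD1 l) inE lt lW /= add1n ltnS.
      apply: subset_leq_card; apply/subsetP => z; rewrite !inE negb_or.
      by case/and3P=> -> -> ->.
    (* Index l is taken out of the set again: regularity modulo l and W gives a = c x_l modulo W,
       and cancelling x_l leaves c in the colon ideal. *)
    apply: (Hnak (l := l)) => a ha.
    have /vid_cons [c hc] : vid (l :: W) a.
      by apply: nls; apply: vid_sub ha => z zW; rewrite inE zW orbT.
    exists c; rewrite (mulrC (x l)); split=> //; apply: nl.
    rewrite (_ : x l * (x s * c) = x s * a - x s * (a - c * x l)); last by ring.
    by apply: midB => //; apply: midM.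
  move=> a ha.
  have e : {subset [seq l : 'I_d <- enum 'I_d | (l < s)%N] <= W}.
    move=> l; rewrite mem_filter st => /andP [lt _].
    by move: (h l) => /=; rewrite lt /= => /negbFE.
  apply: (vid_sub e); apply: Hreg; apply: vid_sub ha => l lW.
  by rewrite mem_filter mem_enum st (allP aW).
move=> aV jt jV.
have [ltd|td] := ltnP t d; last first.
  apply: IH => //; last exact: leq_trans td.
  by apply/allP => l _; apply: leq_trans td.
pose s := Ordinal ltd.
have ne_s (l : 'I_d) : (l < t.+1)%N -> l != s -> (l < t)%N.
  rewrite ltnS leq_eqVlt => /orP [/eqP e|//].
  by rewrite (_ : l = s) ?eqxx //; apply: val_inj.
have [ej|js] := eqVneq j s.
  subst j; apply: top => //; apply/allP => l lV; apply: ne_s; first exact: (allP aV).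
  by apply: contraNneq jV => <-.
have {}jt := ne_s _ jt js.
have [sV|sV] := boolP (s \in V); last first.
  apply: IH => //; apply/allP => l lV; apply: ne_s; first exact: (allP aV).
  by apply: contraNneq sV => <-.
pose W := [seq l <- V | l != s].
have aW : all (fun l : 'I_d => l < t)%N W.
  by apply/allP => l; rewrite mem_filter => /andP [ls lV]; apply: ne_s => //; apply: (allP aV).
have jW : j \notin W by rewrite mem_filter negb_and jV orbT.
have sVW : {subset V <= s :: W}.
  by move=> l lV; rewrite inE mem_filter lV andbT; case: eqVneq.
have sWV : {subset s :: W <= V}.
  by move=> l; rewrite inE mem_filter => /orP [/eqP ->|/andP []].
(* Exchange: x_j a = c x_s modulo W forces c = c' x_j modulo W, hence x_j (a - c' x_s) lies in W. *)
move=> a /(vid_sub sVW) /vid_cons [c hc]; apply: (vid_sub sWV).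
have /vid_cons [c' hc'] : vid (j :: W) c.
  apply: (top s) => //=; first by rewrite jt.
  apply/vid_cons; exists a.
  by rewrite -opprB (mulrC (x s)) (mulrC a); apply: midN.
apply/vid_cons; exists c'; apply: (IH _ _ aW jt jW).
rewrite (_ : x j * (a - c' * x s) = (x j * a - c * x s) + x s * (c - c' * x j)); last by ring.
by apply: midD => //; apply: midM.
Qed.

Lemma regular_permutable V j : j \notin V -> nzd_mod (vid V) (x j).
Proof. by apply: (@regular_permutable_bounded d); [apply/allP|]. Qed.

Lemma Wt_filter (p : pred ('I_d -> nat)) M :
  Wt M = (Wt (filter p M) + Wt (filter (predC p) M))%N.
Proof. by elim: M => [|m M IH] //=; rewrite Wt_cons IH; case: ifP => _ /=; rewrite Wt_cons; lia. Qed.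

Definition dec (l : 'I_d) m : 'I_d -> nat := fun j => (m j - (j == l))%N.

Lemma wt_dec l m : (wt (dec l m) + (0 < m l) = wt m)%N.
Proof.
rewrite /wt (bigD1 l) //= [in RHS](bigD1 l) //= {1}/dec eqxx.
rewrite (eq_bigr m); first by lia.
by move=> j /negbTE jl; rewrite /dec jl subn0.
Qed.

Lemma Wt_dec l M : (Wt (map (dec l) M) <= Wt M)%N.
Proof. by elim: M => [|m M IH] //=; rewrite /Wt /= leq_add // -[X in (_ <= X)%N](wt_dec l) leq_addr. Qed.

Lemma wt_gt0 m : reflect (exists l, 0 < m l)%N (0 < wt m)%N.
Proof.
rewrite lt0n /wt sum_nat_eq0 negb_forall.
by apply: (iffP existsP) => -[l h]; exists l; rewrite /= -?lt0n in h *.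
Qed.

Lemma mono_dec l m : (0 < m l)%N -> mono m = mono (dec l m) * x l.
Proof.
move=> h; rewrite -mono_del -monoD; apply: mono_ext => j.
by rewrite /dec /del subnK //; case: eqP => [->|].
Qed.

Let nzdP M j := all (fun m => m j == 0)%N M -> nzd_mod (mid M) (x j).

(** Sorting the generators by divisibility by x_l writes x_l a = b0 + x_l b1 with b0 in the part M0
    free of x_l. Then x_l (a - b1) lies in M0, where x_l cancels by hypothesis. *)
Lemma colon_step M l : nzdP [seq m <- M | m l == 0]%N l ->
  forall a, mid M (x l * a) -> mid (map (dec l) M) a.
Proof.
move=> H a ha.
pose M0 := [seq m <- M | m l == 0]%N; pose M1 := [seq m <- M | m l != 0]%N.

have split2 b : mid M b -> exists b0 b1, [/\ mid M0 b0, mid (map (dec l) M1) b1 & b = b0 + x l * b1].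
  rewrite /M0 /M1; elim: M b {H ha M0 M1} => [|m M IH] b /=.
    by move=> ->; exists 0, 0; rewrite mulr0 addr0.
  move=> [c /IH [b0 [b1 [h0 h1 e]]]]; case: eqP => ml /=.
    exists (b0 + c * mono m), b1; split=> //; first by exists c; rewrite addrK.
    by rewrite addrAC -e subrK.
  exists b0, (b1 + c * mono (dec l m)); split=> //; first by exists c; rewrite addrK.
  rewrite mulrDr addrA -e (mono_dec (l := l)) ?lt0n; last by apply/eqP.
  by ring.
have [b0 [b1 [h0 h1 e]]] := split2 _ ha.
have hab : mid M0 (a - b1).
  apply: H; first by rewrite filter_all.
  by rewrite mulrBr e addrK.
have sub0 : mid M0 (a - b1) -> mid (map (dec l) M) (a - b1).
  apply: mid_sub; rewrite /M0; elim: M {H ha M0 M1 split2 h0 h1 hab} => [|m M IH] //=.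
  have IH' : all (fun m0 => has (lem^~ m0) (dec l m :: map (dec l) M)) [seq m0 <- M | m0 l == 0%N].
    by apply: sub_all IH => m' /= ->; rewrite orbT.
  case: ifP => //= _; rewrite IH' andbT (_ : lem (dec l m) m) //.
  by apply/forallP => j; rewrite leq_subr.
have sub1 : mid (map (dec l) M1) b1 -> mid (map (dec l) M) b1.
  apply: mid_sub; rewrite /M1; elim: M {H ha M0 M1 split2 h0 h1 hab sub0} => [|m M IH] //=.
  have IH' : all (fun m0 => has (lem^~ m0) (dec l m :: map (dec l) M))
      (map (dec l) [seq m0 <- M | m0 l != 0%N]).
    by apply: sub_all IH => m' /= ->; rewrite orbT.
  by case: ifP => //= _; rewrite IH' lem_refl.
by rewrite -(subrK b1 a); apply: midD; [apply: sub0|apply: sub1].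
Qed.

Lemma mid_unit M a : has (fun m => wt m == 0)%N M -> mid M a.
Proof.
elim: M => [|m M IH] //= /orP [/eqP h|h].
  exists a; rewrite mono0 ?mulr1 ?subrr; first exact: mid0.
  by move=> j; move/eqP: h; rewrite /wt sum_nat_eq0 => /forallP /(_ j) /eqP.
by exists 0; rewrite mul0r subr0; apply: IH.
Qed.

Lemma wt1_del m : wt m = 1%N -> exists l, m =1 del l.
Proof.
move=> w1; have /wt_gt0 [l hl] : (0 < wt m)%N by rewrite w1.
exists l => j; have := wt_dec l m; rewrite hl w1 => /eqP; rewrite addn1 eqSS /wt sum_nat_eq0.
move=> /forallP /(_ j) /eqP; rewrite /dec /del.
by case: eqP => [->|_]; rewrite ?subn0 //; lia.
Qed.

Lemma mid_ext M M' a : all2 (fun m m' => lem m m' && lem m' m) M M' -> mid M a -> mid M' a.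
Proof.
move=> h; apply: mid_sub.
elim: M M' h => [|m M IH] [|m' M'] //= /andP [/andP [h1 h2] h3]; rewrite h2 /=.
by apply: sub_all (IH _ h3) => m'' /= ->; rewrite orbT.
Qed.

(** Induction on the total degree of M. Generators of degree one are covered by permutability.
    Otherwise some x_l divides a generator of degree at least two; with M0 the generators free of
    x_l, both M0 + (x_l) and (M : x_l) have generators of smaller total degree. The first gives a =
    c x_l modulo M0, the second handles c. *)
Lemma mono_regular M j : nzdP M j.
Proof.
have [k le_k] := ubnP (Wt M); elim: k M j le_k => [|k IH] M j // le_k aM a ha.
have [h0|h0] := boolP (has (fun m => wt m == 0)%N M); first exact: mid_unit.
have [h2|h2] := boolP (has (fun m => 1 < wt m)%N M); last first.
  have [V [hV jV]] : exists V, all2 (fun m m' => lem m m' && lem m' m) M (map del V) /\ j \notin V.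
    move: aM h0 h2; elim: M {le_k ha} => [|m M IHM] /=; first by exists [::].
    move=> /andP [mj aM]; rewrite !negb_or => /andP [m0 h0] /andP [m1 h2].
    have [V [hV jV]] := IHM aM h0 h2.
    have /wt1_del [l hl] : wt m = 1%N by lia.
    exists (l :: V) => /=; rewrite inE negb_or jV hV !andbT.
    split; first by apply/andP; split; apply/forallP => i; rewrite hl.
    by apply: contraTneq mj => ->; rewrite hl /del eqxx.
  have hV' : all2 (fun m m' => lem m m' && lem m' m) (map del V) M.
    by move: hV; elim: M (map del V) {aM le_k ha h0 h2} => [|m M IHM] [|m' M'] //= /andP [/andP [h1 h2] /IHM ->]; rewrite h1 h2.
  by apply: (mid_ext hV'); apply: (regular_permutable jV); apply: (mid_ext hV).
have [l hl] : exists l, has (fun m => (0 < m l) && (1 < wt m))%N M.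
  elim: M {le_k aM ha h0} h2 => [|m M IHM] //= /orP [h|/IHM [l hl]]; last by exists l; rewrite hl orbT.
  have /wt_gt0 [l hl] : (0 < wt m)%N by lia.
  by exists l; rewrite hl h.
pose M0 := [seq m <- M | m l == 0]%N; pose M1 := [seq m <- M | predC (fun m => m l == 0) m]%N.
have wM : Wt M = (Wt M0 + Wt M1)%N by apply: Wt_filter.
(* More than 1, so that trading the generators divisible by x_l for x_l itself lowers the total
   degree. *)
have w1 : (1 < Wt M1)%N.
  rewrite /M1; elim: M hl {wM M0 M1 le_k aM ha h0 h2} => [|m M IHM] //=.
  case: (m l) => [|ml] /=; first exact: IHM.
  by rewrite Wt_cons; case/orP=> [h|/IHM /= h]; lia.
have jl : j != l.
  apply: contraTneq hl => <-; rewrite -all_predC; apply: sub_all aM => m /= /eqP ->.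
  by rewrite ltnn.
have sM0 b : mid M0 b -> mid M b.
  apply: mid_sub; rewrite /M0; elim: (M) => [|m N IHN] //=.
  case: ifP => //= _; rewrite ?lem_refl /=;
  by apply: sub_all IHN => m' /= ->; rewrite orbT.
have aM0 : all (fun m => m j == 0)%N M0.
  by rewrite /M0; elim: (M) aM => [|m N IHN] //= /andP [h1 /IHN h]; case: ifP => //= _; rewrite h1 h.
have aD : all (fun m => m j == 0)%N (map (dec l) M).
  by elim: (M) aM => [|m N IHN] //= /andP [/eqP h1 /IHN h]; rewrite /dec h1 h.
have hdel : mid (del l :: M0) a.
  apply: (IH _ j).
  - rewrite Wt_cons; have := wt_dec l (del l).
    rewrite {2}/del eqxx /= (_ : wt (dec l (del l)) = 0%N); first by lia.
    by apply: big1 => i _; rewrite /dec /del subnn.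
  - by rewrite /= aM0 /del (negbTE jl).
  - apply: mid_sub ha; rewrite /M0; elim: (M) => [|m N IHN] //=.
    have IHN' : all (fun m0 => has (lem^~ m0) (del l :: m :: [seq m <- N | m l == 0%N])) N.
      by apply: sub_all IHN => m' /= /orP [->|->]; rewrite ?orbT.
    case: ifP => [h|/negbT h] /=.
      by rewrite lem_refl orbT /=.
    have -> : lem (del l) m by apply/forallP => i; rewrite /del; case: eqP => // ->; rewrite lt0n.
    by [].
move: hdel => /= [c hc]; rewrite mono_del in hc.
have hjc : mid (map (dec l) M) (x j * c).
  apply: colon_step.
    by apply: IH; rewrite -/M0; lia.
  rewrite (_ : x l * _ = x j * a - x j * (a - c * x l)); last by ring.
  by apply: midB => //; apply: midM; apply: sM0.
have {}hc' : mid (map (dec l) M) c.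
  apply: (IH _ j) => //.
  suff : (Wt (map (dec l) M) < Wt M)%N by lia.
  elim: (M) hl => [|m N IHN] //=; rewrite !Wt_cons.
  have := Wt_dec l N; have := wt_dec l m; case: (m l) => [|ml] /=; first by move=> ? _ /IHN; lia.
  by move=> ? ? _; lia.
rewrite -(subrK (c * x l) a); apply: midD; first exact: sM0.
elim: (M) c hc' {hc hjc} => [|m N IHN] c /=; first by move=> ->; rewrite mul0r.
move=> [r h]; have [h0'|h0'] := posnP (m l).
  exists (r * x l); rewrite -(mono_ext (m := dec l m)); last first.
    by move=> i; rewrite /dec; case: eqP => [->|]; rewrite ?h0' ?subn0.
  by rewrite (_ : _ - _ = (c - r * mono (dec l m)) * x l); [apply: IHN | ring].
by exists r; rewrite (mono_dec h0') mulrA -mulrBl; apply: IHN.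
Qed.

Lemma mid_colon_var M l a : mid M (x l * a) -> mid (map (dec l) M) a.
Proof. by apply: colon_step; apply: mono_regular. Qed.

Definition sube b m : 'I_d -> nat := fun j => (m j - b j)%N.

Lemma mid_colon M b a : mid M (mono b * a) -> mid (map (sube b) M) a.
Proof.
have [k le_k] := ubnP (wt b); elim: k b M a le_k => [|k IH] b M a // le_k.
have [w0|/wt_gt0 [l hl]] := posnP (wt b).
  have b0 j : b j = 0%N.
    by move/eqP: w0; rewrite /wt sum_nat_eq0 => /forallP /(_ j) /eqP.
  rewrite mono0 // mul1r; apply: mid_ext; elim: M => [|m M IHM] //=.
  by rewrite IHM andbT; apply/andP; split; apply/forallP => j; rewrite /sube b0 subn0.
rewrite (_ : _ * a = x l * (mono (dec l b) * a)); last by rewrite (mono_dec hl); ring.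
move=> /mid_colon_var h.
have wb : (wt (dec l b) < k)%N by have := wt_dec l b; rewrite hl; lia.
have {}h := IH _ _ _ wb h.
apply: mid_ext h; elim: M => [|m M IHM] //=.
rewrite IHM andbT; apply/andP; split; apply/forallP => j; rewrite /sube /dec;
by case: eqP => [->|_] //=; rewrite ?subn0; lia.
Qed.

Variables (k : fieldType) (res : {rmorphism Q -> k}).
Hypothesis Hres : forall j, res (x j) = 0.

Lemma res_mono m : res (mono m) = (wt m == 0%N)%:R.
Proof.
have [w0|/wt_gt0 [l hl]] := posnP (wt m).
  rewrite mono0 ?rmorph1 ?w0 // => j.
  by move/eqP: w0; rewrite /wt sum_nat_eq0 => /forallP /(_ j) /eqP.
by rewrite (mono_dec hl) rmorphM Hres mulr0.
Qed.

Lemma mid_res M a : ~~ has (fun m => wt m == 0)%N M -> mid M a -> res a = 0.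
Proof.
elim: M a => [|m M IH] a /=; first by move=> _ ->; rewrite rmorph0.
rewrite negb_or => /andP [m0 h] [c /(IH _ h)] /eqP.
by rewrite rmorphB rmorphM res_mono (negbTE m0) mulr0 subr0 => /eqP.
Qed.

(** The colon ideal is generated by the quotients m / gcd (m, b), none of which is a unit when no m
    divides b. With c = 1 this decides divisibility between monomials. *)
Lemma mid_mono_res M b c : mid M (mono b * c) -> ~~ has (lem^~ b) M -> res c = 0.
Proof.
move=> /mid_colon h hM; apply: mid_res h.
elim: M hM => [|m M IH] //=; rewrite !negb_or => /andP [h1 /IH ->]; rewrite andbT.
apply: contra h1; rewrite /wt sum_nat_eq0 => /forallP h; apply/forallP => j.
by have /eqP := h j; rewrite /sube; lia.
Qed.

End MonomialIdeals.

Lemma sum_delta (R : pzRingType) (I : finType) (i : I) (F : I -> R) :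
  \sum_j (j == i)%:R * F j = F i.
Proof. by rewrite (bigD1 i) //= eqxx mul1r big1 ?addr0 // => j /negbTE ->; rewrite mul0r. Qed.

(** * Nakayama's lemma in the local and in the graded case *)

Section MonomialSpan.
Variables (Q : comUnitRingType) (d : nat) (x : 'I_d -> Q).

Lemma mid_span n (E : 'I_n -> 'I_d -> nat) (p : pred 'I_n) a :
  mid x [seq E i | i <- enum 'I_n & p i] a <->
  exists c, a = \sum_(i < n | p i) c i * mono x (E i).
Proof.
split=> [|[c ->]]; last first.
  apply: mid_sum => i pi; apply: mid_gen; rewrite has_map; apply/hasP.
  by exists i; [rewrite mem_filter pi mem_enum | exact: lem_refl].
have : all p [seq i <- enum 'I_n | p i] by apply: filter_all.
elim: [seq i <- enum 'I_n | p i] a => [|i s IH] a /=.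
  by move=> _ ->; exists (fun=> 0); rewrite big1 // => i _; rewrite mul0r.
move=> /andP [pi ps] [c /(IH _ ps) [c' e]].
exists (fun j => c' j + (if j == i then c else 0)).
rewrite (eq_bigr (fun j => c' j * mono x (E j) +
   (if j == i then c else 0) * mono x (E j))); last by move=> j _; rewrite mulrDl.
rewrite big_split /= -e (bigD1 i) //= eqxx [X in _ + (_ + X)]big1 ?addr0 ?subrK //.
by move=> j /andP [_ /negbTE ->]; rewrite mul0r.
Qed.

Lemma span_mod0 (n : nat) (g : 'I_n -> Q) p a :
  span_mod (fun a => a = 0) g p a <-> exists c, a = \sum_(i < n | p i) c i * g i.
Proof.
split=> [[b [-> [c ->]]]|[c ->]]; first by exists c; rewrite add0r.
by exists 0; split=> //; exists c; rewrite add0r.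
Qed.

Lemma vid_span (p : pred 'I_d) a :
  vid x [seq l : 'I_d <- enum 'I_d | p l] a <->
  span_mod (fun a => a = 0) x p a.
Proof.
rewrite span_mod0 /vid mid_span.
by split=> -[c ->]; exists c; apply: eq_bigr => i _; rewrite mono_del.
Qed.

Lemma initial_regularP : regular_seq x -> initial_regular x.
Proof. by move=> [h _] s a /vid_span /h /vid_span. Qed.

(** Determinant trick: the colon ideal has finitely many generators g, the hypothesis reads g = x_l
    c g modulo V for a matrix c, and 1 - x_l c has determinant 1 in the residue field. *)
Lemma nakayama_local (k : fieldType) (res : {rmorphism Q -> k}) :
  noetherian Q -> (forall a, (a \is a GRing.unit) = (res a != 0)) ->
  (forall j, res (x j) = 0) -> nakayama_vid x.
Proof.
move=> nQ uQ x0 V l s H a ha.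
pose K a := vid x V (x s * a).
have iK : ideal K.
  split=> [|b c hb hc|r b hb]; rewrite /K.
  - by rewrite mulr0; apply: mid0.
  - by rewrite mulrDr; apply: midD.
  - by rewrite mulrCA; apply: midM.
have [r [g gK]] := nQ K iK.
have Kg i : K (g i).
  apply/gK; exists (fun j => (j == i)%:R).
  by rewrite sum_delta.
have /choice [c hc] : forall i, exists c : 'I_r -> Q, vid x V (g i - x l * \sum_j c j * g j).
  by move=> i; have [a1 [/gK [c ->] h]] := H _ (Kg i); exists c.
pose B : 'M[Q]_r := 1%:M - x l *: \matrix_(i, j) c i j.
pose gc : 'cV[Q]_r := \col_i g i.
have Bg i : vid x V ((B *m gc) i 0).
  rewrite mulmxBl mul1mx -scalemxAl !mxE.
  by rewrite (eq_bigr (fun j => c i j * g j)) // => j _; rewrite !mxE.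
have uB : \det B \is a GRing.unit.
  rewrite uQ -det_map_mx /B map_mxB map_mx1 map_mxZ x0 scale0r subr0 det1.
  exact: oner_neq0.
have vg i : vid x V (g i).
  have : vid x V (\det B * g i).
    have -> : \det B * g i = (\adj B *m (B *m gc)) i 0.
      rewrite mulmxA mul_adj_mx mul_scalar_mx.
      by rewrite [RHS]mxE [gc i 0]mxE.
    by rewrite mxE; apply: mid_sum => j _; apply: midM; apply: Bg.
  by move=> /(midM (\det B)^-1); rewrite mulKr.
have /gK [c' ->] : K a by [].
by apply: mid_sum => i _; apply: midM; apply: vg.
Qed.

End MonomialSpan.

Section GradedNakayama.
Variables (k : fieldType) (N : nat) (w : 'I_N -> nat).
Hypothesis w_gt0 : forall i, (0 < w i)%N.
Let Q := {mpoly k[N]}.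

(* p |-> p(t^w_1 X_1, ..., t^w_N X_N): the coefficient of t^D is the
   component of weighted degree D. *)
Definition wsplit : Q -> {poly Q} :=
  mmap (polyC \o mpolyC N (R := k)) (fun i => ('X_i)%:P * 'X^(w i)).
HB.instance Definition _ := GRing.RMorphism.on wsplit.

Definition wdeg (m : 'X_{1..N}) := (\sum_(i < N) w i * m i)%N.

Lemma wsplitX m : wsplit 'X_[m] = ('X_[m])%:P * 'X^(wdeg m).
Proof.
rewrite /wsplit mmapX /mmap1 mpolyXE_id rmorph_prod /=.
rewrite (eq_bigr (fun i => ('X_i ^+ m i)%:P * 'X^(w i * m i))); last first.
  by move=> i _; rewrite exprMn rmorphXn /= -exprM.
rewrite big_split /=; congr (_ * _).
by rewrite /wdeg; elim/big_rec2: _ => [|i y z _ e]; rewrite ?expr0 // exprD -e.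
Qed.

Lemma wsplit_homog p D : (forall m, m \in msupp p -> wdeg m = D) ->
  wsplit p = p%:P * 'X^D.
Proof.
move=> h; transitivity (\sum_(m <- msupp p) (p@_m *: 'X_[m])%:P * 'X^D); last first.
  by rewrite -mulr_suml -rmorph_sum -mpolyE.
rewrite {1}(mpolyE p) rmorph_sum /=; apply: eq_big_seq => m /h <-.
rewrite -!mul_mpolyC !rmorphM /= wsplitX mulrA; congr (_ * _ * _).
by rewrite /wsplit mmapC.
Qed.

Lemma wsplit_horner1 p : (wsplit p).[1] = p.
Proof.
rewrite (mpolyE p) rmorph_sum /= horner_sum; apply: eq_bigr => m _.
rewrite -!mul_mpolyC !rmorphM /= wsplitX /wsplit mmapC /= hornerM hornerC hornerM hornerC.
by rewrite hornerXn expr1n mulr1.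
Qed.

(** Iterating the hypothesis puts a in V + x_l^M K for every M, with K the colon ideal. As V is
    homogeneous and x_l has positive degree, every component of a of degree below M lies in V. The
    element a itself is not assumed homogeneous. *)
Lemma nakayama_graded d (x : 'I_d -> Q) :
  (forall j, whomog w (x j)) -> (forall j, (x j)@_0%MM = 0) -> nakayama_vid x.
Proof.
move=> hx x0.
have hx' j : exists D, wsplit (x j) = (x j)%:P * 'X^(D.+1).
  have [D hD] := hx j.
  (* For x_j = 0 any positive degree will do. *)
  have [xj0|xj0] := eqVneq (x j) 0; first by exists 0%N; rewrite xj0 rmorph0 mul0r.
  have := mlead_supp xj0 => hm.
  have m0 : mlead (x j) != 0%MM.
    by apply: contraTneq hm => ->; rewrite mcoeff_msupp x0 eqxx.
  have D0 : (0 < D)%N.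
    rewrite -(hD _ hm) lt0n sum_nat_eq0 negb_forall.
    move: m0; apply: contraNT; rewrite negb_exists => /forallP h.
    apply/eqP/mnmP => i; have := h i; rewrite /= negbK mnm0E muln_eq0.
    by have := w_gt0 i; case: (w i) => // ? _ /= /eqP.
  exists D.-1; rewrite prednK //; exact: wsplit_homog.
have piV V D c : vid x V c -> vid x V ((wsplit c)`_D).
  elim: V c => [|l V IH] c.
    by rewrite /vid /= => ->; rewrite rmorph0 coef0.
  move=> /vid_cons [c' /IH h]; apply/vid_cons.
  have [e he] := hx' l.
  move: h; rewrite rmorphB rmorphM /= coefB he mulrA coefMXn coefMC.
  case: ltnP => _ h; first by exists 0; rewrite mul0r.
  by exists (wsplit c')`_(D - e.+1).
move=> V l s H a ha.
have iter_ M : exists aM, vid x V (x s * aM) /\ vid x V (a - x l ^+ M * aM).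
  elim: M => [|M [aM [h1 h2]]].
    by exists a; rewrite expr0 mul1r subrr; split=> //; apply: mid0.
  have [b [h3 h4]] := H _ h1; exists b; split=> //.
  rewrite (_ : a - _ = (a - x l ^+ M * aM) + x l ^+ M * (aM - x l * b)).
    by apply: midD => //; apply: midM.
  by rewrite exprS; ring.
(* For this exponent the term x_l^M aM has no component in the degrees that occur in a. *)
have [aM [_ hM]] := iter_ (size (wsplit a)).
rewrite -(wsplit_horner1 a) horner_coef; apply: mid_sum => D _.
rewrite expr1n mulr1.
have := piV _ D _ hM; rewrite rmorphB rmorphM rmorphXn /= coefB.
have [e ->] := hx' l.
rewrite exprMn -exprM mulrAC coefMXn.
have -> : (D < e.+1 * size (wsplit a))%N.
  by apply: leq_trans (ltn_ord D) _; rewrite leq_pmull.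
by rewrite subr0.
Qed.

End GradedNakayama.

Section Presentation.
Variables (k : fieldType) (n : nat) (P : monomial_presentation k n).
Local Notation x := (@mp_x k n P).
Local Notation res := (mp_res P).
Local Notation a := (mp_exp P).

Lemma mp_nakayama : nakayama_vid x.
Proof.
case: P => Q res0 hom I d x0 a0 f pres hx x00 _ _ /=.
case: pres x0 f hx x00 => [R resR Q' res' I' _ _ [[_ uQ] nQ _] _ _ _|N w I' /= w0 _ _] x0 f hx x00.
  exact: nakayama_local x00.
exact: nakayama_graded.
Qed.

Lemma mp_initial_regular : initial_regular x.
Proof. exact: initial_regularP (@mp_x_regular _ _ P). Qed.

Lemma mp_fE i : mp_f P i = mono x (a i).
Proof. by []. Qed.

Lemma mp_ideal_mid q : mp_ideal P q <-> mid x [seq (a i : 'I_(mp_length P) -> nat) | i <- enum 'I_n] q.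
Proof.
have [g _] := @mp_f_generates _ _ P; rewrite g.
have := @mid_span _ _ x n (fun i => a i) xpredT q.
by rewrite filter_predT => ->.
Qed.

Lemma mp_ideal_res2 q : mp_ideal P q -> ideal_pow (res_ker res) 2 q.
Proof.
case: P q => Q res0 hom I d x0 a0 f pres hx x00 _ _ /=.
by case: pres x0 f hx x00 => [R resR Q' res' I' _ _ _ _ h _|N w I' /= w0 _ h] *; apply: h.
Qed.

Lemma mp_hom_prod (I : Type) (r : seq I) (F : I -> mp_ring P) :
  (forall i, mp_hom P (F i)) -> mp_hom P (\prod_(i <- r) F i).
Proof.
case: P F => Q res0 hom J d x0 a0 f pres hx x00 _ _ /=.
case: pres x0 f hx x00 => [//|N w I' /= _ _ _] _ _ _ _ F hF.
elim: r => [|i r [D IH]].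
  rewrite big_nil; exists 0%N => m; rewrite msupp1 inE => /eqP ->.
  by apply: big1 => i _; rewrite mnm0E muln0.
rewrite big_cons; have [D' hD'] := hF i; exists (D' + D)%N => m /msuppM_le /allpairsP [[m1 m2] /= [h1 h2 ->]].
rewrite -(hD' _ h1) -(IH _ h2) -big_split; apply: eq_bigr => j _.
by rewrite mnmDE mulnDr.
Qed.

End Presentation.
Import Order.TTheory Num.Theory.

(** * Complexes of free modules *)

Section Homogeneous.
Variable A : comNzRingType.

Definition homg (N M : nat) (degX : 'I_N -> int) (degY : 'I_M -> int) (s : int)
    (Z : 'M[A]_(N, M)) :=
  forall x y, degY y != degX x + s -> Z x y = 0.

Definition hgeq (N M : nat) (degX : 'I_N -> int) (degY : 'I_M -> int) (s : int)
    (Z : 'M[A]_(N, M)) :=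
  forall x y, degY y < degX x + s -> Z x y = 0.

Definition hrow (M : nat) (degY : 'I_M -> int) (i : int) (v : 'rV[A]_M) :=
  forall y, degY y != i -> v 0 y = 0.

Section Ops.
Variables (N M L : nat) (dX : 'I_N -> int) (dY : 'I_M -> int) (dW : 'I_L -> int).

Lemma homg0 s : homg dX dY s 0. Proof. by move=> x y _; rewrite mxE. Qed.

Lemma homgD s Z W : homg dX dY s Z -> homg dX dY s W -> homg dX dY s (Z + W).
Proof. by move=> h1 h2 x y e; rewrite mxE h1 // h2 // addr0. Qed.

Lemma homgZ s c Z : homg dX dY s Z -> homg dX dY s (c *: Z).
Proof. by move=> h1 x y e; rewrite mxE h1 // mulr0. Qed.

Lemma homgB s Z W : homg dX dY s Z -> homg dX dY s W -> homg dX dY s (Z - W).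
Proof. by move=> h1 h2; rewrite -scaleN1r; apply: homgD => //; apply: homgZ. Qed.

Lemma homgM s t Z W : homg dX dY s Z -> homg dY dW t W -> homg dX dW (s + t) (Z *m W).
Proof.
move=> h1 h2 x y e; rewrite mxE big1 // => u _.
have [eu|/h1 ->] := eqVneq (dY u) (dX x + s); last by rewrite mul0r.
by rewrite h2 ?mulr0 // eu -addrA.
Qed.

Lemma homgE s t Z : homg dX dY s Z -> s = t -> homg dX dY t Z.
Proof. by move=> h <-. Qed.

Lemma homg_hgeq s r Z : (r <= s)%R -> homg dX dY s Z -> hgeq dX dY r Z.
Proof. by move=> rs h x y e; apply: h; apply/eqP; lia. Qed.

Lemma hgeqD s Z W : hgeq dX dY s Z -> hgeq dX dY s W -> hgeq dX dY s (Z + W).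
Proof. by move=> h1 h2 x y e; rewrite mxE h1 // h2 // addr0. Qed.

Lemma hgeqZ s c Z : hgeq dX dY s Z -> hgeq dX dY s (c *: Z).
Proof. by move=> h1 x y e; rewrite mxE h1 // mulr0. Qed.

Lemma hgeqB s Z W : hgeq dX dY s Z -> hgeq dX dY s W -> hgeq dX dY s (Z - W).
Proof. by move=> h1 h2; rewrite -scaleN1r; apply: hgeqD => //; apply: hgeqZ. Qed.

Lemma hgeqW s r Z : (r <= s)%R -> hgeq dX dY s Z -> hgeq dX dY r Z.
Proof. by move=> rs h x y e; apply: h; lia. Qed.

Lemma hgeqM s t Z W : hgeq dX dY s Z -> hgeq dY dW t W -> hgeq dX dW (s + t) (Z *m W).
Proof.
move=> h1 h2 x y e; rewrite mxE big1 // => u _.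
have [eu|/h1 ->] := lerP (dX x + s) (dY u); last by rewrite mul0r.
by rewrite h2 ?mulr0 //; lia.
Qed.

Lemma homg_row s Z x : homg dX dY s Z -> hrow dY (dX x + s) (row x Z).
Proof. by move=> h y e; rewrite mxE h. Qed.

Lemma hrowD i v w : hrow dY i v -> hrow dY i w -> hrow dY i (v + w).
Proof. by move=> h1 h2 y e; rewrite mxE h1 // h2 // addr0. Qed.

Lemma hrowZ i c v : hrow dY i v -> hrow dY i (c *: v).
Proof. by move=> h1 y e; rewrite mxE h1 // mulr0. Qed.

Lemma hrowM i s v Z : hrow dX i v -> homg dX dY s Z -> hrow dY (i + s) (v *m Z).
Proof.
move=> h1 h2 y e; rewrite mxE big1 // => u _.
have [eu|/h1 ->] := eqVneq (dX u) i; last by rewrite mul0r.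
by rewrite h2 ?mulr0 // eu.
Qed.

End Ops.

Lemma homg1 N (dX : 'I_N -> int) : homg dX dX 0 1%:M.
Proof. by move=> x y; rewrite addr0 mxE; case: (eqVneq x y) => // ->; rewrite eqxx. Qed.

Lemma row_mulmx_eq N M (dX : 'I_N -> int) s (D : 'M[A]_N) (W W' : 'M[A]_(N, M)) x :
  homg dX dX s D -> (forall y, dX y = dX x + s -> row y W = row y W') ->
  row x (D *m W) = row x (D *m W').
Proof.
move=> h e; apply/rowP => j; rewrite !mxE; apply: eq_bigr => y _.
have [ey|/h ->] := eqVneq (dX y) (dX x + s); last by rewrite !mul0r.
by have /rowP /(_ j) := e y ey; rewrite !mxE => ->.
Qed.

(* A bounded complex of free modules of finite rank as a single square matrix
   acting on rows, together with the degrees of the basis vectors. *)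
Record gcx := Gcx {
  gn : nat;
  gdeg : 'I_gn -> int;
  gd : 'M[A]_gn;
  gd_hom : homg gdeg gdeg (-1) gd;
  gd_sq : gd *m gd = 0
}.

Local Notation ghom X Y := (homg (gdeg (g := X)) (gdeg (g := Y))).
Local Notation ghge X Y := (hgeq (gdeg (g := X)) (gdeg (g := Y))).
Local Notation grow X := (hrow (gdeg (g := X))).

Definition exact_at (Y : gcx) (i : int) := forall v, grow Y i v ->
  v *m gd Y = 0 -> exists w, grow Y (i + 1) w /\ w *m gd Y = v.

Definition acyclic (Y : gcx) := forall i, i != 0 -> exact_at Y i.

Lemma gdeg_bounded (X : gcx) : exists b : nat, forall x : 'I_(gn X),
  (- (b%:Z) < gdeg x) /\ (gdeg x < b%:Z).
Proof.
exists (\max_(x : 'I_(gn X)) `|gdeg x|%N).+1 => x.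
have := @leq_bigmax _ (fun x : 'I_(gn X) => `|gdeg x|%N) x.
by set m := (\max_ _ _)%N => h; split; lia.
Qed.

Section Lift.
Variables (X Y : gcx).
Local Notation dX := (gd X).
Local Notation dY := (gd Y).
Local Notation degX := (gdeg (g := X)).
Local Notation degY := (gdeg (g := Y)).
Variables (s : int) (sg : A).
Hypothesis sg2 : sg * sg = 1.

(** The common construction behind contractions, comparison maps and homotopies. H is built in
    increasing degree: a row of Z - dX H is a cycle by the relation for Z and the rows already
    built, and exactness of Y supplies the next row. In degree [lo] a preimage is assumed instead,
    because Y may have homology there. *)
Lemma lift_rows (Z : 'M[A]_(gn X, gn Y)) (lo : int) (t : nat) :
  homg degX degY s Z -> dX *m Z + sg *: (Z *m dY) = 0 ->
  (forall x, degX x < lo -> row x Z = 0) ->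
  (forall x, degX x = lo -> exists w, hrow degY (lo + s + 1) w /\ w *m dY = row x Z) ->
  (forall x, lo < degX x -> degX x < lo + t%:Z -> exact_at Y (degX x + s)) ->
  exists H : 'M[A]_(gn X, gn Y), [/\ homg degX degY (s + 1) H,
    (forall x, degX x < lo -> row x H = 0),
    (forall x, lo + t%:Z <= degX x -> row x H = 0) &
    (forall x, degX x < lo + t%:Z -> row x Z = row x (dX *m H - sg *: (H *m dY)))].
Proof.
move=> hZ cZ Z0 Zlo; have ZdY : Z *m dY = - (sg *: (dX *m Z)).
  move/eqP: cZ; rewrite addr_eq0 => /eqP ->.
  by rewrite scalerN scalerA sg2 scale1r opprK.
elim: t => [|t IH] Yex.
  exists 0; split=> [||x _|x]; first exact: homg0.
  - by move=> x _; apply/rowP => j; rewrite !mxE.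
  - by apply/rowP => j; rewrite !mxE.
  by rewrite addr0 mulmx0 mul0mx scaler0 subr0 => /Z0 ->; apply/rowP => j; rewrite !mxE.
have [|H [hH H0 H1 H2]] := IH; first by move=> x h1 h2; apply: Yex => //; lia.
have step x : exists w : 'rV[A]_(gn Y), degX x = lo + t%:Z ->
    hrow degY (degX x + s + 1) w /\ w *m dY = row x (Z - dX *m H).
  have [ex|nx] := eqVneq (degX x) (lo + t%:Z); last by exists 0 => e; rewrite e eqxx in nx.
  have [t0|t_gt0] := posnP t.
    have [w [hw e]] : exists w, hrow degY (lo + s + 1) w /\ w *m dY = row x Z.
      by apply: Zlo; rewrite ex t0 addr0.
    exists w => _; split; first by rewrite ex t0 addr0.
    rewrite e; apply/rowP => j; rewrite !mxE big1 ?subr0 // => y _.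
    have [ey|/(@gd_hom X) ->] := eqVneq (degX y) (degX x + -1); last by rewrite mul0r.
    have /rowP /(_ j) : row y H = 0 by apply: H0; lia.
    by rewrite !mxE => ->; rewrite mulr0.
  have [||||w [hw e]] := Yex x _ _ (row x (Z - dX *m H)); try lia.
  - apply: homg_row; apply: homgB => //.
    by apply: homgE (homgM (@gd_hom X) hH) _; lia.
  - rewrite -row_mul mulmxBl ZdY.
    have -> : row x (- (sg *: (dX *m Z)) - dX *m H *m dY) =
              - (sg *: row x (dX *m Z)) - row x (dX *m H *m dY).
      by rewrite linearB /= linearN /= [row x (_ *: _)]linearZ.
    rewrite (row_mulmx_eq (W' := dX *m H - sg *: (H *m dY)) (@gd_hom X)); last first.
      by move=> y ey; apply: H2; lia.
    rewrite mulmxBr mulmxA gd_sq mul0mx sub0r -scalemxAr [row x (- _)]linearN /= [row x (_ *: _)]linearZ /= scalerN opprK scalerA sg2 scale1r.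
    by rewrite mulmxA subrr.
  by exists w.
have [w hw] := choice step.
(* With this sign the new row contributes + w dY to dX H' - sg H' dY. *)
pose H' : 'M[A]_(gn X, gn Y) :=
  \matrix_x (if degX x == lo + t%:Z then - (sg *: w x) else row x H).
have rowH' x : row x H' = if degX x == lo + t%:Z then - (sg *: w x) else row x H.
  by rewrite rowK.
have H'H x y : degX y = degX x + -1 -> degX x < lo + t.+1%:Z -> row y H' = row y H.
  by move=> e lx; rewrite rowH'; case: eqP => // ey; lia.
exists H'; split=> [x y ne|x lx|x lx|x lx].
- have -> : H' x y = row x H' 0 y by rewrite [RHS]mxE.
  rewrite rowH'; case: eqP => [ex|_]; last by rewrite mxE hH.
  have [hwx _] := hw x ex.
  by rewrite !mxE hwx ?mulr0 ?oppr0 // -addrA.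
- by rewrite rowH'; case: eqP => [ex|_]; [lia | apply: H0].
- by rewrite rowH'; case: eqP => [ex|_]; [lia | apply: H1; lia].
have -> : row x (dX *m H' - sg *: (H' *m dY)) = row x (dX *m H') - sg *: (row x H' *m dY).
  by rewrite linearB /= [row x (_ *: _)]linearZ /= (row_mul x H').
rewrite (row_mulmx_eq (W' := H) (@gd_hom X)); last by move=> y ey; apply: (H'H x).
rewrite rowH'; case: eqP => [ex|nx].
  have [_ e] := hw x ex.
  by rewrite mulNmx -scalemxAl e scalerN scalerA sg2 scale1r opprK linearB /= addrC subrK.
by rewrite H2; [rewrite linearB /= [row x (_ *: _)]linearZ /= (row_mul x H) | lia].
Qed.

End Lift.

(** A bounded complex vanishes far below, so its negative part contracts step by step. By the last
    conclusion 1 - d h projects the degree 0 part onto its cycles; this makes up for the possible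
    presence of negative degrees. *)
Lemma negative_contraction (X : gcx) : acyclic X ->
  exists h : 'M[A]_(gn X), ghom X X 1 h /\
    (forall x, gdeg x < 0 -> row x 1%:M = row x (gd X *m h + h *m gd X)) /\
    forall x, gdeg x = 0 -> row x (1%:M - gd X *m h) *m gd X = 0.
Proof.
move=> aX; have [b hb] := gdeg_bounded X.
have [|||x e|x h1 h2|h [hh _ _ e]] := @lift_rows X X 0 (-1) _ 1%:M (- b%:Z) b (@homg1 _ _).
- by rewrite mulrNN mulr1.
- by rewrite mulmx1 mul1mx scaleN1r subrr.
- by move=> x; have := hb x; lia.
- by have := hb x; lia.
- by rewrite addr0; apply: aX; apply/eqP; lia.
exists h; split; first by rewrite add0r in hh.
have ch x : gdeg x < 0 -> row x 1%:M = row x (gd X *m h + h *m gd X).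
  by move=> lx; rewrite e ?scaleN1r ?opprK //; lia.
split=> // x ex; rewrite -row_mul mulmxBl mul1mx -mulmxA linearB /=.
rewrite [X in _ - X](row_mulmx_eq (W' := 1%:M - gd X *m h) (@gd_hom X)).
  by rewrite mulmxBr mulmx1 mulmxA gd_sq mul0mx subr0 subrr.
move=> y ey; rewrite linearB /= ch; last by rewrite ey ex.
by rewrite linearD /= addrC addKr.
Qed.

Section NullHomotopy.
Variables (X Y : gcx).
Hypotheses (aX : acyclic X) (aY : acyclic Y).
Local Notation dX := (gd X).
Local Notation dY := (gd Y).
Local Notation degX := (gdeg (g := X)).
Local Notation degY := (gdeg (g := Y)).

(** Subtracting the homotopy given by h Z makes Z vanish in negative degrees, so that the lifting
    starts in degree 0. Its target there has degree s, where Y is exact unless s = 0; only then must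
    Z be zero on H_0. *)
Lemma null_homotopy (s : int) (sg : A) (Z : 'M[A]_(gn X, gn Y)) :
  sg * sg = 1 -> 0 <= s -> homg degX degY s Z -> dX *m Z + sg *: (Z *m dY) = 0 ->
  (s = 0 -> forall v, hrow degX 0 v -> v *m dX = 0 ->
     exists w, hrow degY 1 w /\ w *m dY = v *m Z) ->
  exists H, homg degX degY (s + 1) H /\ Z = dX *m H - sg *: (H *m dY).
Proof.
move=> sg2 s0 hZ cZ Z_H0.
have ZdY : Z *m dY = - (sg *: (dX *m Z)).
  move/eqP: cZ; rewrite addr_eq0 => /eqP ->.
  by rewrite scalerN scalerA sg2 scale1r opprK.
have [h [hh [ch cyc]]] := negative_contraction aX.
have [b hb] := gdeg_bounded X.
pose Z' := Z - (dX *m (h *m Z) - sg *: (h *m Z *m dY)).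
have hhZ : homg degX degY (s + 1) (h *m Z) by rewrite addrC; apply: homgM hh hZ.
have hZ' : homg degX degY s Z'.
  apply: homgB => //; apply: homgB.
    by apply: homgE (homgM (@gd_hom X) hhZ) _; lia.
  by apply: homgZ; apply: homgE (homgM hhZ (@gd_hom Y)) _; lia.
have cZ' : dX *m Z' + sg *: (Z' *m dY) = 0.
  rewrite /Z' !(mulmxBr, mulmxBl) !mulmxA gd_sq !mul0mx -scalemxAl -!mulmxA gd_sq !mulmx0.
  rewrite scaler0 sub0r opprK subr0 !mulmxA -scalemxAr !mulmxA scalerBr addrACA cZ add0r subrr.
  by [].
have EZ' : Z' = (1%:M - (dX *m h + h *m dX)) *m Z.
  rewrite /Z' -!mulmxA ZdY mulmxN -scalemxAr scalerN scalerA sg2 scale1r opprK.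
  by rewrite mulmxBl mul1mx mulmxDl !mulmxA.
have Z'0 x : degX x < 0 -> row x Z' = 0.
  by move=> /ch e; rewrite EZ' row_mul linearB /= -e subrr mul0mx.
have Zlo x : degX x = 0 -> exists w, hrow degY (0 + s + 1) w /\ w *m dY = row x Z'.
  move=> ex; have [es|ns] := eqVneq s 0; last first.
    have /aY {}aY' : degX x + s != 0 by rewrite ex; apply/eqP => e; move/eqP: ns; lia.
    rewrite -ex; apply: aY'; first exact: homg_row.
    have : row x (dX *m Z' + sg *: (Z' *m dY)) = 0 by rewrite cZ' linear0.
    rewrite linearD /= [row x (_ *: _)]linearZ /= [row x (dX *m Z')](row_mulmx_eq (W' := 0) (@gd_hom X)).
      rewrite mulmx0 linear0 add0r row_mul => e.
      by rewrite -[_ *m _]scale1r -sg2 -scalerA e scaler0.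
    by move=> y ey; rewrite Z'0 ?linear0 // ey ex.
  have [|w [hw e]] := Z_H0 es (row x (1%:M - dX *m h)) _ (cyc x ex).
    rewrite -ex -[degX x]addr0; apply: homg_row; apply: homgB; first exact: homg1.
    by apply: homgE (homgM (@gd_hom X) hh) _.
  exists (w + sg *: row x (h *m Z)); split.
    rewrite es !add0r in hhZ *; apply: hrowD => //; apply: hrowZ.
    by rewrite -[X in hrow _ X]add0r -ex; apply: homg_row.
  have -> : Z' = (1%:M - dX *m h) *m Z + sg *: (h *m Z *m dY).
    by rewrite /Z' opprB mulmxBl mul1mx -(mulmxA dX) addrA addrAC.
  by rewrite [LHS]mulmxDl e -scalemxAl -!row_mul [RHS]linearD /= [row x (sg *: _)]linearZ.
have [x h1 h2|H [hH _ _ e]] := @lift_rows X Y s sg sg2 Z' 0 b hZ' cZ' Z'0 Zlo.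
  by apply: aY; apply/eqP; lia.
exists (H + h *m Z); split; first exact: homgD.
have EH : Z' = dX *m H - sg *: (H *m dY).
  by apply/row_matrixP => x; apply: e; rewrite add0r; case: (hb x).
transitivity (Z' + (dX *m (h *m Z) - sg *: (h *m Z *m dY))); first by rewrite subrK.
by rewrite {1}EH mulmxDr mulmxDl scalerDr opprD addrACA.
Qed.

End NullHomotopy.

End Homogeneous.

Local Notation ghom X Y := (homg (gdeg (g := X)) (gdeg (g := Y))).
Local Notation ghge X Y := (hgeq (gdeg (g := X)) (gdeg (g := Y))).
Local Notation grow X := (hrow (gdeg (g := X))).

(** * Homotopies of matrix factorizations *)

Section MatrixFactorization.
Variables (A : comNzRingType) (X Y : gcx A).
Hypotheses (aX : acyclic X) (aY : acyclic Y).
Local Notation degX := (gdeg (g := X)).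
Local Notation degY := (gdeg (g := Y)).
Variables (eX : 'M[A]_(gn X)) (eY : 'M[A]_(gn Y)) (w : A).
Hypotheses (heX : homg degX degX 1 eX) (heY : homg degY degY 1 eY).
Let DX := eX - gd X.
Let DY := eY - gd Y.
Hypotheses (DX2 : DX *m DX = w%:M) (DY2 : DY *m DY = w%:M).

(** Induction along the degree filtration. The component of Z of lowest degree r is, up to sign, a
    chain map for d and so null homotopic. Since D = e - d, adding D H1 - sg H1 D removes it and
    leaves degrees at least r + 1. The bound r >= 1 avoids any condition on H_0. *)
Lemma mf_null_homotopy (r : int) (sg : A) (Z : 'M[A]_(gn X, gn Y)) :
  sg * sg = 1 -> 1 <= r -> hgeq degX degY r Z ->
  DX *m Z + sg *: (Z *m DY) = 0 ->
  exists H, hgeq degX degY (r + 1) H /\ Z = DX *m H - sg *: (H *m DY).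
Proof.
move=> sg2; have [bX hbX] := gdeg_bounded X; have [bY hbY] := gdeg_bounded Y.
(* [t] counts the degrees left until the bounds on X and Y force Z = 0. *)
have [t] : exists t : nat, (bX%:Z + bY%:Z - r <= t%:Z)%R.
  by exists `|(bX%:Z + bY%:Z - r)%R|%N; lia.
elim: t r Z => [|t IH] r Z ht r1 hZ cZ.
  exists 0; split; first by move=> x y _; rewrite mxE.
  rewrite mulmx0 mul0mx scaler0 subr0; apply/matrixP => x y; rewrite mxE hZ //.
  by have := hbX x; have := hbY y; lia.
pose Zr : 'M[A]_(gn X, gn Y) :=
  \matrix_(x, y) (if degY y == degX x + r then Z x y else 0).
have hZr : homg degX degY r Zr by move=> x y /negbTE e; rewrite mxE e.
have hZZr : hgeq degX degY (r + 1) (Z - Zr).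
  move=> x y e; rewrite !mxE; case: eqP => [|ne]; first by rewrite subrr.
  by rewrite subr0 hZ //; lia.
have cZr : gd X *m Zr + sg *: (Zr *m gd Y) = 0.
  have h1 : homg degX degY (r - 1) (gd X *m Zr + sg *: (Zr *m gd Y)).
    apply: homgD; first by apply: homgE (homgM (@gd_hom _ X) hZr) _; lia.
    by apply: homgZ; apply: homgE (homgM hZr (@gd_hom _ Y)) _; lia.
  apply/matrixP => x y; rewrite [RHS]mxE.
  have [e|/h1 //] := eqVneq (degY y) (degX x + (r - 1)).
  have -> : gd X *m Zr + sg *: (Zr *m gd Y) =
     (eX *m Z + sg *: (Z *m eY)) - (DX *m Z + sg *: (Z *m DY))
     - (gd X *m (Z - Zr) + sg *: ((Z - Zr) *m gd Y)).
    rewrite /DX /DY !(mulmxBl, mulmxBr) !scalerBr.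
    by rewrite !opprD !opprK; apply/matrixP => ? ?; rewrite !mxE; ring.
  rewrite cZ subr0.
  have hge1 : hgeq degX degY r (eX *m Z + sg *: (Z *m eY)).
    apply: hgeqD.
      by apply: (@hgeqW _ _ _ _ _ (1 + r)); [lia | apply: hgeqM hZ; apply: homg_hgeq heX].
    by apply: hgeqZ; apply: (@hgeqW _ _ _ _ _ (r + 1)); [lia | apply: hgeqM (homg_hgeq _ heY)].
  have hge2 : hgeq degX degY r (gd X *m (Z - Zr) + sg *: ((Z - Zr) *m gd Y)).
    apply: hgeqD.
      by apply: (@hgeqW _ _ _ _ _ (-1 + (r + 1))); [lia | apply: hgeqM hZZr; apply: homg_hgeq (@gd_hom _ X)].
    by apply: hgeqZ; apply: (@hgeqW _ _ _ _ _ (r + 1 + -1)); [lia | apply: hgeqM (homg_hgeq _ (@gd_hom _ Y))].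
  by apply: (hgeqB hge1 hge2); lia.
have [||H1 [hH1 e1]] := null_homotopy aX aY sg2 _ hZr cZr; first by lia.
  by move=> r0; lia.
have ge1 : hgeq degX degY (r + 1) H1 by apply: homg_hgeq hH1.
pose Z2 := Z + (DX *m H1 - sg *: (H1 *m DY)).
have hZ2 : hgeq degX degY (r + 1) Z2.
  have -> : Z2 = (Z - Zr) + (eX *m H1 - sg *: (H1 *m eY)).
    rewrite /Z2 e1 /DX /DY !(mulmxBl, mulmxBr) !scalerBr.
    by apply/matrixP => ? ?; rewrite !mxE; ring.
  apply: hgeqD => //; apply: hgeqB.
    by apply: (@hgeqW _ _ _ _ _ (1 + (r + 1))); [lia | apply: hgeqM ge1; apply: homg_hgeq heX].
  by apply: hgeqZ; apply: (@hgeqW _ _ _ _ _ (r + 1 + 1)); [lia | apply: hgeqM (homg_hgeq _ heY)].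
have cZ2 : DX *m Z2 + sg *: (Z2 *m DY) = 0.
  rewrite /Z2; set B := DX *m H1 - _.
  rewrite [DX *m (_ + _)]mulmxDr [(Z + B) *m _]mulmxDl scalerDr addrACA cZ add0r /B.
  rewrite [DX *m (_ - _)]mulmxBr [(_ - sg *: _) *m DY]mulmxBl.
  rewrite [DX *m (DX *m _)]mulmxA DX2 -scalemxAr -scalemxAl -[H1 *m DY *m DY]mulmxA DY2.
  rewrite mul_scalar_mx mul_mx_scalar scalerBr [sg *: (sg *: _)]scalerA sg2 scale1r mulmxA.
  by rewrite addrA subrK subrr.
have [||H2 [hH2 e2]] := IH (r + 1) Z2 _ _ hZ2 cZ2; try by lia.
exists (H2 - H1); split.
  by apply: hgeqB => //; apply: hgeqW hH2; lia.
have -> : Z = Z2 - (DX *m H1 - sg *: (H1 *m DY)) by rewrite addrK.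
rewrite e2 !(mulmxBl, mulmxBr) scalerBr.
by apply/matrixP => ? ?; rewrite !mxE; ring.
Qed.

End MatrixFactorization.

Lemma antisym_sum (V : zmodType) n (T : 'I_n -> 'I_n -> V) :
  (forall j, T j j = 0) -> (forall j l, T j l = - T l j) -> \sum_j \sum_l T j l = 0.
Proof.
move=> T0 TN.
have -> : \sum_j \sum_l T j l =
    \sum_(j < n) \sum_(l < n | (j < l)%N) T j l + \sum_(j < n) \sum_(l < n | (l < j)%N) T j l.
  rewrite -big_split; apply: eq_bigr => j _ /=.
  rewrite (bigID (fun l : 'I_n => (j < l)%N)) /=; congr (_ + _).
  rewrite (bigD1 j) ?ltnn //= T0 add0r; apply: eq_bigl => l.
  by rewrite -leqNgt ltn_neqAle andbC.
rewrite [X in _ + X](exchange_big_dep xpredT) //= -big_split big1 // => j _ /=.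
by rewrite -big_split big1 // => l _; rewrite /= [T l j]TN subrr.
Qed.

Section GradedModules.
Variables (Q : comNzRingType) (n : nat) (f : 'I_n -> Q).

Record gmod := Gmod {
  gc :> gcx Q;
  ge : 'I_n -> 'M[Q]_(gn gc);
  ge_hom : forall j, ghom gc gc 1 (ge j);
  ge_sq : forall j, ge j *m ge j = 0;
  ge_C : forall j l, ge l *m ge j = - (ge j *m ge l);
  ge_d : forall j, ge j *m gd gc + gd gc *m ge j = (f j)%:M
}.

Variable I : Q -> Prop.

(** H_0 is identified with Q/I through a cycle that generates it and has annihilator I, so that no
    quotient module has to be formed. *)
Definition generates_H0 (X : gcx Q) (z : 'rV[Q]_(gn X)) :=
  [/\ grow X 0 z, z *m gd X = 0,
      forall v, grow X 0 v -> v *m gd X = 0 ->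
        exists q w, grow X 1 w /\ v = q *: z + w *m gd X &
      forall q, I q <-> exists w, grow X 1 w /\ w *m gd X = q *: z].

Definition resolution (X : gcx Q) := acyclic X /\ exists z : 'rV[Q]_(gn X), generates_H0 z.

Lemma hrow_sum (N M : nat) (dY : 'I_M -> int) i (c : 'I_N -> Q) (v : 'I_N -> 'rV[Q]_M) :
  (forall x, hrow dY i (v x)) -> hrow dY i (\sum_x c x *: v x).
Proof. by move=> h y e; rewrite summxE big1 // => x _; rewrite mxE h // mulr0. Qed.

(** The comparison theorem for complexes that may have negative terms: X_0 is projected onto its
    cycles, a cycle q zX + boundary is sent to q zY, and the higher degrees are lifted as usual. *)
Lemma resolution_lift (X Y : gcx Q) zX zY :
  acyclic X -> acyclic Y -> generates_H0 zX -> generates_H0 zY ->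
  exists phi : 'M[Q]_(gn X, gn Y),
    [/\ ghom X Y 0 phi, gd X *m phi = phi *m gd Y &
        exists w, grow Y 1 w /\ zX *m phi = zY + w *m gd Y].
Proof.
move=> aX aY [hzX zXd genX IX] [hzY zYd genY IY].
have [h [hh [_ cyc]]] := negative_contraction aX.
have [b hb] := gdeg_bounded X.
have h1 : ghom X X 0 (1%:M - gd X *m h).
  by apply: homgB; [apply: homg1 | apply: homgE (homgM (@gd_hom _ X) hh) _].
have /choice [q /choice [w hq]] : forall x, exists (q : Q) (w : 'rV[Q]_(gn X)),
    grow X 1 w /\
    (gdeg x = 0 -> row x (1%:M - gd X *m h) = q *: zX + w *m gd X).
  move=> x; have [e|ne] := eqVneq (gdeg x) 0.
    have [|q [w [hw ew]]] := genX (row x (1%:M - gd X *m h)) _ (cyc x e).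
      by rewrite -e -[gdeg x]addr0; apply: homg_row.
    by exists q, w.
  by exists 0, 0; split=> [y _|e]; [rewrite mxE | rewrite e eqxx in ne].
have expand (v : 'rV[Q]_(gn X)) : grow X 0 v ->
    v *m (1%:M - gd X *m h) =
      (\sum_x v 0 x * q x) *: zX + (\sum_x v 0 x *: w x) *m gd X.
  move=> hv; rewrite mulmx_sum_row scaler_suml mulmx_suml -big_split /=.
  apply: eq_bigr => x _; have [e|/hv ->] := eqVneq (gdeg x) 0.
    by case: (hq x) => _ /(_ e) ->; rewrite scalerDr scalerA scalemxAl.
  by rewrite mul0r !scale0r mul0mx addr0.
pose phi0 : 'M[Q]_(gn X, gn Y) := \matrix_x (if gdeg x == 0 then q x *: zY else 0).
have hphi0 : ghom X Y 0 phi0.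
  move=> x y; rewrite addr0 => e.
  have -> : phi0 x y = row x phi0 0 y by rewrite [RHS]mxE.
  by rewrite rowK; case: eqP => [ex|_]; rewrite mxE // hzY ?mulr0 // -ex.
have phi0E (v : 'rV[Q]_(gn X)) : grow X 0 v ->
    v *m phi0 = (\sum_x v 0 x * q x) *: zY.
  move=> hv; rewrite mulmx_sum_row scaler_suml; apply: eq_bigr => x _.
  have [e|/hv ->] := eqVneq (gdeg x) 0; last by rewrite mul0r !scale0r.
  by rewrite rowK e eqxx scalerA.
have phi0d : phi0 *m gd Y = 0.
  apply/row_matrixP => x; rewrite row_mul rowK linear0.
  by case: ifP => _; rewrite ?mul0mx // -scalemxAl zYd scaler0.
have [|||||x h1x h2x|H [hH H0 _ eH]] :=
  @lift_rows _ X Y (-1) 1 _ (gd X *m phi0) 1 b.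
- by rewrite mulr1.
- by apply: homgE (homgM (@gd_hom _ X) hphi0) _.
- by rewrite mulmxA gd_sq mul0mx -mulmxA phi0d mulmx0 scaler0 addr0.
- move=> x lx; rewrite (row_mulmx_eq (W' := 0) (@gd_hom _ X)) ?mulmx0 ?linear0 //.
  by move=> y ey; rewrite rowK linear0; case: eqP => //; lia.
(* If r is the coefficient of a boundary at zX, then r zX is a boundary too; so r lies in I and r zY
   is a boundary in Y. *)
- move=> x ex; have hx : grow X 0 (row x (gd X)).
    have -> : 0 = gdeg x + -1 by rewrite ex.
    by apply: homg_row; apply: gd_hom.
  rewrite row_mul phi0E //; set r := \sum_x _.
  have /IY [w' [hw' e']] : I r.
    apply/IX; exists (row x 1%:M - \sum_y row x (gd X) 0 y *: w y); split.
      apply: hrowD; first by rewrite -ex -[gdeg x]addr0; apply: homg_row; apply: homg1.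
      by rewrite -scaleN1r; apply: hrowZ; apply: hrow_sum => y; case: (hq y).
    rewrite mulmxBl -row_mul mul1mx.
    have := expand _ hx; rewrite mulmxBr mulmx1 mulmxA -row_mul gd_sq linear0 mul0mx subr0.
    by move=> {1}->; rewrite addrK.
  by exists w'; rewrite addrK; split.
- by apply: aY; apply/eqP; lia.
exists (phi0 - H); split.
- by apply: homgB => //; apply: homgE hH _.
- have e : gd X *m phi0 = gd X *m H - H *m gd Y.
    apply/row_matrixP => x; have [lx|lx] := ltrP (gdeg x) (1 + b%:Z).
      by rewrite eH // scale1r.
    by have := hb x; lia.
  by rewrite mulmxBr mulmxBl phi0d e sub0r addrAC subrr sub0r.
have -> : zX *m (phi0 - H) = (\sum_x zX 0 x * q x) *: zY.
  rewrite mulmxBr phi0E // [X in _ - X](_ : _ = 0) ?subr0 //.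
  rewrite mulmx_sum_row big1 // => x _.
  have [e|/hzX ->] := eqVneq (gdeg x) 0; last by rewrite scale0r.
  by rewrite H0 ?scaler0 // e.
(* As zX is a cycle, it equals r zX up to a boundary; so r = 1 modulo I, and [phi] induces the
   identity of Q/I. *)
set r := \sum_x _.
have /IY [w' [hw' e']] : I (r - 1).
  apply/IX; exists (- \sum_x zX 0 x *: w x); split.
    by rewrite -scaleN1r; apply: hrowZ; apply: hrow_sum => y; case: (hq y).
  have := expand _ hzX; rewrite mulmxBr mulmx1 mulmxA zXd mul0mx subr0 -/r => /eqP.
  by rewrite addrC -subr_eq mulNmx scalerBl scale1r => /eqP <-; rewrite opprB.
by exists w'; split=> //; rewrite e' scalerBl scale1r addrC subrK.
Qed.

End GradedModules.

Lemma sub_swap (V : zmodType) (a b c d : V) : a - b = c - d -> a - c = b - d.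
Proof. by move/eqP; rewrite subr_eq => /eqP ->; rewrite addrAC [X in X + _]addrAC subrr sub0r addrC. Qed.

Section BaseChange.
Variables (A B : comNzRingType) (h : {rmorphism A -> B}).

Lemma map_homg N M (degX : 'I_N -> int) (degY : 'I_M -> int) s (Z : 'M[A]_(N, M)) :
  homg degX degY s Z -> homg degX degY s (map_mx h Z).
Proof. by move=> hZ x y e; rewrite mxE hZ ?rmorph0. Qed.

Lemma map_gd_sq (X : gcx A) : map_mx h (gd X) *m map_mx h (gd X) = 0.
Proof. by rewrite -map_mxM gd_sq map_mx0. Qed.

Definition gcx_map (X : gcx A) : gcx B :=
  Gcx (map_homg (@gd_hom _ X)) (map_gd_sq X).

End BaseChange.

(** Q[chi] is free over Q: cycles are lifted one chi-monomial at a time, and [s] lists the monomials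
    that occur. *)
Lemma acyclic_mpoly (Q : comNzRingType) n (X : gcx Q) :
  acyclic X -> acyclic (gcx_map (@mpolyC n Q) X).
Proof.
move=> aX i i0 v hv vd.
pose s := undup (flatten [seq msupp (v 0 y) | y <- enum 'I_(gn X)]).
have sP y m : m \notin s -> (v 0 y)@_m = 0.
  rewrite mem_undup => hm; apply: memN_msupp_eq0; apply: contra hm => hm.
  by apply/flatten_mapP; exists y; rewrite ?mem_enum.
have vE : v = \sum_(m <- s) 'X_[m] *: map_mx (@mpolyC n Q) (map_mx (mcoeff m) v).
  apply/rowP => y; rewrite summxE; apply/mpolyP => m'.
  rewrite raddf_sum /= (eq_bigr (fun m => (m == m')%:R * (v 0 y)@_m)); last first.
    by move=> m _; rewrite !mxE mulrC mcoeffCM mcoeffX mulrC.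
  have [ms|ms] := boolP (m' \in s).
    rewrite (bigD1_seq m') ?undup_uniq //= eqxx mul1r big1 ?addr0 // => m /negbTE ->.
    by rewrite mul0r.
  rewrite sP // big1_seq // => m /andP [_ hm].
  by case: eqVneq => [e|]; rewrite ?mul0r // mul1r e sP.
have /choice [w hw] : forall m, exists w : 'rV[Q]_(gn X),
    grow X (i + 1) w /\ w *m gd X = map_mx (mcoeff m) v.
  move=> m; apply: aX => //.
    by move=> y e; rewrite mxE hv ?mcoeff0.
  apply/rowP => z; move/rowP/(_ z): vd; rewrite !mxE => /(congr1 (mcoeff m)).
  rewrite mcoeff0 raddf_sum /= => e; rewrite -[RHS]e; apply: eq_bigr => y _.
  by rewrite !mxE [in RHS]mulrC mcoeffCM mulrC.
exists (\sum_(m <- s) 'X_[m] *: map_mx (@mpolyC n Q) (w m)); split.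
  move=> y e; rewrite summxE big1_seq // => m _.
  by rewrite !mxE (proj1 (hw m)) ?mpolyC0 ?mulr0.
rewrite mulmx_suml [RHS]vE; apply: eq_bigr => m _.
by rewrite -scalemxAl -map_mxM (proj2 (hw m)).
Qed.

(** * The twisted differential over Q[chi] *)

Section TwistedDifferential.
Variables (Q : comNzRingType) (n : nat) (f : 'I_n -> Q).
Local Notation A := {mpoly Q[n]}.
Local Notation cst := (@mpolyC n Q).

Definition ext_e (X : gmod f) : 'M[A]_(gn X) := \sum_j 'X_j *: map_mx cst (ge X j).
Definition ext_D (X : gmod f) : 'M[A]_(gn X) := ext_e X - map_mx cst (gd X).

Lemma ext_e_hom (X : gmod f) : ghom X X 1 (ext_e X).
Proof.
move=> x y e; rewrite summxE big1 // => j _.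
by rewrite !mxE (@ge_hom _ _ _ X) ?mpolyC0 ?mulr0.
Qed.

Lemma ext_D_sq (X : gmod f) : ext_D X *m ext_D X = (- \sum_j 'X_j * cst (f j))%:M.
Proof.
have ee : ext_e X *m ext_e X = 0.
  rewrite mulmx_suml; under eq_bigr => j _ do rewrite mulmx_sumr.
  apply: antisym_sum => [j|j l]; rewrite -!scalemxAl -!scalemxAr -!map_mxM.
    by rewrite ge_sq map_mx0 !scaler0.
  by rewrite ge_C map_mxN !scalerN !scalerA mulrC.
have ed : ext_e X *m map_mx cst (gd X) + map_mx cst (gd X) *m ext_e X =
    (\sum_j 'X_j * cst (f j))%:M.
  rewrite mulmx_suml mulmx_sumr -big_split raddf_sum; apply: eq_bigr => j _ /=.
  rewrite -scalemxAl -scalemxAr -scalerDr -!map_mxM -map_mxD ge_d map_scalar_mx.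
  by rewrite scale_scalar_mx.
rewrite /ext_D mulmxBl !mulmxBr ee map_gd_sq !(sub0r, subr0) -opprD ed.
by rewrite -raddfN.
Qed.

Variable I : Q -> Prop.

(** A chain map for d commutes with D up to terms of degree at least 1, and these are null
    homotopic. The same correction turns the homotopy for d between phi0 psi0 and 1 into one for
    D. *)
Lemma homotopy_equivalence (X Y : gmod f) : resolution I X -> resolution I Y ->
  exists (phi : 'M[A]_(gn X, gn Y)) (psi : 'M[A]_(gn Y, gn X)) (H : 'M[A]_(gn X)),
  [/\ ext_D X *m phi = phi *m ext_D Y, ext_D Y *m psi = psi *m ext_D X &
      phi *m psi = 1%:M + (ext_D X *m H + H *m ext_D X)].
Proof.
move=> [aX [zX gX]] [aY [zY gY]].
have chain (U V : gmod f) (phi0 : 'M[Q]_(gn U, gn V)) : acyclic U -> acyclic V ->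
    ghom U V 0 phi0 -> gd U *m phi0 = phi0 *m gd V ->
    exists phi : 'M[A]_(gn U, gn V), ext_D U *m phi = phi *m ext_D V /\
       ghge U V 1 (phi - map_mx cst phi0).
  move=> aU aV hphi e0.
  pose p0 := map_mx cst phi0.
  pose Z := ext_D U *m p0 - p0 *m ext_D V.
  have EZ : Z = ext_e U *m p0 - p0 *m ext_e V.
    rewrite /Z /ext_D mulmxBl mulmxBr -!map_mxM e0.
    by rewrite opprB addrA subrK.
  have hp0 : ghom U V 0 p0 by apply: map_homg.
  have hZ : ghge U V 1 Z.
    rewrite EZ; apply: hgeqB.
      by apply: homg_hgeq (homgM (@ext_e_hom U) hp0).
    by apply: homg_hgeq (homgM hp0 (@ext_e_hom V)).
  have cZ : ext_D U *m Z + 1 *: (Z *m ext_D V) = 0.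
    rewrite scale1r /Z [ext_D U *m (_ *m _ - _)]mulmxBr [(_ *m _ - _) *m ext_D V]mulmxBl.
    rewrite [ext_D U *m (ext_D U *m _)]mulmxA ext_D_sq.
    rewrite [ext_D U *m (p0 *m _)]mulmxA -[p0 *m ext_D V *m ext_D V]mulmxA ext_D_sq.
    by rewrite mul_scalar_mx mul_mx_scalar addrA subrK subrr.
  have [||H [hH eH]] := mf_null_homotopy (acyclic_mpoly aU) (acyclic_mpoly aV)
    (@ext_e_hom U) (@ext_e_hom V) (ext_D_sq U) (ext_D_sq V) _ _ hZ cZ.
  - by rewrite mulr1.
  - by [].
  exists (p0 - H); split.
    have : Z = ext_D U *m H - H *m ext_D V by rewrite {1}eH scale1r.
    by move/sub_swap; rewrite [ext_D U *m (p0 - H)]mulmxBr [(p0 - H) *m _]mulmxBl.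
  rewrite addrAC subrr add0r -scaleN1r; apply: hgeqZ; exact: (hgeqW _ hH).
have [phi0 [hphi0 ephi0 [w [hw zphi0]]]] := resolution_lift aX aY gX gY.
have [psi0 [hpsi0 epsi0 [w' [hw' zpsi0]]]] := resolution_lift aY aX gY gX.
have [phi [ephi gphi]] := chain _ _ _ aX aY hphi0 ephi0.
have [psi [epsi gpsi]] := chain _ _ _ aY aX hpsi0 epsi0.
have h00 : ghom X X 0 (phi0 *m psi0 - 1%:M).
  by apply: homgB; [apply: homgE (homgM hphi0 hpsi0) _ | apply: homg1].
have [||||h [hh eh]] := null_homotopy (s := 0) (sg := -1) aX aX _ _ h00.
- by rewrite mulrNN mulr1.
- by [].
- by rewrite scaleN1r mulmxBr mulmxBl mulmx1 mul1mx mulmxA ephi0 -!mulmxA epsi0 subrr.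
- move=> _ v hv vd; have [_ _ genX _] := gX.
  have [q [u [hu ->]]] := genX v hv vd.
  exists (q *: (w *m psi0 + w') + (u *m phi0 *m psi0 - u)); split.
    apply: hrowD; first apply: hrowZ.
      by apply: hrowD => //; rewrite -[1]addr0; apply: hrowM hpsi0.
    apply: hrowD; last by rewrite -scaleN1r; apply: hrowZ.
    by rewrite -[1]addr0 -[1]addr0; apply: hrowM hpsi0; apply: hrowM hphi0.
  rewrite mulmxBr mulmx1 !mulmxDl -!scalemxAl !mulmxDl mulNmx.
  rewrite !mulmxA zphi0 mulmxDl zpsi0.
  rewrite -!mulmxA epsi0 !mulmxA -[u *m gd X *m phi0]mulmxA ephi0 !mulmxA.
  rewrite -[u *m phi0 *m psi0 *m gd X]mulmxA -epsi0 !mulmxA.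
  by rewrite !scalerDr; apply/matrixP => ? ?; rewrite !mxE; ring.
pose h' := map_mx cst h.
(* As D contains - d, the added terms cancel the degree 0 part of phi psi - 1. *)
pose Z := phi *m psi - 1%:M + (ext_D X *m h' + h' *m ext_D X).
have EZ : Z = (phi - map_mx cst phi0) *m psi + map_mx cst phi0 *m (psi - map_mx cst psi0)
    + (ext_e X *m h' + h' *m ext_e X).
  have eh' : map_mx cst phi0 *m map_mx cst psi0 - 1%:M =
      map_mx cst (gd X) *m h' + h' *m map_mx cst (gd X).
    by rewrite -!map_mxM -(map_mx1 cst) -map_mxB eh scaleN1r opprK map_mxD.
  rewrite /Z /ext_D [(_ - _) *m psi]mulmxBl [_ *m (psi - _)]mulmxBr.
  rewrite [(_ - _) *m h']mulmxBl [h' *m (_ - _)]mulmxBr.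
  have -> : map_mx cst (gd X) *m h' = map_mx cst phi0 *m map_mx cst psi0 - 1%:M
     - h' *m map_mx cst (gd X) by rewrite eh' addrK.
  by apply/matrixP => ? ?; rewrite !mxE; ring.
have gpsi0 : ghge Y X 0 psi.
  rewrite -(subrK (map_mx cst psi0) psi); apply: hgeqD; first exact: (hgeqW _ gpsi).
  by apply: homg_hgeq (map_homg _ hpsi0).
have hZ : ghge X X 1 Z.
  rewrite EZ; apply: hgeqD; first apply: hgeqD.
  - by apply: (@hgeqW _ _ _ _ _ (1 + 0)) => //; apply: hgeqM gpsi0.
  - by apply: (@hgeqW _ _ _ _ _ (0 + 1)) => //; apply: hgeqM gpsi; apply: homg_hgeq (map_homg _ hphi0).
  have hh' := map_homg (@mpolyC n Q) hh.
  apply: hgeqD; first by apply: homg_hgeq (homgM (@ext_e_hom X) hh').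
  by apply: homg_hgeq (homgM hh' (@ext_e_hom X)).
have cZ : ext_D X *m Z + -1 *: (Z *m ext_D X) = 0.
  have Da : ext_D X *m (phi *m psi) = (phi *m psi) *m ext_D X.
    by rewrite mulmxA ephi -mulmxA epsi mulmxA.
  rewrite scaleN1r /Z [ext_D X *m (_ - _ + _)]mulmxDr [(_ - _ + _) *m ext_D X]mulmxDl.
  rewrite [ext_D X *m (_ - 1%:M)]mulmxBr [(_ - 1%:M) *m _]mulmxBl mulmx1 mul1mx Da.
  rewrite [ext_D X *m (_ + h' *m _)]mulmxDr [(_ + h' *m _) *m _]mulmxDl.
  rewrite [ext_D X *m (ext_D X *m h')]mulmxA -[h' *m _ *m _]mulmxA ext_D_sq.
  rewrite mul_scalar_mx mul_mx_scalar mulmxA [X in _ + X - _]addrC.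
  by rewrite subrr.
have [||H [hH eH]] := mf_null_homotopy (acyclic_mpoly aX) (acyclic_mpoly aX)
    (@ext_e_hom X) (@ext_e_hom X) (ext_D_sq X) (ext_D_sq X) _ _ hZ cZ.
- by rewrite mulrNN mulr1.
- by [].
exists phi, psi, (H - h'); split=> //.
have -> : phi *m psi = 1%:M + Z - (ext_D X *m h' + h' *m ext_D X).
  by rewrite /Z addrA addrK addrC subrK.
rewrite {1}eH scaleN1r opprK [ext_D X *m (H - h')]mulmxBr [(H - h') *m _]mulmxBl.
by rewrite -[LHS]addrA; congr (_ + _); rewrite opprD addrACA.
Qed.

End TwistedDifferential.

(** The matrices act on F by rows, hence on Hom (F, k) by columns. *)
Definition annH (S : comNzRingType) N (D : 'M[S]_N) (s : S) : Prop :=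
  forall xi : 'cV[S]_N, D *m xi = 0 -> exists eta, s *: xi = D *m eta.

Section Reduction.
Variables (Q S : comNzRingType) (n : nat) (f : 'I_n -> Q) (I : Q -> Prop).
Variable rho : {rmorphism {mpoly Q[n]} -> S}.

Lemma annH_resolution (X Y : gmod f) : resolution I X -> resolution I Y ->
  forall s, annH (map_mx rho (ext_D Y)) s -> annH (map_mx rho (ext_D X)) s.
Proof.
move=> rX rY s; have [phi [psi [H [e1 e2 e3]]]] := homotopy_equivalence rX rY.
move: e1 e2 e3; move: (ext_D X) (ext_D Y) => EX EY.
move=> /(congr1 (map_mx rho)) e1 /(congr1 (map_mx rho)) e2 /(congr1 (map_mx rho)) e3.
move: e1 e2 e3; rewrite !(map_mxM, map_mxD) map_mx1.
set DX := map_mx rho EX; set DY := map_mx rho EY.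
set p := map_mx rho phi; set q := map_mx rho psi; set h := map_mx rho H.
move=> e1 e2 e3 sY xi Dxi.
have [eta e] : exists eta, s *: (q *m xi) = DY *m eta.
  by apply: (sY (q *m xi)); rewrite mulmxA e2 -mulmxA Dxi mulmx0.
exists (p *m eta - s *: (h *m xi)).
rewrite mulmxBr mulmxA e1 -mulmxA -e -!scalemxAr mulmxA e3 -scalerBr; congr (_ *: _).
by rewrite !mulmxDl mul1mx -[h *m DX *m xi]mulmxA Dxi mulmx0 addr0 mulmxA addrK.
Qed.

End Reduction.

(** * The Taylor resolution *)

Section Signs.
Variables (R : pzRingType) (n : nat).
Implicit Types (A B : {set 'I_n}) (i j : 'I_n).

(** The Koszul sign of moving e_i past the smaller elements of A. *)
Definition ksign i A : R := (-1) ^+ #|[set l in A | (l < i)%N]|.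

Lemma ksignK i A : ksign i A * ksign i A = 1.
Proof. by rewrite -expr2 sqrr_sign. Qed.

Lemma ksignU i j A : j \notin A -> i != j ->
  ksign i (j |: A) = (if (j < i)%N then -1 else 1) * ksign i A.
Proof.
move=> jA ij; rewrite /ksign; case: ifP => ji.
  rewrite -exprS (_ : [set l in j |: A | (l < i)%N] = j |: [set l in A | (l < i)%N]).
    by rewrite cardsU1 !inE (negbTE jA).
  by apply/setP => l; rewrite !inE; case: eqP => // ->.
rewrite mul1r; congr (_ ^+ _); apply: eq_card => l; rewrite !inE.
by case: eqP => // ->; rewrite ji (negbTE jA).
Qed.

Lemma ksignU1 i A : ksign i (i |: A) = ksign i A.
Proof.
congr (_ ^+ _); apply: eq_card => l; rewrite !inE.
by case: eqP => // ->; rewrite ltnn !andbF.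
Qed.

Lemma ksignD1 i A : ksign i (A :\ i) = ksign i A.
Proof.
congr (_ ^+ _); apply: eq_card => l; rewrite !inE.
by case: eqP => // ->; rewrite ltnn !andbF.
Qed.

Lemma ksign_anti i j B : i \notin B -> j \notin B -> i != j ->
  ksign i (j |: B) * ksign j B = - (ksign j (i |: B) * ksign i B).
Proof.
move=> iB jB ij; rewrite !ksignU // 1?eq_sym //.
have : (i != j :> nat) by [].
rewrite /ksign -!mulrA -!exprD addnC.
by case: ltngtP => // _ _; rewrite ?mul1r ?mulN1r ?opprK.
Qed.

End Signs.

Section Lcm.
Variables (n d : nat) (E : 'I_n -> 'I_d -> nat).
Implicit Types (A B : {set 'I_n}) (i j : 'I_n).

Definition lcme A (t : 'I_d) := (\max_(i in A) E i t)%N.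

Lemma lcmeU1 i A t : lcme (i |: A) t = maxn (E i t) (lcme A t).
Proof.
rewrite /lcme; have [iA|iA] := boolP (i \in A); last by rewrite big_setU1.
have -> : i |: A = A by apply/setUidPr; rewrite sub1set.
by symmetry; apply/maxn_idPr; exact: (@leq_bigmax_cond _ (fun l => l \in A) (fun l => E l t) i iA).
Qed.

Lemma lcme0 t : lcme set0 t = 0%N. Proof. by rewrite /lcme big_set0. Qed.

Lemma lcmeS A B t : A \subset B -> (lcme A t <= lcme B t)%N.
Proof.
move=> /subsetP s; apply/bigmax_leqP => i /s iB.
by exact: (@leq_bigmax_cond _ (fun l => l \in B) (fun l => E l t) i iB).
Qed.

End Lcm.

Section Taylor.
Variables (Q : comUnitRingType) (d : nat) (x : 'I_d -> Q) (n : nat).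
Implicit Types (A B C : {set 'I_n}) (i j : 'I_n) (z : {set 'I_n} -> Q).
Local Notation mono := (mono x).
Local Notation sg := (@ksign Q n).

Section Complex.
Variable E : 'I_n -> 'I_d -> nat.
Local Notation L := (lcme E).

Definition tay_d A B : Q :=
  \sum_(i in A | B == A :\ i) sg i A * mono (fun t => L A t - L B t)%N.

Definition tay_e j A B : Q :=
  if (j \notin A) && (B == j |: A)
  then sg j A * mono (fun t => L A t + E j t - L B t)%N else 0.

Lemma tay_d_suml A (F : {set 'I_n} -> Q) :
  \sum_C tay_d A C * F C =
  \sum_(i in A) sg i A * mono (fun t => L A t - L (A :\ i) t)%N * F (A :\ i).
Proof.
rewrite /tay_d; under eq_bigr => C _ do rewrite big_distrl /=.
rewrite (exchange_big_dep (mem A)) /=; last by move=> C i _ /andP [].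
by apply: eq_bigr => i iA; under eq_bigl => C do rewrite iA /=; rewrite big_pred1_eq.
Qed.

Lemma tay_e_suml j A (F : {set 'I_n} -> Q) :
  \sum_C tay_e j A C * F C =
  if j \notin A then sg j A * mono (fun t => L A t + E j t - L (j |: A) t)%N * F (j |: A) else 0.
Proof.
rewrite /tay_e; case: ifP => [jA|_]; last by rewrite big1 // => C _; rewrite mul0r.
rewrite (bigD1 (j |: A)) //= eqxx big1 ?addr0 // => C /negbTE ->; by rewrite mul0r.
Qed.

Lemma tay_dd A B : \sum_C tay_d A C * tay_d C B = 0.
Proof.
rewrite tay_d_suml.
(* Removing i and l in either order gives the same monomial with opposite signs. *)
pose T i l := if [&& i \in A, l \in A, i != l & B == A :\ i :\ l]
  then sg i A * sg l (A :\ i) * mono (fun t => L A t - L B t)%N else 0.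
transitivity (\sum_i \sum_l T i l).
  rewrite [LHS]big_mkcond; apply: eq_bigr => i _; case: ifP => iA; last first.
    by rewrite big1 // => l _; rewrite /T iA.
  rewrite /tay_d big_mkcond big_distrr; apply: eq_bigr => l _ /=.
  rewrite /T iA !inE [i == l]eq_sym /=; case: (l != i); rewrite /= ?andbF ?mulr0 //.
  case: (l \in A); rewrite /= ?mulr0 //; case: eqP => [->|_]; rewrite ?mulr0 //.
  rewrite mulrACA -monoD; congr (_ * _); apply: mono_ext => t.
  have h1 := lcmeS E t (subsetDl A [set i]).
  by have h2 := lcmeS E t (subsetDl (A :\ i) [set l]); lia.
apply: (@antisym_sum Q n T) => [i|i l]; first by rewrite /T eqxx !andbF.
rewrite /T [l == i]eq_sym; case iA: (i \in A); case lA: (l \in A); rewrite /= ?oppr0 //.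
have [|il] := eqVneq i l; rewrite /= ?oppr0 //.
have -> : A :\ l :\ i = A :\ i :\ l by rewrite !setDDl setUC.
case: eqP => [eB|]; rewrite ?oppr0 // -mulNr; congr (_ * _).
have -> : A = i |: (l |: (A :\ i :\ l)).
  apply/setP => u; rewrite !inE; case: (eqVneq u i) => [->|ui]; rewrite ?iA //=.
  by case: (eqVneq u l) => [->|ul]; rewrite ?lA.
set B0 := A :\ i :\ l.
have iB : i \notin B0 by rewrite !inE eqxx !andbF.
have lB : l \notin B0 by rewrite !inE eqxx.
have e1 : (i |: (l |: B0)) :\ i = l |: B0.
  by apply: setU1K; rewrite in_setU1 negb_or il.
have e2 : (i |: (l |: B0)) :\ l = i |: B0.
  by rewrite setUCA setU1K // in_setU1 negb_or eq_sym il.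
rewrite e1 e2 ksignU1 [i |: (l |: B0)]setUCA ksignU1.
by rewrite [sg l (l |: _)]ksignU1 [sg i (i |: B0)]ksignU1 ksign_anti.
Qed.

Lemma tay_ee j A B : \sum_C tay_e j A C * tay_e j C B = 0.
Proof.
by rewrite tay_e_suml; case: ifP => // _; rewrite /tay_e setU11 /= mulr0.
Qed.

Lemma tay_eC j l A B :
  \sum_C tay_e l A C * tay_e j C B = - \sum_C tay_e j A C * tay_e l C B.
Proof.
rewrite !tay_e_suml /tay_e !inE !negb_or.
case jA: (j \in A); case lA: (l \in A); rewrite /= ?andbF ?mulr0 ?oppr0 //=.
rewrite !andbT [l == j]eq_sym; have [|jl] := eqVneq j l; rewrite /= ?mulr0 ?oppr0 //.
have -> : j |: (l |: A) = l |: (j |: A) by rewrite setUCA.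
case: eqP => [->|]; rewrite ?mulr0 ?oppr0 //.
rewrite mulrACA [X in _ = - X]mulrACA -!monoD -mulNr; congr (_ * _).
  by rewrite [LHS]mulrC ksign_anti ?jA ?lA // mulrC.
by apply: mono_ext => t; rewrite !lcmeU1; lia.
Qed.

Lemma tay_de j A B :
  \sum_C tay_e j A C * tay_d C B + \sum_C tay_d A C * tay_e j C B =
  if A == B then mono (E j) else 0.
Proof.
rewrite tay_d_suml tay_e_suml; have [jA|jA] := boolP (j \in A) => /=.
  rewrite add0r (bigD1 j) //= big1 ?addr0; last first.
    move=> i /andP [iA ij].
    by rewrite /tay_e !inE jA eq_sym ij /= mulr0.
  rewrite /tay_e !inE eqxx /= setD1K // [B == A]eq_sym.
  case: eqP => [<-|_]; last by rewrite mulr0.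
  rewrite mulrACA ksignD1 ksignK mul1r -monoD; apply: mono_ext => t.
  have h := lcmeS E t (subsetDl A [set j]).
  have := lcmeU1 E j (A :\ j) t; rewrite setD1K //.
  by move: h; move: (L A t) (L (A :\ j) t) (E j t) => a b e; lia.
(* For j outside A the term of d (A + j) that removes j yields f_j; the others cancel against the
   terms of e_j (d A). *)
rewrite {1}/tay_d mulr_sumr big_mkcond (bigD1 j) //= setU11 setU1K //=.
rewrite (_ : (if B == A then _ else _) = if A == B then mono (E j) else 0); last first.
  rewrite [B == A]eq_sym; case: eqP => // <-.
  rewrite ksignU1 mulrACA ksignK mul1r -monoD; apply: mono_ext => t.
  by rewrite lcmeU1; lia.
rewrite -addrA [X in _ + X](_ : _ = 0) ?addr0 //.
rewrite [X in _ + X = _]big_mkcond [X in _ + X = _](bigD1 j) //= (negbTE jA) add0r -big_split big1 // => i ij /=.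
rewrite !inE (negbTE ij) /=; case iA: (i \in A) => /=; last by rewrite addr0.
have jAi : j \notin A :\ i by rewrite !inE (negbTE jA) andbF.
have eB : (j |: A) :\ i = j |: (A :\ i).
  by apply/setP => u; rewrite !inE; case: (eqVneq u j) => [->|]; rewrite // eq_sym ij.
rewrite eB /tay_e jAi /=; case: eqP => [eB'|_]; last by rewrite mulr0 addr0.
rewrite mulrACA [X in _ + X]mulrACA -!monoD.
rewrite [X in _ + _ * X](@mono_ext _ _ x _ (fun t => L A t + E j t - L (j |: A) t + (L (j |: A) t - L B t))%N).
  rewrite -mulrDl [X in X * _](_ : _ = 0) ?mul0r //.
  have iAi : i \notin A :\ i by rewrite !inE eqxx.
  have s1 : sg j A = sg j (i |: (A :\ i)) by rewrite setD1K.
  have s2 : sg i (j |: A) = sg i (j |: (A :\ i)) by rewrite -eB ksignD1.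
  rewrite s1 s2 -(ksignD1 _ i A) !ksignU // 1?eq_sym //.
  have : (i != j :> nat) by [].
  by case: ltngtP => // _ _; rewrite ?mul1r ?mulN1r ?mulNr ?mulrN mulrC ?addNr ?addrN.
move=> t; rewrite eB'; have h1 := lcmeS E t (subsetDl A [set i]).
rewrite !lcmeU1; move: h1; move: (L A t) (L (A :\ i) t) (E j t) => a b e; lia.
Qed.

End Complex.
End Taylor.

Section TaylorExact.
Variables (Q : comUnitRingType) (d : nat) (x : 'I_d -> Q) (n : nat).
Hypotheses (Hreg : initial_regular x) (Hnak : nakayama_vid x).
Implicit Types (A B C : {set 'I_n}) (i j : 'I_n) (z y u : {set 'I_n} -> Q).
Implicit Type E : 'I_n -> 'I_d -> nat.
Local Notation mono := (mono x).
Local Notation sg := (@ksign Q n).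

(** The Taylor differential of a chain given by its coefficients; without matrices the exponents E
    can change during the induction. *)
Definition tdiff E z B : Q :=
  \sum_(i | i \notin B) sg i B * mono (fun t => lcme E (i |: B) t - lcme E B t)%N * z (i |: B).

Lemma tdiffE E z B : \sum_A z A * tay_d x E A B = tdiff E z B.
Proof.
rewrite /tay_d.
under [LHS]eq_bigr => A _ do rewrite big_distrr /=.
rewrite (exchange_big_dep xpredT) //= /tdiff [RHS]big_mkcond; apply: eq_bigr => i _.
case: ifP => iB.
  rewrite (big_pred1 (i |: B)); last first.
    move=> A /=; apply/andP/eqP => [[iA /eqP ->]|->]; first by rewrite setD1K.
    by rewrite setU11 setU1K.
  by rewrite mulrC ksignU1.
rewrite big_pred0 // => A; apply/negP => /andP [_ /eqP e].
by move: iB; rewrite e !inE eqxx.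
Qed.

Lemma tdiff_tdiff E z B : tdiff E (tdiff E z) B = 0.
Proof.
rewrite -tdiffE; under eq_bigr => A _ do rewrite -tdiffE mulr_suml.
rewrite exchange_big big1 //= => A _.
under eq_bigr => C _ do rewrite -mulrA.
by rewrite -mulr_sumr tay_dd mulr0.
Qed.

Lemma tdiffD E z y B : tdiff E (fun A => z A + y A) B = tdiff E z B + tdiff E y B.
Proof. by rewrite /tdiff -big_split; apply: eq_bigr => i _; rewrite mulrDr. Qed.

Lemma tdiffN E z B : tdiff E (fun A => - z A) B = - tdiff E z B.
Proof. by rewrite /tdiff -sumrN; apply: eq_bigr => i _; rewrite mulrN. Qed.

Lemma tdiff_ext E z y B : (forall i, i \notin B -> z (i |: B) = y (i |: B)) ->
  tdiff E z B = tdiff E y B.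
Proof. by move=> e; apply: eq_bigr => i iB; rewrite e. Qed.

Definition below (s : nat) A := A \subset [set i : 'I_n | (i < s)%N].

Definition supported (s p : nat) z := forall A, ~~ (below s A && (#|A| == p)%N) -> z A = 0.

Definition subE E (s : 'I_n) : 'I_n -> 'I_d -> nat := fun i t => (E i t - E s t)%N.

Lemma lcme_subE E (s : 'I_n) B t : lcme E (s |: B) t = (E s t + lcme (subE E s) B t)%N.
Proof.
rewrite lcmeU1 /lcme; elim/big_rec2: _ => [|i a b _ e]; first by rewrite maxn0 addn0.
by rewrite /subE; lia.
Qed.

(* The part of the Taylor differential through the sets containing the largest
   index s is the Taylor differential of the exponents E i - E s, i.e. of the
   monomials f_i / gcd (f_i, f_s). *)
Lemma tdiff_slice E (s : 'I_n) y B : below s B ->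
  (forall A, ~~ below s A -> y A = 0) ->
  tdiff E (fun C => if s \in C then y (C :\ s) else 0) (s |: B) =
  tdiff (subE E s) y B.
Proof.
move=> bB y0; have sB : s \notin B.
  by apply/negP => sB; move/subsetP/(_ s sB): bB; rewrite inE ltnn.
rewrite /tdiff big_mkcond [RHS]big_mkcond; apply: eq_bigr => i _.
rewrite [i \in s |: B]in_setU1 negb_or; have [->|is_] := eqVneq i s => /=.
  rewrite sB y0 ?mulr0 //; apply/negP => /subsetP /(_ s).
  by rewrite !inE eqxx ltnn => /(_ isT).
case iB: (i \in B) => //=.
rewrite setUCA setU11 (_ : (s |: (i |: B)) :\ s = i |: B); last first.
  by rewrite setU1K // !inE eq_sym (negbTE is_).
have [bi|bi] := boolP (below s (i |: B)); last by rewrite y0 // !mulr0.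
have li : (i < s)%N by move/subsetP/(_ i): bi; rewrite !inE eqxx => /(_ isT).
rewrite ksignU // ltnNge (ltnW li) /= mul1r; congr (_ * _ * _).
by apply: mono_ext => t; rewrite !lcme_subE; lia.
Qed.

Lemma belowS (s : 'I_n) A : below s.+1 A = below s (A :\ s).
Proof.
apply/subsetP/subsetP => h i; rewrite !inE.
  by move=> /andP [ne /h]; rewrite inE ltnS leq_eqVlt => /orP [/eqP e|//]; case/eqP: ne; apply: val_inj.
have [->|ne] := eqVneq i s; first by rewrite ltnSn.
by move=> iA; apply: ltnW; rewrite ltnS; move: (h i); rewrite !inE ne iA => /(_ isT).
Qed.

Lemma lcme1 E i t : lcme E [set i] t = E i t.
Proof. by rewrite /lcme big_set1. Qed.

Definition small_ideal E (s : nat) := mid x [seq E i | i <- enum 'I_n & (i < s)%N].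

(** Adding the generator f_s turns the Taylor complex into the mapping cone of a map from the one on
    the quotients f_i / gcd (f_i, f_s). A cycle is first made a boundary on the sets containing s,
    and the remainder lives on smaller indices. For p = 0 membership in the ideal replaces being a
    cycle, so that H_0 is part of the same induction. *)
Lemma taylor_exact_below (s : nat) E p z : (s <= n)%N -> supported s p z ->
  ((0 < p)%N -> forall B, tdiff E z B = 0) ->
  (p = 0%N -> small_ideal E s (z set0)) ->
  exists u, supported s p.+1 u /\ forall B, tdiff E u B = z B.
Proof.
elim: s E p z => [|s IH] E p z sn hz cz Iz.
  exists (fun=> 0); split=> // B; rewrite /tdiff big1; last by move=> *; rewrite mulr0.
  have [/andP [bB cB]|/hz //] := boolP (below 0 B && (#|B| == p)).
  have B0 : B = set0.
    by apply/setP => i; rewrite inE; apply/negP => /(subsetP bB); rewrite inE.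
  have p0 : p = 0%N by move: cB; rewrite B0 cards0 => /eqP.
  have := Iz p0; rewrite B0 /small_ideal (eq_filter (a2 := pred0)) ?filter_pred0 //=.
pose st := Ordinal sn; have est : st = s :> nat by [].
have sn' : (s <= n)%N := ltnW sn.
have [p0|p_gt0] := posnP p.
  have /mid_span [c ec] := Iz p0.
  pose c' := c st.
  pose z2 A := if A == set0 then z set0 - c' * mono (E st) else 0.
  have [|||u [hu eu]] := IH E 0%N z2 sn'.
  - move=> A; rewrite /z2; case: (A =P set0) => // ->; rewrite cards0 eqxx andbT.
    by rewrite /below sub0set.
  - by [].
  - move=> _; rewrite /z2 eqxx /small_ideal; apply/mid_span.
    exists c; rewrite ec (bigD1 st) /= ?ltnSn // /c' addrAC subrr add0r.
    apply: eq_bigl => i; rewrite ltnS; case: (eqVneq i st) => [->|ne].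
      by rewrite ltnn andbF.
    rewrite andbT leq_eqVlt; case: eqP => // e; case/eqP: ne; exact: val_inj.
  exists (fun A => u A + (if A == [set st] then c' else 0)); split=> [A|B].
    move=> hA; rewrite hu ?add0r; last first.
      apply: contra hA; rewrite p0 => /andP [bA ->]; rewrite andbT.
      by apply: subset_trans bA _; apply/subsetP => i; rewrite !inE => /ltnW; rewrite ltnS.
    case: (A =P [set st]) => // eA; move: hA; rewrite p0 eA cards1 eqxx andbT.
    by rewrite /below sub1set inE ltnSn.
  rewrite tdiffD eu /z2; case: (B =P set0) => [->|B0].
    rewrite /tdiff (bigD1 st) ?inE //= setU0 eqxx big1 ?addr0; last first.
      by move=> i /andP [_ ne]; rewrite setU0 (inj_eq (@set1_inj _)) (negbTE ne) mulr0.
    rewrite {1}/ksign (_ : [set _ in _ | _] = set0); last by apply/setP => l; rewrite !inE.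
    rewrite cards0 mul1r (@mono_ext _ _ x _ (E st)); last first.
      by move=> t; rewrite lcme1 lcme0 subn0.
    by rewrite [mono _ * _]mulrC subrK.
  rewrite add0r hz ?p0; last by apply/nandP; right; rewrite cards_eq0; apply/eqP.
  rewrite /tdiff big1 // => i iB; case: eqP => [e|]; rewrite ?mulr0 //.
  case: B0; apply/setP => l; rewrite inE; apply/negP => lB.
  have: l \in i |: B by rewrite inE lB orbT.
  by rewrite e inE => /eqP el; move: iB; have : i \in i |: B by [rewrite setU11]; rewrite e inE => /eqP ->; rewrite -el lB.
pose y A := if below s A then z (st |: A) else 0.
have zy C : st \in C -> z C = (if st \in C then y (C :\ st) else 0).
  move=> sC; rewrite sC /y setD1K //; case: ifP => // /negbT h.
  by apply: hz; rewrite negb_and (belowS st) h.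
have y0 A : ~~ below s A -> y A = 0 by rewrite /y => /negbTE ->.
have stB B : below s B -> st \notin B.
  by move=> bB; apply/negP => /(subsetP bB); rewrite inE ltnn.
have cy B : below s B -> tdiff (subE E st) y B = tdiff E z (st |: B).
  move=> bB; rewrite -tdiff_slice //; apply: tdiff_ext => i _.
  by rewrite -zy // !inE eqxx orbT.
have cyN B : ~~ below s B -> tdiff (subE E st) y B = 0.
  move=> bB; rewrite /tdiff big1 // => i _; rewrite y0 ?mulr0 //.
  by apply: contra bB; apply: subset_trans; apply: subsetUr.
have [|||u [hu eu]] := IH (subE E st) p.-1 y sn'.
- move=> A; rewrite negb_and; case bA: (below s A) => /=; last by rewrite y0 // bA.
  move=> hA; rewrite /y bA hz // negb_and cardsU1 stB // add1n.
  by apply/orP; right; apply: contra hA => /eqP <-.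
- move=> p1 B; have [bB|bB] := boolP (below s B); last exact: cyN.
  by rewrite cy // cz.
(* A cycle of degree 1 is a syzygy. Its coefficient at f_s lies in the colon ideal of the smaller
   generators by f_s, which the f_i / gcd (f_i, f_s) generate. *)
- move=> p1; have p1' : p = 1%N by lia.
  have h := cz p_gt0 set0.
  rewrite /small_ideal.
  have -> : [seq subE E st i | i <- enum 'I_n & (i < s)%N] =
       map (sube (E st)) [seq E i | i <- enum 'I_n & (i < s)%N] by rewrite -map_comp.
  apply: (mid_colon Hreg Hnak).
  rewrite /y /below sub0set setU0; apply/mid_span.
  exists (fun i => - z [set i]).
  move: h; rewrite /tdiff (bigD1 st) ?inE //= => /eqP; rewrite addr_eq0 => /eqP.
  have s0 i : sg i set0 = 1.
    rewrite /ksign (_ : [set _ in _ | _] = set0) ?cards0 //; by apply/setP => l; rewrite !inE.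
  have m0 i : mono (fun t => lcme E (i |: set0) t - lcme E set0 t)%N = mono (E i).
    by apply: mono_ext => t; rewrite setU0 lcme1 lcme0 subn0.
  rewrite s0 mul1r m0 setU0 => ->; rewrite -sumrN big_mkcond [RHS]big_mkcond.
  apply: eq_bigr => i _; rewrite inE /= s0 mul1r m0 setU0.
  case: (eqVneq i st) => [->|ne] /=; first by rewrite ltnn.
  case: ltnP => si; rewrite ?mulNr 1?mulrC // hz ?mul0r ?oppr0 //.
  rewrite negb_and /below sub1set inE ltnS -ltnNge ltn_neqAle si andbT.
  by rewrite (_ : (s != i)) // eq_sym -est; apply: contra ne => /eqP e; apply/eqP/val_inj.
pose U C := if st \in C then u (C :\ st) else 0.
have u0 A : ~~ below s A -> u A = 0.
  by move=> h; rewrite hu // negb_and h.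
have hU : supported s.+1 p.+1 U.
  move=> C; rewrite /U; case: ifP => // sC hC; rewrite hu //.
  apply: contra hC; rewrite (belowS st) => /andP [-> /eqP e] /=.
  by rewrite (cardsD1 st) sC e; apply/eqP; lia.
have dU C : st \in C -> tdiff E U C = z C.
  move=> sC; rewrite -[C](setD1K sC); have [bC|bC] := boolP (below s (C :\ st)).
    by rewrite tdiff_slice // eu /y bC.
  rewrite [RHS]hz; last by rewrite setD1K // negb_and (belowS st) bC.
  rewrite /tdiff big1 // => i iC; rewrite hU ?mulr0 // negb_and (belowS st).
  apply/orP; left; apply: contra bC; apply: subset_trans.
  by apply/subsetP => l; rewrite !inE => /andP [-> ->]; rewrite !orbT.
have hdU : supported s.+1 p (tdiff E U).
  move=> C hC; rewrite /tdiff big1 // => i iC; rewrite hU ?mulr0 //.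
  apply: contra hC; rewrite cardsU1 iC add1n eqSS => /andP [b ->]; rewrite andbT.
  by apply: subset_trans b; apply: subsetUr.
(* The boundary of U already agrees with z on every set containing s. *)
pose z2 C := z C - tdiff E U C.
have [|||w [hw ew]] := IH E p z2 sn'.
- move=> C; rewrite /z2 => hC; have [sC|sC] := boolP (st \in C); first by rewrite dU ?subrr.
  have hC' : ~~ (below s.+1 C && (#|C| == p)).
    apply: contra hC => /andP [b ->]; rewrite andbT.
    move: b; rewrite (belowS st) (_ : C :\ st = C) //.
    by apply/setP => l; rewrite !inE; case: eqP => // ->; rewrite (negbTE sC).
  by rewrite hz // hdU // subrr.
- by move=> _ B; rewrite /z2 tdiffD tdiffN tdiff_tdiff cz // subrr.
- by lia.
exists (fun C => U C + w C); split=> [C hC|B].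
  rewrite hU // hw ?addr0 //; apply: contra hC => /andP [b ->]; rewrite andbT.
  by apply: subset_trans b _; apply/subsetP => i; rewrite !inE => /ltnW; rewrite ltnS.
by rewrite tdiffD ew /z2 addrC subrK.
Qed.

End TaylorExact.

Section FinMatrix.
Variables (R : pzRingType) (T : finType).

Definition fmat (F : T -> T -> R) : 'M[R]_#|T| := \matrix_(a, b) F (enum_val a) (enum_val b).

Lemma sum_enum_val (V : nmodType) (F : T -> V) :
  \sum_(a < #|T|) F (enum_val a) = \sum_A F A.
Proof.
rewrite [RHS](reindex (@enum_val _ T)) //.
by exists enum_rank => a _; rewrite ?enum_valK ?enum_rankK.
Qed.

Lemma fmatM F G : fmat F *m fmat G = fmat (fun A B => \sum_C F A C * G C B).
Proof.
apply/matrixP => a b; rewrite !mxE -sum_enum_val.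
by apply: eq_bigr => c _; rewrite !mxE.
Qed.

End FinMatrix.

Section TaylorModule.
Variables (Q : comUnitRingType) (d : nat) (x : 'I_d -> Q) (n : nat).
Variable E : 'I_n -> 'I_d -> nat.
Implicit Types (A B C : {set 'I_n}).
Local Notation mono := (mono x).
Local Notation N := #|{set 'I_n}|.

Definition tdeg (a : 'I_N) : int := #|enum_val a|%:Z.
Local Notation tmat := (@fmat Q {set 'I_n}).

Lemma tmat_hom F s : (forall A B, #|B|%:Z != #|A|%:Z + s -> F A B = 0) ->
  homg tdeg tdeg s (tmat F).
Proof. by move=> h a b e; rewrite mxE h. Qed.

Lemma tay_d_hom : homg tdeg tdeg (-1) (tmat (tay_d x E)).
Proof.
apply: tmat_hom => A B ne; rewrite /tay_d big1 // => i /andP [iA /eqP e].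
by move: ne; rewrite e [#|A|](cardsD1 i) iA; case/eqP; lia.
Qed.

Lemma tay_e_hom j : homg tdeg tdeg 1 (tmat (tay_e x E j)).
Proof.
apply: tmat_hom => A B ne; rewrite /tay_e; case: ifP => // /andP [jA /eqP e].
by move: ne; rewrite e cardsU1 jA; case/eqP; lia.
Qed.

Lemma tay_d_sq : tmat (tay_d x E) *m tmat (tay_d x E) = 0.
Proof. by rewrite fmatM; apply/matrixP => a b; rewrite !mxE tay_dd. Qed.

Definition taylor_gcx : gcx Q := Gcx tay_d_hom tay_d_sq.

Lemma tay_e_sq j : tmat (tay_e x E j) *m tmat (tay_e x E j) = 0.
Proof. by rewrite fmatM; apply/matrixP => a b; rewrite !mxE tay_ee. Qed.

Lemma tay_e_C j l :
  tmat (tay_e x E l) *m tmat (tay_e x E j) = - (tmat (tay_e x E j) *m tmat (tay_e x E l)).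
Proof. by rewrite !fmatM; apply/matrixP => a b; rewrite !mxE tay_eC. Qed.

Lemma tay_e_d j : tmat (tay_e x E j) *m tmat (tay_d x E) +
  tmat (tay_d x E) *m tmat (tay_e x E j) = (mono (E j))%:M.
Proof.
rewrite !fmatM; apply/matrixP => a b; rewrite !mxE tay_de (inj_eq enum_val_inj).
by case: eqVneq; rewrite ?mulr1n ?mulr0n.
Qed.

Definition taylor : gmod (fun i => mono (E i)) :=
  @Gmod _ _ _ taylor_gcx (fun j => tmat (tay_e x E j)) tay_e_hom tay_e_sq tay_e_C tay_e_d.

Hypotheses (Hreg : initial_regular x) (Hnak : nakayama_vid x).

Let fn (v : 'rV[Q]_N) : {set 'I_n} -> Q := fun A => v 0 (enum_rank A).

Let tdiff_row v B : (v *m gd taylor_gcx) 0 (enum_rank B) = tdiff x E (fn v) B.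
Proof.
rewrite -tdiffE -sum_enum_val mxE; apply: eq_bigr => a _.
by rewrite mxE enum_rankK /fn enum_valK.
Qed.

Lemma below_all A : below n A.
Proof. by apply/subsetP => i _; rewrite inE ltn_ord. Qed.

Lemma taylor_resolution (I : Q -> Prop) :
  (forall q, I q <-> mid x [seq E i | i <- enum 'I_n] q) -> resolution I taylor.
Proof.
move=> I_mid.
have exact p (v : 'rV[Q]_N) : hrow tdeg p%:Z v ->
    ((0 < p)%N -> v *m gd taylor_gcx = 0) ->
    (p = 0%N -> I (fn v set0)) ->
    exists w, hrow tdeg (p%:Z + 1) w /\ w *m gd taylor_gcx = v.
  move=> hv cv Iv.
  have [|||u [hu eu]] := @taylor_exact_below Q d x n Hreg Hnak n E p (fn v) (leqnn n).
  - move=> A; rewrite below_all /= => cA; rewrite /fn hv // /tdeg enum_rankK.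
    by apply: contra cA => /eqP [->].
  - by move=> p0 B; rewrite -tdiff_row cv // mxE.
  - move=> p0; have /I_mid := Iv p0; rewrite /small_ideal.
    rewrite (eq_filter (a2 := predT)) ?filter_predT // => i; exact: ltn_ord.
  exists (\row_a u (enum_val a)); split.
    move=> a e; rewrite mxE hu // below_all /=.
    by apply: contra e => /eqP e; rewrite /tdeg e -addn1 PoszD.
  apply/rowP => b; rewrite -[b]enum_valK tdiff_row -[RHS]/(fn v (enum_val b)) -eu.
  by apply: tdiff_ext => i _; rewrite /fn mxE enum_rankK.
split=> [i i0 v hv vd|].
  have [i_neg|i_pos] := ltrP i 0.
    exists 0; split; first by move=> y _; rewrite mxE.
    rewrite mul0mx; apply/rowP => a; rewrite hv ?mxE //=.
    by rewrite /tdeg; apply/eqP; lia.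
  have ei : i = `|i|%N%:Z by lia.
  rewrite ei; apply: exact => //; first by rewrite -ei.
  by move=> e; move: i0; rewrite ei e eqxx.
pose z : 'rV[Q]_N := delta_mx 0 (enum_rank set0).
have fz A : fn z A = (A == set0)%:R.
  by rewrite /fn mxE eqxx /= (inj_eq enum_rank_inj).
have hz : hrow tdeg 0 z.
  move=> a e; rewrite -[a]enum_valK -[LHS]/(fn z (enum_val a)) fz.
  by case: eqP => // e0; move: e; rewrite /tdeg e0 cards0.
have zd (v : 'rV[Q]_N) : hrow tdeg 0 v -> v = fn v set0 *: z.
  move=> hv; apply/rowP => a; rewrite -[a]enum_valK mxE -[z 0 _]/(fn z (enum_val a)) fz.
  case: eqP => [->|/eqP ne]; first by rewrite mulr1.
  by rewrite mulr0 hv // /tdeg enum_valK; apply: contra ne => /eqP [] /eqP; rewrite cards_eq0.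
exists z; split=> //.
- apply/rowP => b; rewrite -[b]enum_valK tdiff_row mxE /tdiff big1 // => i _.
  rewrite fz; case: eqP => [e|]; rewrite ?mulr0 //.
  by have := setU11 i (enum_val b); rewrite e inE.
- move=> v hv _; exists (fn v set0), 0; split; first by move=> y _; rewrite mxE.
  by rewrite mul0mx addr0; apply: zd.
move=> q; split=> [Iq|[w [hw e]]].
  have [||_|w [hw e]] := exact 0%N (q *: z); last by exists w.
  - exact: hrowZ.
  - by [].
  - by rewrite /fn mxE -[z 0 _]/(fn z set0) fz eqxx mulr1.
apply/I_mid.
have := tdiff_row w set0; rewrite e mxE -[z 0 _]/(fn z set0) fz eqxx mulr1 => ->.
apply: mid_sum => i _.
rewrite (_ : _ * _ = (fn w (i |: set0) * ksign Q i set0) * mono (E i)); last first.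
  rewrite (@mono_ext _ _ x _ (E i)); first by ring.
  by move=> t; rewrite setU0 lcme1 lcme0 subn0.
by apply: mid_gen; rewrite has_map; apply/hasP; exists i; [rewrite mem_enum | exact: lem_refl].
Qed.

End TaylorModule.

Lemma mp_taylor_resolution (k : fieldType) n (P : monomial_presentation k n) :
  resolution (mp_ideal P) (taylor (@mp_x _ _ P) (fun i j => mp_exp P i j)).
Proof.
apply: taylor_resolution; [exact: mp_initial_regular|exact: mp_nakayama|exact: mp_ideal_mid].
Qed.

(** * Quotient rings, residue fields and quotient modules *)

Section Quotients.
Local Open Scope quotient_scope.

Lemma quotient_ring_exists (Q : comNzRingType) (I : Q -> Prop) :
  I 0 -> (forall a b, I a -> I b -> I (a + b)) -> (forall r a, I a -> I (r * a)) -> ~ I 1 ->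
  exists (R : comNzRingType) (f : {rmorphism Q -> R}),
    (forall y, exists q, f q = y) /\ (forall q, f q = 0 <-> I q).
Proof.
move=> I0 ID IM I1.
(* The quotient construction takes a boolean predicate, which classical logic provides. *)
pose S : Q -> bool := fun q => asbool (I q).
have SP q : reflect (I q) (q \in (S : {pred Q})) by apply: asboolP.
have hS : idealr_closed (S : {pred Q}).
  split; [by apply/SP|by apply/SP|move=> a u v /SP hu /SP hv].
  by apply/SP; apply: ID => //; apply: IM.
pose J : idealr Q := HB.pack S (isIdealr.Build Q S hS).
exists {ideal_quot J}, (\pi_{ideal_quot J}).
split=> [y|q]; first by exists (repr y); apply: reprK.
rewrite -(rmorph0 (\pi_{ideal_quot J})) /=.
split=> [/eqP|Iq].
  by rewrite -Quotient.idealrBE subr0 => /SP.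
by apply/eqP; rewrite -Quotient.idealrBE subr0; apply/SP.
Qed.

Lemma fraction_field_exists (R : comNzRingType) :
  (forall x y : R, x * y = 0 -> x = 0 \/ y = 0) ->
  exists (K : fieldType) (f : {rmorphism R -> K}), injective f.
Proof.
move=> hR.
(* The fraction field is formed over rings equipped with an inverse; units and inverses are chosen
   classically. *)
pose unit : pred R := fun x => asbool (exists y, y * x = 1).
pose inv (x : R) := if pselect (exists y, y * x = 1) is left h then projT1 (cid h) else x.
have mulVr : {in unit, left_inverse 1 inv *%R}.
  move=> x /asboolP ux; rewrite /inv; case: pselect => // h.
  exact: (projT2 (cid h)).
have unitP : forall x y, y * x = 1 -> unit x by move=> x y e; apply/asboolP; exists y.
have inv_out : {in [predC unit], inv =1 id}.
  by move=> x /asboolP ux; rewrite /inv; case: pselect.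
pose U : comUnitRingType := HB.pack (GRing.ComNzRing.sort R)
  (GRing.ComNzRing_hasMulInverse.Build R mulVr unitP inv_out).
have dom : GRing.integral_domain_axiom U.
  move=> x y e; have := hR x y e.
  by case=> e'; apply/orP; [left|right]; apply/eqP.
pose D : idomainType := HB.pack (GRing.ComUnitRing.sort U)
  (GRing.ComUnitRing_isIntegral.Build U dom).
pose fD : {rmorphism D -> {fraction D}} := @tofrac D.
exists {fraction D}, fD.
by move=> a b /eqP; rewrite (@tofrac_eq D) => /eqP.
Qed.

Lemma residue_field_exists (S : comUnitRingType) (p : spec S) :
  exists (K : fieldType) (ev : {rmorphism S -> K}), forall s, p s <-> ev s = 0.
Proof.
have [[I0 ID IM] I1 Ip] := @spec_prime _ p.
have [R [f [fs fI]]] := quotient_ring_exists I0 ID IM I1.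
have [|K [g g_inj]] := @fraction_field_exists R.
  move=> x y; have [a <-] := fs x; have [b <-] := fs y.
  by rewrite -rmorphM => /fI /Ip [] /fI; [left|right].
exists K, (g \o f) => s; rewrite -fI /=; split=> [->|]; first by rewrite rmorph0.
by rewrite -[0](rmorph0 g) => /g_inj.
Qed.

Lemma quotient_module_exists (Q : comUnitRingType) (I : Q -> Prop) : ideal I -> ~ I 1 ->
  exists (M : lmodType Q) (pr : {linear Q^o -> M}),
    (forall y, exists q, pr q = y) /\ (forall q, pr q = 0 <-> I q).
Proof.
move=> [I0 ID IM] I1; have [R [f [fs fI]]] := quotient_ring_exists I0 ID IM I1.
pose sc (a : Q) (u : R) : R := f a * u.
have scA a b v : sc a (sc b v) = sc (a * b) v by rewrite /sc rmorphM mulrA.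
have sc1 : left_id 1 sc by move=> v; rewrite /sc rmorph1 mul1r.
have scDr : right_distributive sc +%R by move=> a u v; rewrite /sc mulrDr.
have scDl v : {morph sc^~ v : a b / a + b} by move=> a b; rewrite /sc rmorphD mulrDl.
pose M : lmodType Q := HB.pack (GRing.ComNzRing.sort R)
  (GRing.Zmodule_isLmodule.Build Q (GRing.ComNzRing.sort R) scA sc1 scDr scDl).
have lin : linear (f : Q^o -> M).
  by move=> a u v; rewrite rmorphD rmorphM.
pose L : {linear Q^o -> M} := HB.pack (f : Q^o -> M)
  (GRing.isLinear.Build Q Q^o M *:%R (f : Q^o -> M) lin).
by exists M, L.
Qed.

End Quotients.

(** * From graded matrices to dg modules and back *)

Section FreeOfGmod.
Variables (Q : comUnitRingType) (n : nat) (f : 'I_n -> Q) (X : gmod f).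
Local Notation deg := (gdeg (g := X)).

Definition grk (i : int) : nat := #|[pred x | deg x == i]|.

Definition gblock (Z : 'M[Q]_(gn X)) i j : 'M[Q]_(grk i, grk j) :=
  \matrix_(r, c) Z (enum_val r) (enum_val c).

Lemma grk_deg i (r : 'I_(grk i)) : deg (enum_val r) = i.
Proof. by apply/eqP; have := enum_valP r; rewrite inE. Qed.

Lemma gblockM s Z W i j k : homg deg deg s Z -> j = i + s ->
  gblock Z i j *m gblock W j k = gblock (Z *m W) i k.
Proof.
move=> hZ ej; apply/matrixP => r c; rewrite !mxE.
under eq_bigr => u _ do rewrite !mxE.
rewrite -(big_enum_val (fun y => Z (enum_val r) y * W y (enum_val c))) /=.
rewrite big_mkcond; apply: eq_bigr => y _; rewrite inE.
by case: eqP => // /eqP ne; rewrite hZ ?mul0r // grk_deg -ej.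
Qed.

Lemma gblock0 i j : gblock 0 i j = 0.
Proof. by apply/matrixP => r c; rewrite !mxE. Qed.

Lemma gblockN Z i j : gblock (- Z) i j = - gblock Z i j.
Proof. by apply/matrixP => r c; rewrite !mxE. Qed.

Lemma gblockB Z W i j : gblock (Z - W) i j = gblock Z i j - gblock W i j.
Proof. by apply/matrixP => r c; rewrite !mxE. Qed.

Lemma gblock_scalar a i : gblock a%:M i i = a%:M.
Proof. by apply/matrixP => r c; rewrite !mxE (inj_eq enum_val_inj). Qed.

Lemma gfree_bounded : exists b : nat, forall i : int, (b < `|i|)%N -> grk i = 0%N.
Proof.
have [b hb] := gdeg_bounded X; exists b => i bi.
by apply: eq_card0 => x; rewrite !inE; apply/eqP; have := hb x; lia.
Qed.

Lemma gfree_dd i : gblock (gd X) (i + 1 + 1) (i + 1) *m gblock (gd X) (i + 1) i = 0.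
Proof. by rewrite (gblockM _ _ (@gd_hom _ X)) ?gd_sq ?gblock0 //; lia. Qed.

Lemma gfree_ee j i : gblock (ge X j) i (i + 1) *m gblock (ge X j) (i + 1) (i + 1 + 1) = 0.
Proof. by rewrite (gblockM _ _ (@ge_hom _ _ _ X j)) // ge_sq gblock0. Qed.

Lemma gfree_eC j l i :
  gblock (ge X l) i (i + 1) *m gblock (ge X j) (i + 1) (i + 1 + 1) =
  - (gblock (ge X j) i (i + 1) *m gblock (ge X l) (i + 1) (i + 1 + 1)).
Proof. by rewrite !(gblockM _ _ (@ge_hom _ _ _ X _)) // ge_C gblockN. Qed.

Lemma gfree_de j i :
  gblock (ge X j) (i + 1) (i + 1 + 1) *m gblock (gd X) (i + 1 + 1) (i + 1) =
  (f j)%:M - gblock (gd X) (i + 1) i *m gblock (ge X j) i (i + 1).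
Proof.
rewrite (gblockM _ _ (@ge_hom _ _ _ X _)) // (gblockM _ _ (@gd_hom _ X)); last by lia.
by rewrite -gblock_scalar -gblockB -(ge_d X j) addrK.
Qed.

Definition gfree : free_dgE f :=
  @FreeDgE Q n f grk (fun i => gblock (gd X) (i + 1) i)
    (fun j i => gblock (ge X j) i (i + 1))
    gfree_bounded gfree_dd gfree_ee gfree_eC gfree_de.

Definition gcomp i (v : 'rV[Q]_(gn X)) : 'rV[Q]_(grk i) := \row_r v 0 (enum_val r).
Definition gemb i (w : 'rV[Q]_(grk i)) : 'rV[Q]_(gn X) :=
  \sum_r w 0 r *: delta_mx 0 (enum_val r).

Lemma gemb_hrow i w : hrow deg i (gemb (i := i) w).
Proof.
move=> y e; rewrite summxE big1 // => r _; rewrite !mxE eqxx /=.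
case: eqP => [ey|]; rewrite ?mulr0 //.
by move: e; rewrite ey grk_deg eqxx.
Qed.

Lemma gembK i w : gcomp i (gemb w) = w.
Proof.
apply/rowP => r; rewrite mxE summxE (bigD1 r) //= !mxE !eqxx mulr1 big1 ?addr0 // => u /negbTE ur.
by rewrite !mxE eqxx /= (inj_eq enum_val_inj) eq_sym ur mulr0.
Qed.

Lemma gcompK i v : hrow deg i v -> gemb (gcomp i v) = v.
Proof.
move=> hv; apply/rowP => y; rewrite summxE.
under eq_bigr => r _ do rewrite !mxE eqxx /=.
rewrite -(big_enum_val (fun x => v 0 x * (y == x)%:R)) /= big_mkcond (bigD1 y) //= big1 ?addr0.
  by rewrite inE eqxx mulr1; case: eqP => // /eqP /hv ->.
by move=> x /negbTE yx; rewrite [y == x]eq_sym yx mulr0 if_same.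
Qed.

Lemma gembM i w Z s j : homg deg deg s Z -> j = i + s ->
  gemb (w *m gblock Z i j) = gemb (i := i) w *m Z.
Proof.
move=> hZ ej; have h : hrow deg j (gemb (i := i) w *m Z).
  by rewrite ej; apply: hrowM hZ; apply: gemb_hrow.
rewrite -[RHS](gcompK h); congr gemb; apply/rowP => c; rewrite !mxE.
rewrite -{1}[w]gembK [RHS](bigID (fun y => deg y == i)) /= [X in _ = _ + X]big1 ?addr0; last first.
  by move=> y ny; rewrite (gemb_hrow w ny) mul0r.
rewrite (big_enum_val (fun y => gemb w 0 y * Z y (enum_val c))).
by apply: eq_bigr => r _; rewrite !mxE.
Qed.

Hypothesis deg_ge0 : forall x, 0 <= deg x.
Variable I : Q -> Prop.
Hypotheses (idI : ideal I) (I1 : ~ I 1) (If : forall j, I (f j)) (resX : resolution I X).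

Lemma grk_neg i : i < 0 -> grk i = 0%N.
Proof.
by move=> i0; apply: eq_card0 => x; rewrite !inE; apply/eqP; have := deg_ge0 x; lia.
Qed.

(** The zigzag is a single map, the augmentation: in degree 0 it reads off the coefficient of z,
    which is well defined modulo I. Nonnegative degrees make every element of degree 0 a cycle. *)
Lemma gfree_resolves : resolves I gfree.
Proof.
have [M [pr [prs prI]]] := quotient_module_exists idI I1.
have [aX [z [hz zd genz Iz]]] := resX.
(* By matching on the integer, the module in degree 0 is M by conversion, also where the degree is
   written -1 + 1. *)
pose mod0 (i : int) : lmodType Q := if i is Posz 0 then M else 'rV[Q]_0.
have mod00 (i : int) : i != 0 -> forall u : mod0 i, u = 0.
  by case: i => [[|m]|m] // _ u; apply: thinmx0.
have Mf (i : int) j (u : mod0 i) : f j *: u = 0.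
  case: i u => [[|m]|m] u; rewrite ?[u]thinmx0 ?scaler0 //.
  have [q <-] := prs u; rewrite -linearZ /=; apply/prI.
  by have [_ _ IM] := idI; rewrite -[_ *: _]/(f j * q) mulrC; apply: IM.
have e1 (j : 'I_n) (i : int) (u : mod0 (i + 1)) :
   (\0 : {linear mod0 (i + 1 + 1) -> mod0 (i + 1)}) ((\0 : {linear mod0 (i + 1) -> mod0 (i + 1 + 1)}) u) =
   f j *: u - (\0 : {linear mod0 i -> mod0 (i + 1)}) ((\0 : {linear mod0 (i + 1) -> mod0 i}) u).
  by rewrite /= subr0 Mf.
pose MM : dgE f := @DgE Q n f mod0 (fun i => \0) (fun j i => \0)
  (fun _ _ => erefl) (fun _ _ _ => erefl) (fun _ _ _ _ => esym (oppr0 _)) e1.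
exists MM; split.
  by split=> [i i0 u|]; [apply: mod00|exists pr].
have hcyc v : hrow deg 0 v -> v *m gd X = 0.
  move=> hv; apply/rowP => y; rewrite (hrowM hv (@gd_hom _ X)) ?mxE //.
  by apply/eqP; have := deg_ge0 y; lia.
have hdelta (x : 'I_(gn X)) : hrow deg (deg x) (delta_mx 0 x : 'rV[Q]_(gn X)).
  by move=> y; rewrite mxE eqxx /=; case: (eqVneq y x) => // ->; rewrite eqxx.
have /choice [q /choice [w hq]] : forall x, exists (q : Q) (w : 'rV[Q]_(gn X)),
    deg x = 0 -> hrow deg 1 w /\ delta_mx 0 x = q *: z + w *m gd X.
  move=> x; have [e|ne] := eqVneq (deg x) 0; last by exists 0, 0 => e; rewrite e eqxx in ne.
  have hx : hrow deg 0 (delta_mx 0 x : 'rV[Q]_(gn X)) by rewrite -e; apply: hdelta.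
  by have [q [w hw]] := genz _ hx (hcyc _ hx); exists q, w.
pose aug (v : 'rV[Q]_(gn X)) : Q := \sum_x v 0 x * q x.
have augE v : hrow deg 0 v -> exists w', hrow deg 1 w' /\ v = aug v *: z + w' *m gd X.
  move=> hv; exists (\sum_(x | deg x == 0) v 0 x *: w x); split.
    move=> y e; rewrite summxE big1 // => x /eqP ex; rewrite mxE.
    by have [-> //] := hq x ex; rewrite mulr0.
  rewrite {1}[v]row_sum_delta scaler_suml mulmx_suml.
  rewrite [X in _ = X + _](bigID (fun x => deg x == 0)) /= [X in _ = _ + X + _]big1 ?addr0; last first.
    by move=> x /hv ->; rewrite mul0r scale0r.
  rewrite [LHS](bigID (fun x => deg x == 0)) /= [X in _ + X = _]big1 ?addr0; last first.
    by move=> x /hv ->; rewrite scale0r.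
  rewrite -big_split; apply: eq_bigr => x /eqP /hq [_ ->].
  by rewrite scalerDr scalerA -scalemxAl.
have augD : forall a u v, aug (a *: u + v) = a * aug u + aug v.
  move=> a u v; rewrite /aug mulr_sumr -big_split; apply: eq_bigr => x _.
  by rewrite !mxE mulrDl mulrA.
have augI v w' : hrow deg 0 v -> hrow deg 1 w' -> v = w' *m gd X -> I (aug v).
  move=> hv hw' ev; have [w2 [hw2 e2]] := augE v hv.
  apply/Iz; exists (w' - w2); split.
    by rewrite -scaleN1r; apply: hrowD => //; apply: hrowZ.
  by rewrite mulmxBl -ev {1}e2 addrK.
pose h0 (v : 'rV[Q]_(grk 0)) : M := pr (aug (gemb v)).
have gembD i a (u v : 'rV[Q]_(grk i)) : gemb (a *: u + v) = a *: gemb u + gemb v.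
  rewrite /gemb scaler_sumr -big_split; apply: eq_bigr => r _.
  by rewrite !mxE scalerDl scalerA.
have h0lin : linear h0.
  by move=> a u v; rewrite /h0 gembD augD linearD /= -linearZ.
pose h0L : {linear 'rV[Q]_(grk 0) -> M} := HB.pack h0
  (GRing.isLinear.Build Q 'rV[Q]_(grk 0) M *:%R h0 h0lin).
pose hm (i : int) : {linear 'rV[Q]_(grk i) -> mod0 i} :=
  match i return {linear 'rV[Q]_(grk i) -> mod0 i} with Posz 0 => h0L | _ => \0 end.
have rk_nil (i : int) (v : 'rV[Q]_(grk i)) : i < 0 -> v = 0.
  by move=> /grk_neg e; apply/rowP => r; have := ltn_ord r; rewrite [X in (_ < X)%N]e.
have hm_d (i : int) (v : 'rV[Q]_(grk (i + 1))) : hm i (v *m gblock (gd X) (i + 1) i) = 0.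
  have [i0|i0] := eqVneq i 0; last exact: mod00.
  subst i; rewrite /hm /= /h0; apply/prI.
  have hw : hrow deg 1 (gemb v) by apply: gemb_hrow.
  rewrite (gembM (s := -1) _ (@gd_hom _ X)) //.
  apply: (augI _ (gemb v)) => //.
  exact: (hrowM hw (@gd_hom _ X)).
have hm_e j (i : int) (v : 'rV[Q]_(grk i)) : hm (i + 1) (v *m gblock (ge X j) i (i + 1)) = 0.
  have [i0|i0] := eqVneq (i + 1) 0; last exact: mod00.
  by rewrite [v]rk_nil ?mul0mx ?linear0 //; lia.
pose H : dg_hom (dgE_of_free gfree) MM := @DgHom Q n f (dgE_of_free gfree) MM hm hm_d hm_e.
apply: (QisoForward (h := H)); last exact: QisoRefl.
move=> i; have [i0|i0] := eqVneq (i + 1) 0; last first.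
  split=> [v cv _|y _]; last first.
    exists 0; split; first exact: mul0mx.
    by exists 0; rewrite linear0; symmetry; apply: mod00.
  have [|w' [hw' e]] := aX _ i0 (gemb v) (gemb_hrow v).
    rewrite -(gembM (j := i) v (@gd_hom _ X)); last by lia.
    have -> : v *m gblock (gd X) (i + 1) i = 0 by exact: cv.
    by rewrite /gemb big1 // => r _; rewrite mxE scale0r.
  exists (gcomp (i + 1 + 1) w'); rewrite /= -[RHS]gembK -[LHS]gembK; congr gcomp.
  rewrite (gembM (s := -1) _ (@gd_hom _ X)); last by lia.
  by rewrite gcompK.
have ei : i = -1 by lia.
subst i; split=> [v _ [u hu]|y _].
  have hv : hrow deg 0 (gemb (v : 'rV[Q]_(grk 0))) by apply: gemb_hrow.
  have Iv : I (aug (gemb (v : 'rV[Q]_(grk 0)))).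
    by apply/prI; symmetry; exact: hu.
  have [w1 [hw1 e1']] := augE _ hv; have /Iz [w2 [hw2 e2]] := Iv.
  have hw12 : hrow deg 1 (w2 + w1) by apply: hrowD.
  exists (gcomp 1 (w2 + w1)).
  have e : (v : 'rV[Q]_(grk 0)) = gcomp 1 (w2 + w1) *m gblock (gd X) 1 0.
    rewrite -[LHS]gembK -[RHS]gembK; congr gcomp.
    rewrite (gembM (s := -1) _ (@gd_hom _ X)) // gcompK // mulmxDl e2.
    exact: e1'.
  by symmetry; exact: e.
have [q0 eq0] := prs (y : M).
exists (gcomp 0 (q0 *: z)); split.
  by apply: rk_nil.
exists 0; rewrite /= -[RHS]/((y : M) - h0 (gcomp 0 (q0 *: z))).
rewrite -eq0 /h0 gcompK; last exact: hrowZ.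
rewrite -linearB /=; symmetry; apply/prI.
have hqz : hrow deg 0 (q0 *: z) by apply: hrowZ.
have [w1 [hw1 e1']] := augE _ hqz; apply/Iz; exists w1; split=> //.
by rewrite scalerBl {1}e1' addrAC subrr add0r.
Qed.

End FreeOfGmod.

Section Zigzag.
Variables (Q : comUnitRingType) (n : nat) (f : 'I_n -> Q) (I : Q -> Prop).

(** The part of a zigzag that the comparison needs: homology Q/I in degree 0 and none elsewhere.
    Degree 0 appears as -1 + 1 because cycles are indexed by the target of the differential. *)
Definition homology_quotient (M : dgE f) : Prop :=
  (forall i : int, i + 1 != 0 -> forall x : dg_mod M (i + 1), is_cycle x -> is_boundary x) /\
  exists z : dg_mod M (-1 + 1), [/\ is_cycle z,
    forall x : dg_mod M (-1 + 1), is_cycle x -> exists q, is_boundary (x - q *: z) &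
    forall q, I q <-> is_boundary (q *: z)].

Lemma is_boundaryD (M : dgE f) i (x y : dg_mod M i) :
  is_boundary x -> is_boundary y -> is_boundary (x + y).
Proof. by move=> [u <-] [v <-]; exists (u + v); rewrite linearD. Qed.

Lemma is_boundaryZ (M : dgE f) i a (x : dg_mod M i) : is_boundary x -> is_boundary (a *: x).
Proof. by move=> [u <-]; exists (a *: u); rewrite linearZ. Qed.

Lemma is_cycleZ (M : dgE f) i a (x : dg_mod M (i + 1)) : is_cycle x -> is_cycle (a *: x).
Proof. by rewrite /is_cycle => e; rewrite linearZ /= e scaler0. Qed.

Lemma is_cycleB (M : dgE f) i (x y : dg_mod M (i + 1)) :
  is_cycle x -> is_cycle y -> is_cycle (x - y).
Proof. by rewrite /is_cycle => ex ey; rewrite linearB /= ex ey subrr. Qed.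

Section Hom.
Variables (M N : dgE f) (h : dg_hom M N).

Lemma hom_boundary i (x : dg_mod M i) : is_boundary x -> is_boundary (dgh_map h i x).
Proof. by move=> [u <-]; exists (dgh_map h (i + 1) u); rewrite -dgh_d. Qed.

Lemma hom_cycle i (x : dg_mod M (i + 1)) : is_cycle x -> is_cycle (dgh_map h (i + 1) x).
Proof. by rewrite /is_cycle -dgh_d => ->; rewrite linear0. Qed.

Hypothesis qh : quasi_iso h.

Lemma homology_quotient_forward : homology_quotient M -> homology_quotient N.
Proof.
move=> [aM [z [cz gz Iz]]]; split=> [i i0 y cy|].
  have [_ /(_ y cy) [x [cx bx]]] := qh i.
  rewrite -(subrK (dgh_map h (i + 1) x) y); apply: is_boundaryD => //.
  by apply: hom_boundary; apply: aM.
exists (dgh_map h (-1 + 1) z); split; first exact: hom_cycle.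
  move=> y cy; have [_ /(_ y cy) [x [cx bx]]] := qh (-1).
  have [q bq] := gz x cx; exists q.
  rewrite -(subrK (dgh_map h (-1 + 1) x) y) -addrA; apply: is_boundaryD => //.
  by rewrite -linearZ -linearB; apply: hom_boundary.
move=> q; rewrite -linearZ /=; split=> [/Iz|] bq; first exact: hom_boundary.
by apply/Iz; have [inj _] := qh (-1); apply: inj => //; apply: is_cycleZ.
Qed.

Lemma homology_quotient_backward : homology_quotient N -> homology_quotient M.
Proof.
move=> [aN [z [cz gz Iz]]]; split=> [i i0 x cx|].
  by have [inj _] := qh i; apply: inj => //; apply: aN => //; apply: hom_cycle.
have [inj /(_ z cz) [x0 [cx0 b0]]] := qh (-1).
exists x0; split=> // [x cx|q].
  have [q bq] := gz _ (hom_cycle cx); exists q; apply: inj.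
    by apply: is_cycleB => //; apply: is_cycleZ.
  rewrite linearB linearZ /=.
  rewrite -(subrK (q *: z) (dgh_map h (-1 + 1) x)) -addrA -scalerBr.
  by apply: is_boundaryD => //; apply: is_boundaryZ.
have e : q *: z = q *: (z - dgh_map h (-1 + 1) x0) + dgh_map h (-1 + 1) (q *: x0).
  by rewrite linearZ /= scalerBr subrK.
split=> [/Iz bq|bq].
  apply: inj; first exact: is_cycleZ.
  have -> : dgh_map h (-1 + 1) (q *: x0) = q *: z + (- q) *: (z - dgh_map h (-1 + 1) x0).
    by rewrite e scaleNr; move: (q *: (z - _)) (dgh_map _ _ _) => u v; rewrite [u + v]addrC addrK.
  by apply: is_boundaryD => //; apply: is_boundaryZ.
apply/Iz; rewrite e; apply: is_boundaryD; first exact: is_boundaryZ.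
exact: hom_boundary.
Qed.

End Hom.

Lemma homology_quotient_base (M : dgE f) : is_quotient_dgE I M -> homology_quotient M.
Proof.
move=> [M0 [pr [prs prI]]]; split=> [i i0 x _|].
  by exists 0; rewrite linear0 (M0 _ i0 x).
have bdry (x : dg_mod M (-1 + 1)) : is_boundary x <-> x = 0.
  split=> [[u <-]|->]; last by exists 0; rewrite linear0.
  by rewrite (M0 (-1 + 1 + 1) _ u) ?linear0.
have pr1 (q : Q) : q *: pr 1 = pr q.
  by rewrite -linearZ; congr (pr _); rewrite -[_ *: _]/(q * 1) mulr1.
exists (pr 1 : dg_mod M (-1 + 1)); split=> [|x _|q].
- exact: M0.
- have [q eq] := prs (x : dg_mod M 0); exists q; apply/bdry.
  have h : (x : dg_mod M 0) - q *: pr 1 = 0 by rewrite pr1 eq subrr.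
  exact: h.
have h : I q <-> q *: pr 1 = 0 by rewrite pr1 prI.
by rewrite bdry; exact: h.
Qed.

Lemma quasi_isomorphic_homology (M N : dgE f) :
  quasi_isomorphic M N -> homology_quotient N -> homology_quotient M.
Proof.
by elim=> // {M N} M N P h qh _ IH /IH; [apply: homology_quotient_backward|apply: homology_quotient_forward].
Qed.

Lemma resolves_homology (F : free_dgE f) :
  resolves I F -> homology_quotient (dgE_of_free F).
Proof. by move=> [M [/homology_quotient_base hM /quasi_isomorphic_homology]]; apply. Qed.

End Zigzag.

Section Entries.
Variable R : pzRingType.

(* Entries indexed by arbitrary naturals (0 out of range), so that matrices
   with provably but not definitionally equal sizes can be compared. *)
Definition ent p q (M : 'M[R]_(p, q)) (r c : nat) : R :=
  if insub r is Some i then if insub c is Some j then M i j else 0 else 0.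

Lemma ent_ord p q (M : 'M[R]_(p, q)) (i : 'I_p) (j : 'I_q) : ent M i j = M i j.
Proof. by rewrite /ent !valK. Qed.

Lemma entM p q s (M : 'M[R]_(p, q)) (M' : 'M[R]_(q, s)) r c :
  ent (M *m M') r c = \sum_(j < q) ent M r j * ent M' j c.
Proof.
rewrite /ent; case: (insub r) => [i|]; last by rewrite big1 // => j _; rewrite mul0r.
case: (insub c) => [k|]; last first.
  by rewrite big1 // => j _; case: (insub _) => *; rewrite mulr0.
by rewrite mxE; apply: eq_bigr => j _; rewrite valK.
Qed.

Lemma ent0 p q r c : ent (0 : 'M[R]_(p, q)) r c = 0.
Proof. by rewrite /ent; case: insub => // i; case: insub => // j; rewrite mxE. Qed.

Lemma entN p q (M : 'M[R]_(p, q)) r c : ent (- M) r c = - ent M r c.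
Proof. by rewrite /ent; case: insub => [i|]; [case: insub => [j|]|]; rewrite ?mxE ?oppr0. Qed.

Lemma entB p q (M M' : 'M[R]_(p, q)) r c : ent (M - M') r c = ent M r c - ent M' r c.
Proof. by rewrite /ent; case: insub => [i|]; [case: insub => [j|]|]; rewrite ?mxE ?subr0. Qed.

End Entries.

(** * A bounded complex of free modules as one matrix *)

Section Total.
Variables (Q : comUnitRingType) (n : nat) (f : 'I_n -> Q) (F : free_dgE f) (b : nat).
Hypothesis Hb : forall i : int, (b < `|i|)%N -> fr_rk F i = 0%N.

(** A basis of the sum of all F_i. Only degrees from - b to b occur, and b is added to make the
    index a natural number. *)
Definition tbase := {i : 'I_(b + b).+1 & 'I_(fr_rk F (i%:Z - b%:Z))}.
HB.instance Definition _ := Finite.on tbase.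

Definition bdeg (y : tbase) : int := (tag y)%:Z - b%:Z.
Definition bpos (y : tbase) : nat := tagged y.

Lemma sum_bdeg (V : nmodType) (i : int) (G : nat -> V) :
  \sum_(y : tbase | bdeg y == i) G (bpos y) = \sum_(c < fr_rk F i) G c.
Proof.
transitivity (\sum_(t < (b + b).+1 | t%:Z - b%:Z == i) \sum_(c < fr_rk F (t%:Z - b%:Z)) G c).
  by rewrite sig_big_dep; apply: eq_bigl => y; rewrite andbT.
have [bi|ib] := ltnP b `|i|%N.
  rewrite big1; last first.
    by move=> t /eqP e; have := ltn_ord t; lia.
  by rewrite Hb // big_ord0.
have lt : (`|(i + b%:Z)%R|%N < (b + b).+1)%N by lia.
rewrite (big_pred1 (Ordinal lt)) /=.
  by have -> : (`|(i + b%:Z)%R|%N%:Z - b%:Z) = i by lia.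
move=> t /=; apply/eqP/eqP => [e|-> /=]; last by lia.
by apply: val_inj => /=; lia.
Qed.

Lemma bpos_lt y : (bpos y < fr_rk F (bdeg y))%N.
Proof. exact: ltn_ord. Qed.

Lemma tbase_exists i (c : 'I_(fr_rk F i)) : exists y : tbase, bdeg y = i /\ bpos y = c.
Proof.
have := sum_bdeg i (fun c' => (c' == c)%N : nat).
rewrite [RHS](bigD1 c) //= eqxx /= => e.
have /negP : \sum_(y : tbase | bdeg y == i) ((bpos y == c) : nat)%N != 0%N by rewrite e.
rewrite sum_nat_eq0 => /negP; rewrite negb_forall => /existsP [y].
by rewrite negb_imply eqb0 negbK => /andP [/eqP h1 /eqP h2]; exists y.
Qed.

Lemma tbase_inj (y y' : tbase) : bdeg y = bdeg y' -> bpos y = bpos y' -> y = y'.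
Proof.
case: y => t c; case: y' => t' c'; rewrite /bdeg /bpos /= => e.
have et : t = t' by apply: val_inj => /=; lia.
by subst t' => e'; congr Tagged; apply: val_inj.
Qed.

Definition td (x y : tbase) : Q :=
  if bdeg x == bdeg y + 1 then ent (fr_d F (bdeg y)) (bpos x) (bpos y) else 0.
Definition te j (x y : tbase) : Q :=
  if bdeg y == bdeg x + 1 then ent (fr_e F j (bdeg x)) (bpos x) (bpos y) else 0.

Definition tdegree (a : 'I_#|{: tbase}|) : int := bdeg (enum_val a).

Lemma td_hom : homg tdegree tdegree (-1) (fmat td).
Proof. by move=> a c e; rewrite mxE /td; case: eqP => // h; case/eqP: e; rewrite /tdegree h addrK. Qed.

Lemma te_hom j : homg tdegree tdegree 1 (fmat (te j)).
Proof. by move=> a c e; rewrite mxE /te; case: eqP => // h; case/eqP: e. Qed.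

Lemma td_sq : fmat td *m fmat td = 0.
Proof.
rewrite fmatM; apply/matrixP => a c; rewrite !mxE.
move: (enum_val a) (enum_val c) => x z.
rewrite (bigID (fun y => bdeg y == bdeg z + 1)) /= [X in _ + X]big1 ?addr0; last first.
  by move=> y /negbTE ne; rewrite /td ne mulr0.
case: (eqVneq (bdeg x) (bdeg z + 1 + 1)) => [ex|ne]; last first.
  by rewrite big1 // => y /eqP ey; rewrite /td ey (negbTE ne) mul0r.
rewrite (eq_bigr (fun y => ent (fr_d F (bdeg z + 1)) (bpos x) (bpos y) *
    ent (fr_d F (bdeg z)) (bpos y) (bpos z))); last first.
  by move=> y /eqP ey; rewrite /td ey ex !eqxx.
rewrite (sum_bdeg _ (fun c => ent (fr_d F (bdeg z + 1)) (bpos x) c * ent (fr_d F (bdeg z)) c (bpos z))).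
by rewrite -entM fr_dd ent0.
Qed.

Definition total_gcx : gcx Q := Gcx td_hom td_sq.

Lemma te_te j l x z : \sum_y te j x y * te l y z =
  if bdeg z == bdeg x + 1 + 1
  then ent (fr_e F j (bdeg x) *m fr_e F l (bdeg x + 1)) (bpos x) (bpos z) else 0.
Proof.
rewrite (bigID (fun y => bdeg y == bdeg x + 1)) /= [X in _ + X]big1 ?addr0; last first.
  by move=> y /negbTE ne; rewrite /te ne mul0r.
case: (eqVneq (bdeg z) (bdeg x + 1 + 1)) => [ex|ne]; last first.
  by rewrite big1 // => y /eqP ey; rewrite /te ey (negbTE ne) mulr0.
rewrite (eq_bigr (fun y => ent (fr_e F j (bdeg x)) (bpos x) (bpos y) *
    ent (fr_e F l (bdeg x + 1)) (bpos y) (bpos z))); last first.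
  by move=> y /eqP ey; rewrite /te ey ex !eqxx.
rewrite (sum_bdeg _ (fun c => ent (fr_e F j (bdeg x)) (bpos x) c * ent (fr_e F l (bdeg x + 1)) c (bpos z))).
by rewrite -entM.
Qed.

Lemma te_sq j : fmat (te j) *m fmat (te j) = 0.
Proof.
rewrite fmatM; apply/matrixP => a c; rewrite !mxE te_te fr_ee ent0.
by case: ifP.
Qed.

Lemma te_C j l : fmat (te l) *m fmat (te j) = - (fmat (te j) *m fmat (te l)).
Proof.
rewrite !fmatM; apply/matrixP => a c; rewrite !mxE !te_te fr_eC entN.
by case: ifP; rewrite ?oppr0.
Qed.

Lemma te_td_entry j x z : bdeg z = bdeg x ->
  \sum_y te j x y * td y z =
  ent (fr_e F j (bdeg x) *m fr_d F (bdeg x)) (bpos x) (bpos z).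
Proof.
move=> ez; rewrite (bigID (fun y => bdeg y == bdeg x + 1)) /= [X in _ + X]big1 ?addr0; last first.
  by move=> y /negbTE ne; rewrite /te ne mul0r.
rewrite (eq_bigr (fun y => ent (fr_e F j (bdeg x)) (bpos x) (bpos y) *
    ent (fr_d F (bdeg x)) (bpos y) (bpos z))); last first.
  by move=> y /eqP ey; rewrite /te /td ey ez !eqxx.
rewrite (sum_bdeg _ (fun c => ent (fr_e F j (bdeg x)) (bpos x) c * ent (fr_d F (bdeg x)) c (bpos z))).
by rewrite -entM.
Qed.

Lemma td_te_entry j i x z : bdeg x = i + 1 -> bdeg z = i + 1 ->
  \sum_y td x y * te j y z = ent (fr_d F i *m fr_e F j i) (bpos x) (bpos z).
Proof.
move=> ex ez; rewrite (bigID (fun y => bdeg y == i)) /= [X in _ + X]big1 ?addr0; last first.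
  move=> y ne; rewrite /td ex; case: eqP => [e|]; last by rewrite mul0r.
  by case/eqP: ne; lia.
rewrite (eq_bigr (fun y => ent (fr_d F i) (bpos x) (bpos y) *
    ent (fr_e F j i) (bpos y) (bpos z))); last first.
  by move=> y /eqP ey; rewrite /te /td ey ez ex !eqxx.
rewrite (sum_bdeg _ (fun c => ent (fr_d F i) (bpos x) c * ent (fr_e F j i) c (bpos z))).
by rewrite -entM.
Qed.

Lemma te_d j : fmat (te j) *m fmat td + fmat td *m fmat (te j) = (f j)%:M.
Proof.
rewrite !fmatM; apply/matrixP => a c; rewrite !mxE -(inj_eq enum_val_inj).
move: (enum_val a) (enum_val c) => x z.
have [e|ne] := eqVneq (bdeg z) (bdeg x); last first.
  rewrite !big1 ?addr0; first by case: eqP => // e; rewrite e eqxx in ne.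
    move=> y _; rewrite /td /te; case: eqP => [e1|]; last by rewrite mul0r.
    by case: eqP => [e2|]; [case/eqP: ne; lia|rewrite mulr0].
  move=> y _; rewrite /td /te; case: eqP => [e1|]; last by rewrite mul0r.
  by case: eqP => [e2|]; [case/eqP: ne; lia|rewrite mulr0].
rewrite te_td_entry // (@td_te_entry _ (bdeg x - 1)) ?e ?subrK //.
have key i' i : i' = i + 1 -> (bpos x < fr_rk F i')%N -> (bpos z < fr_rk F i')%N ->
   ent (fr_e F j i' *m fr_d F i') (bpos x) (bpos z) +
   ent (fr_d F i *m fr_e F j i) (bpos x) (bpos z) = f j *+ (bpos x == bpos z).
  move=> -> hx hz; rewrite fr_de entB subrK.
  by rewrite -[bpos x]/(val (Ordinal hx)) -[bpos z]/(val (Ordinal hz)) ent_ord mxE.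
rewrite (key _ (bdeg x - 1)) ?subrK ?bpos_lt //; last by rewrite -e bpos_lt.
congr (_ *+ nat_of_bool _); apply/eqP/eqP => [ep|->] //.
by apply: tbase_inj.
Qed.

Definition total : gmod f :=
  @Gmod _ _ _ total_gcx (fun j => fmat (te j)) te_hom te_sq te_C te_d.

End Total.

Section TotalResolution.
Variables (Q : comUnitRingType) (n : nat) (f : 'I_n -> Q) (F : free_dgE f) (b : nat).
Hypothesis Hb : forall i : int, (b < `|i|)%N -> fr_rk F i = 0%N.
Local Notation T := (tbase F b).
Local Notation X := (total Hb).
Local Notation N := #|{: T}|.

Definition tcomp i (v : 'rV[Q]_N) : 'rV[Q]_(fr_rk F i) :=
  \row_c \sum_(y : T | (bdeg y == i) && (bpos y == c :> nat)) v 0 (enum_rank y).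
Definition temb i (w : 'rV[Q]_(fr_rk F i)) : 'rV[Q]_N :=
  \row_a (if bdeg (enum_val a : T) == i then ent w 0 (bpos (enum_val a : T)) else 0).

Lemma sum_tbase1 (V : nmodType) (G : T -> V) (y : T) i c : bdeg y = i -> bpos y = c ->
  \sum_(y : T | (bdeg y == i) && (bpos y == c :> nat)) G y = G y.
Proof.
move=> <- <-; rewrite (big_pred1 y) // => y'; apply/andP/eqP => [[/eqP h1 /eqP h2]|-> //].
exact: tbase_inj.
Qed.

Lemma temb_hrow i w : hrow (tdegree (F := F) (b := b)) i (temb (i := i) w).
Proof. by move=> a e; rewrite mxE; case: eqP e => // ->; rewrite eqxx. Qed.

Lemma tembK i w : tcomp i (temb w) = w.
Proof.
apply/rowP => c; have [y [ey ec]] := tbase_exists Hb c.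
rewrite mxE (sum_tbase1 _ ey ec) mxE enum_rankK ey eqxx ec.
by rewrite -[0%N]/(val (0 : 'I_1)) ent_ord.
Qed.

Lemma tcompK i v : hrow (tdegree (F := F) (b := b)) i v -> temb (tcomp i v) = v.
Proof.
move=> hv; apply/rowP => a; rewrite mxE; case: eqP => [e|/eqP /hv -> //].
have lt : (bpos (enum_val a : T) < fr_rk F i)%N by rewrite -e bpos_lt.
rewrite -[bpos _]/(val (Ordinal lt)) -[0%N]/(val (0 : 'I_1)) ent_ord mxE.
by rewrite (@sum_tbase1 _ _ (enum_val a)) // enum_valK.
Qed.

Lemma tembM i (w : 'rV[Q]_(fr_rk F (i + 1))) :
  temb (w *m fr_d F i) = temb w *m gd X.
Proof.
apply/rowP => a; rewrite !mxE; set y := (enum_val a : T).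
under eq_bigr => x _ do rewrite !mxE.
rewrite (sum_enum_val (fun x : T => (if bdeg x == i + 1 then ent w 0 (bpos x) else 0) * td x y)).
rewrite (bigID (fun x : T => bdeg x == i + 1)) /= [X in _ = _ + X]big1 ?addr0; last first.
  by move=> x /negbTE ->; rewrite mul0r.
case: (eqVneq (bdeg y) i) => [ey|ne]; last first.
  rewrite big1 // => x /eqP ex; rewrite /td ex eqxx; case: eqP; rewrite ?mulr0 // => e.
  by case/eqP: ne; lia.
rewrite (eq_bigr (fun x : T => ent w 0 (bpos x) * ent (fr_d F i) (bpos x) (bpos y))); last first.
  by move=> x /eqP ex; rewrite /td ex ey !eqxx.
by rewrite (sum_bdeg Hb (i + 1) (fun c => ent w 0 c * ent (fr_d F i) c (bpos y))) -entM.
Qed.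

Lemma temb_inj i : injective (@temb i).
Proof. by move=> u v e; rewrite -[u]tembK e tembK. Qed.

Lemma temb_lin i a (u v : 'rV[Q]_(fr_rk F i)) : temb (a *: u + v) = a *: temb u + temb v.
Proof.
apply/rowP => c; rewrite !mxE; case: ifP => _; last by rewrite mulr0 addr0.
rewrite /ent; case: insub => [p|]; last by rewrite mulr0 addr0.
by case: insub => [q|]; rewrite ?mxE // mulr0 addr0.
Qed.

Lemma temb0 i : temb (0 : 'rV[Q]_(fr_rk F i)) = 0.
Proof. by apply/rowP => c; rewrite !mxE ent0 if_same. Qed.

Lemma tcomp_cycle i (v : 'rV[Q]_N) : hrow (tdegree (F := F) (b := b)) (i + 1) v ->
  v *m gd X = 0 -> tcomp (i + 1) v *m fr_d F i = 0.
Proof. by move=> hv vd; apply: temb_inj; rewrite tembM tcompK // vd temb0. Qed.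

Lemma total_resolution (I : Q -> Prop) :
  homology_quotient I (dgE_of_free F) -> resolution I X.
Proof.
move=> [aF [z [cz gz Iz]]]; split=> [i' i0 v hv vd|].
  have ei : i' = (i' - 1) + 1 by lia.
  move: (i' - 1) ei => i ei; subst i'.
  have [u eu] := aF i i0 (tcomp (i + 1) v) (tcomp_cycle hv vd).
  exists (temb u); split; first exact: temb_hrow.
  by rewrite -tembM -[RHS](tcompK hv); congr temb.
exists (temb (z : 'rV[Q]_(fr_rk F (-1 + 1)))); split.
- exact: temb_hrow.
- by rewrite -tembM -[RHS](temb0 (-1)); congr temb; exact: cz.
- move=> v hv vd; have [q [u eu]] := gz (tcomp (-1 + 1) v) (tcomp_cycle (i := -1) hv vd).
  exists q, (temb (u : 'rV[Q]_(fr_rk F (-1 + 1 + 1)))); split; first exact: temb_hrow.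
  rewrite -tembM -[v in LHS](tcompK (i := -1 + 1)) // -temb_lin; congr temb.
  have -> : (u : 'rV[Q]_(fr_rk F (-1 + 1 + 1))) *m fr_d F (-1 + 1) = tcomp (-1 + 1) v - q *: z.
    exact: eu.
  by move: (tcomp _ v) (q *: _) => u1 u2; rewrite [u2 + _]addrC subrK.
move=> q; rewrite Iz; split=> [[u eu]|[w [hw ew]]].
  exists (temb (u : 'rV[Q]_(fr_rk F (-1 + 1 + 1)))); split; first exact: temb_hrow.
  rewrite -tembM -[q *: _]addr0 -(temb0 (-1 + 1)) -temb_lin addr0; congr temb; exact: eu.
exists (tcomp (-1 + 1 + 1) w); apply: temb_inj.
rewrite /= tembM tcompK // ew -[q *: temb _]addr0 -(temb0 (-1 + 1)) -temb_lin addr0.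
by [].
Qed.

Variables (k : fieldType) (res : {rmorphism Q -> k}).
Local Notation S := {mpoly k[n]}.
Local Notation rho := (map_mpoly res : {mpoly Q[n]} -> S).
Local Notation D := (map_mx rho (ext_D X)).

Definition tcol (phi : ext_cochain k F) : 'cV[S]_N :=
  \col_a ent (phi (bdeg (enum_val a : T))) (bpos (enum_val a : T)) 0.
Definition tfam (xi : 'cV[S]_N) : ext_cochain k F := fun i =>
  \col_c \sum_(y : T | (bdeg y == i) && (bpos y == c :> nat)) xi (enum_rank y) 0.
(** Absorbs the sign in [ext_diff], so that the differential becomes the plain matrix D. *)
Definition twist (phi : ext_cochain k F) : ext_cochain k F := fun i => (-1) ^+ `|i|%N *: phi i.
Definition unsigned_diff (phi : ext_cochain k F) (i : int) : 'cV[S]_(fr_rk F (i + 1)) :=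
  \sum_(j < n) 'X_j *: (resS n res (fr_e F j (i + 1)) *m phi (i + 1 + 1))
    - resS n res (fr_d F i) *m phi i.

Lemma tfamK xi : tcol (tfam xi) = xi.
Proof.
apply/colP => a; rewrite mxE; set y := (enum_val a : T).
rewrite -[bpos y]/(val (Ordinal (bpos_lt y))) -[0%N]/(val (0 : 'I_1)) ent_ord mxE.
by rewrite (@sum_tbase1 _ _ y) // /y enum_valK.
Qed.

Lemma tcol_eq i (A B : 'cV[S]_(fr_rk F i)) :
  (forall y : T, bdeg y = i -> ent A (bpos y) 0 = ent B (bpos y) 0) -> A = B.
Proof.
move=> h; apply/colP => c; have [y [ey ec]] := tbase_exists Hb c.
by have := h y ey; rewrite ec -[0%N]/(val (0 : 'I_1)) !ent_ord.
Qed.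

Lemma entD (R : pzRingType) p q (M M' : 'M[R]_(p, q)) r c : ent (M + M') r c = ent M r c + ent M' r c.
Proof. by rewrite -[M']opprK entB entN !opprK. Qed.

Lemma entZ p q (M : 'M[S]_(p, q)) a r c : ent (a *: M) r c = a * ent M r c.
Proof. by rewrite /ent; case: insub => [i|]; [case: insub => [j|]|]; rewrite ?mxE ?mulr0. Qed.

Lemma ent_sum p q (G : 'I_n -> 'M[S]_(p, q)) r c :
  ent (\sum_j G j) r c = \sum_j ent (G j) r c.
Proof.
elim/big_rec2: _ => [|j A B _ <-]; first by rewrite ent0.
by rewrite entD.
Qed.

Lemma ent_resS p q (M : 'M[Q]_(p, q)) r c : ent (resS n res M) r c = (res (ent M r c))%:MP_[n].
Proof.
by rewrite /ent; case: insub => [i|]; [case: insub => [j|]|]; rewrite ?mxE ?rmorph0.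
Qed.

Lemma D_entry (x y : T) : D (enum_rank x) (enum_rank y) =
  \sum_j 'X_j * (res (te j x y))%:MP_[n] - (res (td x y))%:MP_[n].
Proof.
rewrite !mxE rmorphB /= summxE rmorph_sum /= map_mpolyC !enum_rankK; congr (_ - _).
apply: eq_bigr => j _; rewrite !mxE !enum_rankK rmorphM /= map_mpolyC.
by rewrite map_mpolyX.
Qed.

Lemma D_tcol phi i (x : T) : bdeg x = i + 1 ->
  (D *m tcol phi) (enum_rank x) 0 = ent (unsigned_diff phi i) (bpos x) 0.
Proof.
move=> ex; rewrite mxE.
transitivity (\sum_(y : T) (\sum_j 'X_j * (res (te j x y))%:MP_[n]
    - (res (td x y))%:MP_[n]) * ent (phi (bdeg y)) (bpos y) 0).
  rewrite -[RHS]sum_enum_val; apply: eq_bigr => a _.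
  by rewrite -D_entry enum_valK [tcol _ _ _]mxE.
under eq_bigr => y _ do rewrite mulrBl.
rewrite big_split /= sumrN /unsigned_diff entB ent_sum; congr (_ - _).
  under eq_bigr => y _ do rewrite mulr_suml.
  rewrite exchange_big; apply: eq_bigr => j _ /=.
  rewrite entZ entM; under eq_bigr => y _ do rewrite -mulrA.
  rewrite -mulr_sumr; congr (_ * _).
  rewrite (bigID (fun y : T => bdeg y == i + 1 + 1)) /= [X in _ + X]big1 ?addr0; last first.
    by move=> y /negbTE ne; rewrite /te ex ne rmorph0 mpolyC0 mul0r.
  rewrite -(sum_bdeg Hb (i + 1 + 1) (fun c => ent (resS n res (fr_e F j (i + 1))) (bpos x) c *
     ent (phi (i + 1 + 1)) c 0)).
  by apply: eq_bigr => y /eqP ey; rewrite /te ex ey eqxx ent_resS.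
rewrite entM (bigID (fun y : T => bdeg y == i)) /= [X in _ + X]big1 ?addr0; last first.
  move=> y ne; rewrite /td ex; case: eqP => [e|]; last by rewrite rmorph0 mpolyC0 mul0r.
  by case/eqP: ne; lia.
rewrite -(sum_bdeg Hb i (fun c => ent (resS n res (fr_d F i)) (bpos x) c * ent (phi i) c 0)).
by apply: eq_bigr => y /eqP ey; rewrite /td ex ey eqxx ent_resS.
Qed.

(** Degrees i and i + 2 have the same parity, so both parts of the differential acquire the same
    sign. In particular the twist preserves cocycles. *)
Lemma unsigned_twist phi i : unsigned_diff (twist phi) i = (-1) ^+ `|i|%N *: unsigned_diff phi i.
Proof.
rewrite /unsigned_diff /twist scalerBr scaler_sumr -!scalemxAr; congr (_ - _).
apply: eq_bigr => j _; rewrite -scalemxAr !scalerA mulrC; congr (_ * _ *: _).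
rewrite -signr_odd -[RHS]signr_odd; congr (_ ^+ nat_of_bool _).
by lia.
Qed.

Lemma twistK phi : twist (twist phi) = phi.
Proof.
apply: functional_extensionality_dep => i; rewrite /twist scalerA -expr2 sqrr_sign.
by rewrite scale1r.
Qed.

Lemma ext_diffP phi psi : ext_diff res phi psi <-> tcol psi = D *m tcol (twist phi).
Proof.
split=> [h|h i].
  apply/colP => a; rewrite -[a]enum_valK; set x := (enum_val a : T).
  have ex : bdeg x = (bdeg x - 1) + 1 by lia.
  rewrite (D_tcol _ ex) unsigned_twist -/(h _) mxE enum_rankK.
  have hh i : bdeg x = i + 1 -> ent (psi (bdeg x)) (bpos x) 0 =
      ent ((-1) ^+ `|i|%N *: unsigned_diff phi i) (bpos x) 0.
    by move=> e; rewrite e h.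
  exact: hh.
have -> : psi (i + 1) = (-1) ^+ `|i|%N *: unsigned_diff phi i; last by [].
apply: tcol_eq => y ey; rewrite -unsigned_twist -D_tcol // -h mxE enum_rankK.
by rewrite ey.
Qed.

Lemma ext_annP s : ext_ann res F s <-> annH D s.
Proof.
have tcolZ (phi : ext_cochain k F) : tcol (fun i => s *: phi i) = s *: tcol phi.
  by apply/colP => a; rewrite !mxE entZ.
have tcol0 : tcol (fun=> 0) = 0 by apply/colP => a; rewrite !mxE ent0.
split=> [h xi Dxi|h phi /ext_diffP].
  have [|psi /ext_diffP e] := h (twist (tfam xi)).
    by apply/ext_diffP; rewrite twistK tfamK Dxi tcol0.
  have [|psi' /ext_diffP e'] := h (tfam xi).
    apply/ext_diffP; rewrite tcol0; symmetry; apply/colP => a.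
    rewrite -[a]enum_valK; set x := (enum_val a : T).
    have ex : bdeg x = (bdeg x - 1) + 1 by lia.
    by rewrite (D_tcol _ ex) unsigned_twist entZ -(D_tcol _ ex) tfamK Dxi !mxE mulr0.
  by exists (tcol (twist psi')); rewrite -e' tcolZ tfamK.
rewrite tcol0 => e.
have [|eta eeta] := h (tcol phi).
  apply/colP => a; rewrite -[a]enum_valK; set x := (enum_val a : T).
  have ex : bdeg x = (bdeg x - 1) + 1 by lia.
  have e2 : (D *m tcol (twist phi)) (enum_rank x) 0 = 0 by rewrite -e mxE.
  move/eqP: e2; rewrite (D_tcol _ ex) unsigned_twist entZ mulf_eq0 signr_eq0 /= => /eqP e3.
  by rewrite (D_tcol _ ex) e3 mxE.
exists (twist (tfam eta)); apply/ext_diffP.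
by rewrite twistK tfamK tcolZ eeta.
Qed.

End TotalResolution.

(** * The support through the Taylor matrix *)

Section SupportOfPresentation.
Variables (k : fieldType) (n : nat) (P : monomial_presentation k n).

Definition mp_D : 'M[{mpoly k[n]}]_#|{set 'I_n}| :=
  map_mx (map_mpoly (mp_res P)) (ext_D (taylor (@mp_x _ _ P) (fun i j => mp_exp P i j))).

Lemma mp_ideal_ideal : ideal (mp_ideal P).
Proof.
split=> [|a b /mp_ideal_mid ha /mp_ideal_mid hb|r a /mp_ideal_mid ha]; apply/mp_ideal_mid.
- exact: mid0.
- exact: midD.
- exact: midM.
Qed.

Lemma mp_ideal_res q : mp_ideal P q -> mp_res P q = 0.
Proof.
move/mp_ideal_res2 => [r [u [v [hu _ ->]]]]; rewrite rmorph_sum big1 // => i _.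
by rewrite rmorphM hu mul0r.
Qed.

Lemma mp_resolves : resolves (mp_ideal P) (gfree (taylor (@mp_x _ _ P) (fun i j => mp_exp P i j))).
Proof.
apply: gfree_resolves.
- by move=> a; apply: lez_nat.
- exact: mp_ideal_ideal.
- by move/mp_ideal_res/eqP; rewrite rmorph1 oner_eq0.
- move=> j; apply/mp_ideal_mid; rewrite -[mono _ _]mul1r; apply: mid_gen.
  by rewrite has_map; apply/hasP; exists j; [rewrite mem_enum | exact: lem_refl].
- exact: mp_taylor_resolution.
Qed.

Lemma ext_ann_mp (F : free_dgE (mp_f P)) : resolves (mp_ideal P) F ->
  forall s, ext_ann (mp_res P) F s <-> annH mp_D s.
Proof.
move=> rF s; have [b Hb] := fr_bounded F.
have rT := total_resolution Hb (resolves_homology rF).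
have rX := @mp_taylor_resolution _ _ P.
rewrite (ext_annP Hb); split.
  exact: (@annH_resolution _ _ _ (mp_f P) _ (map_mpoly (mp_res P)) _ _ rX rT s).
exact: (@annH_resolution _ _ _ (mp_f P) _ (map_mpoly (mp_res P)) _ _ rT rX s).
Qed.

Lemma is_cohomological_supportP (Z : affine k n -> Prop) :
  (forall p : affine k n, (forall s, annH mp_D s -> p s) <-> Z p) <->
  is_cohomological_support P Z.
Proof.
have key (F : free_dgE (mp_f P)) : resolves (mp_ideal P) F -> forall p : affine k n,
    ext_support (mp_res P) F p <-> (forall s, annH mp_D s -> p s).
  by move=> rF p; split=> h s hs; apply: h; have [h1 h2] := ext_ann_mp rF s; auto.
split=> [h|[_ h] p].
  split=> [|F rF p]; first by exists (gfree (taylor (@mp_x _ _ P) (fun i j => mp_exp P i j))); apply: mp_resolves.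
  by rewrite (key _ rF).
by rewrite -(key _ mp_resolves); apply: h; apply: mp_resolves.
Qed.

End SupportOfPresentation.

(** * Annihilators and minors *)

Section MinorsAnnihilate.
Variables (S : idomainType) (N r : nat) (D : 'M[S]_N).
Hypotheses (eN : N = (r + r)%N) (DD : D *m D = 0).

(** A nonzero minor mu on rows f and columns g forces rank r over the fraction field, where the
    columns g then span ker D. A cycle times mu can be changed by these columns until it vanishes on
    the rows f; being a combination of the columns g, it is then 0. *)
Lemma minor_annH (f g : 'I_r -> 'I_N) : annH D (\det (mxsub f g D)).
Proof.
set B := mxsub f g D; set mu := \det B.
have [m0|m0] := eqVneq mu 0.
  by move=> xi _; exists 0; rewrite m0 scale0r mulmx0.
move=> phi Dphi.
(* Cramer's rule: mu phi and Dg y agree on the rows f. *)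
pose y := \adj B *m rowsub f phi.
pose Dg := colsub g D.
have DgE : Dg = D *m colsub g 1%:M.
  by apply/matrixP => i j; rewrite !mxE (bigD1 (g j)) //= !mxE eqxx mulr1 big1 ?addr0 // => l /negbTE lj; rewrite !mxE lj mulr0.
pose phi' := mu *: phi - Dg *m y.
suff p0 : phi' = 0.
  exists (colsub g 1%:M *m y); rewrite mulmxA -DgE.
  by apply/eqP; rewrite -subr_eq0 -/phi' p0.
have Dphi' : D *m phi' = 0.
  by rewrite mulmxBr -scalemxAr Dphi scaler0 DgE !mulmxA DD !mul0mx subr0.
have fDg : rowsub f Dg = B by apply/matrixP => i j; rewrite !mxE.
have rowsubM p q (Z : 'M[S]_(N, p)) (W : 'M[S]_(p, q)) : rowsub f (Z *m W) = rowsub f Z *m W.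
  by apply/matrixP => i j; rewrite !mxE; apply: eq_bigr => l _; rewrite !mxE.
have fphi' : rowsub f phi' = 0.
  rewrite /phi' linearB linearZ /= rowsubM fDg /y mulmxA mul_mx_adj mul_scalar_mx subrr //.
pose h := map_mx (@tofrac S).
have hB : h _ _ B \in unitmx by rewrite unitmxE /h det_map_mx unitfE tofrac_eq0.
have hDD : (h _ _ D)^T *m (h _ _ D)^T = 0 by rewrite -trmx_mul -map_mxM DD map_mx0 trmx0.
have rkDg : (r <= \rank (h _ _ Dg)^T)%N.
  rewrite mxrank_tr -{1}(mxrank_unit hB) -fDg.
  have -> : h _ _ (rowsub f Dg) = rowsub f 1%:M *m h _ _ Dg.
    apply/matrixP => i j; rewrite !mxE (bigD1 (f i)) //= !mxE eqxx mul1r big1 ?addr0 // => l /negbTE lj.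
    by rewrite !mxE eq_sym lj mul0r.
  exact: mxrankM_maxr.
have sub : ((h _ _ Dg)^T <= (h _ _ D)^T)%MS.
  by rewrite DgE /h map_mxM trmx_mul submxMl.
have subk : ((h _ _ Dg)^T <= kermx (h _ _ D)^T)%MS.
  by rewrite sub_kermx DgE /h map_mxM trmx_mul -mulmxA hDD mulmx0.
have rkD : (r <= \rank (h _ _ D)^T)%N by apply: leq_trans rkDg (mxrankS sub).
have le_k : (kermx (h _ _ D)^T <= (h _ _ Dg)^T)%MS.
  rewrite -(geq_leqif (mxrank_leqif_sup subk)) mxrank_ker.
  apply: leq_trans rkDg; rewrite [X in (X - _)%N]eN; lia.
have : ((h _ _ phi')^T <= kermx (h _ _ D)^T)%MS.
  by rewrite sub_kermx -trmx_mul -map_mxM Dphi' map_mx0 trmx0.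
move=> /submx_trans /(_ le_k) /submxP [z ez].
have z0 : z = 0.
  have : h _ _ B *m z^T = 0.
    rewrite -fDg.
    have -> : h _ _ (rowsub f Dg) = rowsub f (h _ _ Dg) by apply/matrixP => i j; rewrite !mxE.
    have -> : rowsub f (h _ _ Dg) *m z^T = rowsub f (h _ _ Dg *m z^T).
      by apply/matrixP => i j; rewrite !mxE; apply: eq_bigr => l _; rewrite !mxE.
    have -> : h _ _ Dg *m z^T = h _ _ phi' by rewrite -[RHS]trmxK ez trmx_mul trmxK.
    have -> : rowsub f (h _ _ phi') = h _ _ (rowsub f phi') by apply/matrixP => i j; rewrite !mxE.
    by rewrite fphi' /h map_mx0.
  move/(congr1 (mulmx (invmx (h _ _ B)))); rewrite mulKmx // mulmx0 => /(congr1 trmx).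
  by rewrite trmxK trmx0.
have : h _ _ phi' = 0 by rewrite -[LHS]trmxK ez z0 mul0mx trmx0.
move=> e; apply/matrixP => i j; have /matrixP/(_ i j) := e.
by rewrite !mxE => /eqP; rewrite tofrac_eq0 => /eqP.
Qed.

End MinorsAnnihilate.

(** Over a field a nonzero annihilator means that the homology is 0; then the rank is exactly r, and
    a maximal nonsingular submatrix has size r. *)
Lemma exact_minor (K : fieldType) (N r : nat) (M : 'M[K]_N) (c : K) :
  N = (r + r)%N -> M *m M = 0 -> c != 0 -> annH M c ->
  exists f g : 'I_r -> 'I_N, \det (mxsub f g M) != 0.
Proof.
move=> eN MM c0 aM.
have MtMt : M^T *m M^T = 0 by rewrite -trmx_mul MM trmx0.
have le_k : (kermx M^T <= M^T)%MS.
  apply/row_subP => i.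
  have : M *m (row i (kermx M^T))^T = 0.
    have -> : M *m (row i (kermx M^T))^T = (row i (kermx M^T) *m M^T)^T.
      by rewrite trmx_mul trmxK.
    by rewrite -row_mul mulmx_ker row0 trmx0.
  move=> /aM [eta e].
  have -> : row i (kermx M^T) = (c^-1 *: eta^T) *m M^T.
    rewrite -scalemxAl -trmx_mul -e linearZ /= trmxK scalerA mulVf // scale1r.
    by [].
  exact: submxMl.
have rk : \rank M = r.
  have h1 := mulmx0_rank_max MM; have h2 := mxrankS le_k.
  by rewrite mxrank_ker mxrank_tr in h2; lia.
move: rk => <-; clear eN.
pose A := rowsub (maxrankfun M) M.
have fA : row_full A^T.
  by rewrite /row_full mxrank_tr; have := maxrowsub_free M; rewrite /row_free.
exists (maxrankfun M), (fullrankfun fA).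
have -> : mxsub (maxrankfun M) (fullrankfun fA) M = (rowsub (fullrankfun fA) A^T)^T.
  by apply/matrixP => i j; rewrite !mxE.
rewrite det_tr -unitfE -unitmxE -row_full_unit; exact: fullrowsub_full.
Qed.

(** * Specialization to the residue field of a prime *)

Section MpolyInduction.

Lemma mpoly_ring_ind (R : comNzRingType) n (P : {mpoly R[n]} -> Prop) :
  (forall c, P c%:MP) -> (forall i, P 'X_i) ->
  (forall p q, P p -> P q -> P (p + q)) -> (forall p q, P p -> P q -> P (p * q)) ->
  forall p, P p.
Proof.
move=> PC PX PD PM p; rewrite (mpolyE p).
elim: (msupp p) => [|m s IH]; first by rewrite big_nil -mpolyC0; apply: PC.
rewrite big_cons; apply: (PD) => //; rewrite -mul_mpolyC; apply: (PM) => //.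
rewrite mpolyXE_id; elim: (index_enum _) => [|i t IHt].
  by rewrite big_nil -mpolyC1.
rewrite big_cons; apply: (PM) => //.
by elim: (m i) => [|e IHe]; rewrite ?expr0 -?mpolyC1 // exprS; apply: (PM).
Qed.

Lemma mpoly_morph_ext (R T : comNzRingType) n (u v : {rmorphism {mpoly R[n]} -> T}) :
  (forall c, u c%:MP = v c%:MP) -> (forall i, u 'X_i = v 'X_i) -> u =1 v.
Proof.
move=> hC hX; apply: mpoly_ring_ind => // p q hp hq.
  by rewrite !rmorphD hp hq.
by rewrite !rmorphM hp hq.
Qed.

End MpolyInduction.

Section FieldExtension.
Variables (k K : fieldType) (h : {rmorphism k -> K}) (n N : nat).
Local Notation iota := (map_mpoly h : {mpoly k[n]} -> {mpoly K[n]}).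
Variables (D : 'M[{mpoly k[n]}]_N) (s : {mpoly k[n]}).

(** Flatness of K over k, by elimination. If D Phi_t0 is nonzero, one of its coefficients yields a
    relation over k among the b_t that involves b_t0, and the term t0 can be removed. Once all Phi_t
    are cycles, s acts on each of them. *)
Lemma annH_extend_sum (T : finType) (b : T -> K) (Phi : T -> 'cV[{mpoly k[n]}]_N) :
  annH D s -> map_mx iota D *m (\sum_t (b t)%:MP *: map_mx iota (Phi t)) = 0 ->
  exists eta, iota s *: (\sum_t (b t)%:MP *: map_mx iota (Phi t)) = map_mx iota D *m eta.
Proof.
move=> aD; have [m lem_] := ubnP #|[pred t | Phi t != 0]|.
elim: m Phi lem_ => [|m IH] Phi // le_m hD.
have Dsum : map_mx iota D *m (\sum_t (b t)%:MP *: map_mx iota (Phi t)) =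
    \sum_t (b t)%:MP *: map_mx iota (D *m Phi t).
  by rewrite mulmx_sumr; apply: eq_bigr => t _; rewrite -scalemxAr map_mxM.
have [t0 ht0|h0] := pickP [pred t | D *m Phi t != 0]; last first.
  have /choice [eta heta] : forall t, exists eta, s *: Phi t = D *m eta.
    by move=> t; apply: aD; apply/eqP; move: (h0 t) => /= /negbFE.
  exists (\sum_t (b t)%:MP *: map_mx iota (eta t)).
  rewrite scaler_sumr mulmx_sumr; apply: eq_bigr => t _.
  by rewrite -scalemxAr -map_mxM -heta map_mxZ !scalerA mulrC.
have [x [mn hmn]] : exists x mn, ((D *m Phi t0) x 0)@_mn != 0.
  have /matrix0Pn [x [y hxy]] := ht0; exists x, (mlead ((D *m Phi t0) x 0)).
  by rewrite ord1 in hxy; rewrite mleadc_eq0.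
pose l t : k := ((D *m Phi t) x 0)@_mn.
have bl : \sum_t b t * h (l t) = 0.
  move: hD; rewrite Dsum => /matrixP/(_ x 0); rewrite summxE mxE => /(congr1 (mcoeff mn)).
  rewrite mcoeff0 raddf_sum /= => e; rewrite -[RHS]e; apply: eq_bigr => t _.
  by rewrite [in RHS]mxE mcoeffCM [map_mx _ _ _ _]mxE mcoeff_map_mpoly.
pose Psi t := Phi t - (l t / l t0)%:MP *: Phi t0.
have esum : \sum_t (b t)%:MP *: map_mx iota (Psi t) = \sum_t (b t)%:MP *: map_mx iota (Phi t).
  rewrite /Psi; under eq_bigr => t _ do rewrite map_mxB map_mxZ scalerBr scalerA /= map_mpolyC -mpolyCM.
  rewrite big_split /= sumrN -scaler_suml -[in X in _ - X]raddf_sum /=.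
  rewrite (eq_bigr (fun t => (b t * h (l t)) * h (l t0)^-1)); last first.
    by move=> t _; rewrite rmorphM mulrA.
  by rewrite -mulr_suml bl mul0r mpolyC0 scale0r subr0.
rewrite -esum in hD *; apply: IH => //.
rewrite -ltnS; apply: leq_trans le_m; rewrite ltnS.
apply: proper_card; apply/properP; split.
  apply/subsetP => t; rewrite !inE; apply: contraNneq => e.
  by rewrite /Psi /l e mulmx0 mxE mcoeff0 mul0r mpolyC0 scale0r subr0.
exists t0; rewrite !inE.
  by apply: contraNneq ht0 => ->; rewrite mulmx0.
by rewrite /Psi mulfV // mpolyC1 scale1r subrr eqxx.
Qed.

Lemma annH_extend : annH D s -> annH (map_mx iota D) (iota s).
Proof.
move=> aD phi Dphi.
pose ms := undup (flatten [seq msupp (phi y 0) | y <- enum 'I_N]).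
pose T := ('I_N * 'I_(size ms))%type.
pose mn (t : T) := nth 0%MM ms t.2.
have e : phi = \sum_(t : T) ((phi t.1 0)@_(mn t))%:MP *:
    map_mx iota ('X_[mn t] *: delta_mx t.1 0).
  apply/colP => y; rewrite summxE.
  rewrite -(pair_bigA _ (fun (x : 'I_N) (i : 'I_(size ms)) => (((phi x 0)@_(nth 0%MM ms i))%:MP *:
    map_mx iota ('X_[nth 0%MM ms i] *: delta_mx x 0)) y 0)) /=.
  rewrite (bigD1 y) //= [X in _ + X]big1 ?addr0; last first.
    move=> x /negbTE xy; rewrite big1 // => i _.
    by rewrite !mxE eq_sym xy mulr0 rmorph0 mulr0.
  under eq_bigr => i _ do rewrite !mxE !eqxx mulr1 map_mpolyX.
  rewrite -(big_mkord xpredT (fun i => ((phi y 0)@_(nth 0%MM ms i))%:MP * 'X_[nth 0%MM ms i])).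
  rewrite -(big_nth 0%MM xpredT (fun m => ((phi y 0)@_m)%:MP * 'X_[m])).
  rewrite {1}(mpolyE (phi y 0)).
  have sub : {subset msupp (phi y 0) <= ms}.
    by move=> m hm; rewrite mem_undup; apply/flatten_mapP; exists y; rewrite ?mem_enum.
  rewrite [RHS](bigID (fun m => m \in msupp (phi y 0))) /= [X in _ + X]big1 ?addr0; last first.
    by move=> m /memN_msupp_eq0 ->; rewrite mpolyC0 mul0r.
  rewrite -[RHS]big_filter; under [RHS]eq_bigr => m _ do rewrite mul_mpolyC.
  apply: perm_big; apply: uniq_perm; rewrite ?msupp_uniq ?filter_uniq ?undup_uniq //.
  by move=> m; rewrite mem_filter; apply/idP/andP => [hm|[]] //; split=> //; apply: sub.
by rewrite e in Dphi *; apply: annH_extend_sum.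
Qed.

End FieldExtension.

Section Evaluation.
Variables (K : fieldType) (n N : nat) (a : 'I_n -> K).
Local Notation R := {mpoly K[n]}.
Variables (D : 'M[R]_N) (s : R).
Hypotheses (DD : D *m D = 0) (aD : annH D s).

(** Substitution for the first r variables within one fixed ring, so that the stages can be compared
    without changing the number of variables. *)
Definition partial_eval (r : nat) : R -> R :=
  comp_mpoly [tuple (if (l < r)%N then (a l)%:MP else 'X_l) | l < n].
HB.instance Definition _ r := GRing.RMorphism.on (partial_eval r).

Lemma partial_evalC r c : partial_eval r c%:MP = c%:MP.
Proof. exact: comp_mpolyC. Qed.

Lemma partial_evalX r l : partial_eval r 'X_l = if (l < r)%N then (a l)%:MP else 'X_l.
Proof. by rewrite /partial_eval comp_mpolyXU -tnth_nth tnth_mktuple. Qed.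

Lemma partial_eval_comp r r' p :
  partial_eval r (partial_eval r' p) = partial_eval (maxn r r') p.
Proof.
apply: (@mpoly_morph_ext _ _ _ (partial_eval r \o partial_eval r') (partial_eval (maxn r r'))) => [c|l] /=.
  by rewrite !partial_evalC.
rewrite !partial_evalX leq_max; case: ifP => lr'; rewrite ?orbT ?partial_evalC //.
by rewrite partial_evalX orbF.
Qed.

Lemma partial_eval0 p : partial_eval 0 p = p.
Proof.
apply: (@mpoly_morph_ext _ _ _ (partial_eval 0) idfun) => [c|l] /=.
  by rewrite partial_evalC.
by rewrite partial_evalX.
Qed.

Lemma partial_eval_all p : partial_eval n p = (p.@[a])%:MP.
Proof.
apply: (@mpoly_morph_ext _ _ _ (partial_eval n) (@mpolyC n K \o meval a)) => [c|l] /=.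
  by rewrite partial_evalC mevalC.
by rewrite partial_evalX ltn_ord mevalXU.
Qed.

Lemma partial_eval_diff (r : 'I_n) p :
  exists q, partial_eval r p - partial_eval r.+1 p = ('X_r - (a r)%:MP) * q.
Proof.
move: p; apply: mpoly_ring_ind => [c|l|p q [p' ep] [q' eq]|p q [p' ep] [q' eq]].
- by exists 0; rewrite !partial_evalC subrr mulr0.
- rewrite !partial_evalX ltnS.
  case: (ltngtP l r) => [lr|lr|e] /=; try by exists 0; rewrite subrr mulr0.
  have -> : l = r by apply: val_inj; rewrite /= e.
  by exists 1; rewrite mulr1.
- by exists (p' + q'); rewrite !rmorphD mulrDr -ep -eq opprD addrACA.
exists (partial_eval r p * q' + p' * partial_eval r.+1 q).
rewrite !rmorphM mulrDr mulrCA -eq mulrA -ep mulrBr mulrBl.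
by rewrite addrA subrK.
Qed.

Lemma X_sub_C_neq0 (r : 'I_n) : 'X_r - (a r)%:MP != 0 :> R.
Proof.
apply/eqP => /(congr1 (mcoeff U_(r))).
rewrite mcoeffB mcoeffXU eqxx mcoeffC mcoeff0.
have -> : (U_(r) == 0 :> 'X_{1..n})%MM = false.
  by apply/negP => /eqP /(congr1 (fun m : 'X_{1..n} => m r)); rewrite mnmE mnm0E eqxx.
by rewrite mulr0 subr0 => /eqP; rewrite oner_eq0.
Qed.

(* Killing one more variable squares the annihilating element: if D is
   exact up to s then D modulo the nonzerodivisor X_r - a_r is exact up to s^2. *)
Lemma annH_partial_eval (r : nat) : (r <= n)%N -> forall phi : 'cV[R]_N,
  map_mx (partial_eval r) phi = phi -> map_mx (partial_eval r) D *m phi = 0 ->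
  exists theta, map_mx (partial_eval r) theta = theta /\
    partial_eval r s ^+ (2 ^ r) *: phi = map_mx (partial_eval r) D *m theta.
Proof.
elim: r => [|r IH] rn phi fphi Dphi.
  have m0 p q (Z : 'M[R]_(p, q)) : map_mx (partial_eval 0) Z = Z.
    by apply/matrixP => i j; rewrite mxE partial_eval0.
  rewrite m0 in Dphi; have [eta e] := aD Dphi.
  by exists eta; rewrite !m0 partial_eval0 expr1.
have {}IH := IH (ltnW rn).
pose ro := Ordinal rn; pose x : R := 'X_ro - (a ro)%:MP.
have mcomp r1 r2 p q (Z : 'M[R]_(p, q)) :
    map_mx (partial_eval r1) (map_mx (partial_eval r2) Z) = map_mx (partial_eval (maxn r1 r2)) Z.
  by apply/matrixP => i j; rewrite !mxE partial_eval_comp.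
have max1 : maxn r r.+1 = r.+1 by lia.
have max2 : maxn r.+1 r = r.+1 by lia.
have fphi' : map_mx (partial_eval r) phi = phi.
  by rewrite -fphi mcomp max1.
have /choice [E0 hE0] : forall ij : 'I_N * 'I_N, exists q,
    partial_eval r (D ij.1 ij.2) - partial_eval r.+1 (D ij.1 ij.2) = x * q.
  by move=> ij; apply: (partial_eval_diff ro).
pose Dr := map_mx (partial_eval r) D; pose Dr1 := map_mx (partial_eval r.+1) D.
pose E : 'M[R]_N := map_mx (partial_eval r) (\matrix_(i, j) E0 (i, j)).
have xr : partial_eval r x = x.
  by rewrite rmorphB /= partial_evalX partial_evalC /= ltnn.
have xr1 : partial_eval r.+1 x = 0.
  by rewrite rmorphB /= partial_evalX partial_evalC /= ltnSn subrr.
have EE : Dr - Dr1 = x *: E.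
  apply/matrixP => i j; rewrite !mxE -xr -rmorphM -(hE0 (i, j)) rmorphB /= !partial_eval_comp.
  by rewrite maxnn max1.
pose psi := E *m phi.
have fpsi : map_mx (partial_eval r) psi = psi.
  by rewrite map_mxM fphi' mcomp maxnn.
have Drphi : Dr *m phi = x *: psi.
  by rewrite -[Dr](subrK Dr1) mulmxDl Dphi addr0 EE -scalemxAl.
have scalex_inj (Z : 'cV[R]_N) : x *: Z = 0 -> Z = 0.
  move=> e; apply/colP => i; have /colP/(_ i) := e; rewrite !mxE => /eqP.
  by rewrite mulf_eq0 (negbTE (X_sub_C_neq0 ro)) => /eqP.
have DrDr : Dr *m Dr = 0 by rewrite -map_mxM DD map_mx0.
have Drpsi : Dr *m psi = 0.
  by apply: scalex_inj; rewrite scalemxAr -Drphi mulmxA DrDr mul0mx.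
have [theta [ftheta etheta]] := IH psi fpsi Drpsi.
set s' := partial_eval r s ^+ (2 ^ r) in etheta.
have fs' : partial_eval r s' = s' by rewrite rmorphXn /= partial_eval_comp maxnn.
(* The cycle psi is the obstruction to phi being a cycle at stage r. As s' psi = Dr theta, [phi2] is
   a cycle at that stage, and it becomes a multiple of phi when x is set to 0. *)
pose phi2 := s' *: phi - x *: theta.
have fphi2 : map_mx (partial_eval r) phi2 = phi2.
  by rewrite map_mxB !map_mxZ /= fs' xr fphi' ftheta.
have Dphi2 : Dr *m phi2 = 0.
  by rewrite mulmxBr -!scalemxAr Drphi -etheta !scalerA mulrC subrr.
have [eta [feta eeta]] := IH phi2 fphi2 Dphi2.
exists (map_mx (partial_eval r.+1) eta); split.
  by rewrite mcomp maxnn.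
have := congr1 (map_mx (partial_eval r.+1)) eeta.
have s'1 : partial_eval r.+1 s' = partial_eval r.+1 s ^+ (2 ^ r).
  by rewrite rmorphXn /= partial_eval_comp max2.
rewrite map_mxM mcomp map_mxZ map_mxB !map_mxZ /= s'1 xr1 scale0r subr0 fphi scalerA -exprD.
by rewrite addnn -mul2n -expnS max2 => ->.
Qed.

Lemma annH_eval : annH (map_mx (meval a) D) (s.@[a] ^+ (2 ^ n)).
Proof.
move=> phi Dphi.
have mall p q (Z : 'M[R]_(p, q)) :
    map_mx (partial_eval n) Z = map_mx (@mpolyC n K) (map_mx (meval a) Z).
  by apply/matrixP => i j; rewrite !mxE partial_eval_all.
have mC (Z : 'cV[K]_N) : map_mx (meval a) (map_mx (@mpolyC n K) Z) = Z.
  by apply/matrixP => i j; rewrite !mxE mevalC.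
have [||theta [_ e]] := annH_partial_eval (leqnn n) (phi := map_mx (@mpolyC n K) phi).
- by rewrite mall mC.
- by rewrite mall -map_mxM Dphi map_mx0.
exists (map_mx (meval a) theta).
have := congr1 (map_mx (meval a)) e.
rewrite mall map_mxM map_mxZ mC partial_eval_all -rmorphXn /= => {}e.
rewrite mevalC in e; rewrite e; congr (_ *m _).
by apply/matrixP => i j; rewrite !mxE mevalC.
Qed.

End Evaluation.

(** If an annihilator s avoids p, scalars are extended to the residue field K of p, where p consists
    of the polynomials vanishing at a K-rational point a. Evaluation at a leaves a nonzero power of
    the value of s as annihilator, and exactness gives a minor outside p. *)
Lemma annH_minors (k : fieldType) (n N r : nat) (D : 'M[{mpoly k[n]}]_N) (p : affine k n) :
  N = (r + r)%N -> D *m D = 0 ->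
  (forall s, annH D s -> p s) <-> (forall f g : 'I_r -> 'I_N, p (\det (mxsub f g D))).
Proof.
move=> eN DD; split=> [h f g|h s aD]; first by apply: h; apply: minor_annH.
have [K [ev evP]] := residue_field_exists p.
apply/evP; apply/eqP; apply: contraT => s0.
pose h0 : {rmorphism k -> K} := (ev \o @mpolyC n k).
pose iota : {rmorphism {mpoly k[n]} -> {mpoly K[n]}} := map_mpoly h0.
pose a i := ev 'X_i.
have evE q : meval a (iota q) = ev q.
  apply: (@mpoly_morph_ext _ _ _ (meval a \o iota) ev) => [c|i] /=.
    by rewrite map_mpolyC mevalC.
  by rewrite map_mpolyX mevalXU.
have DD' : map_mx iota D *m map_mx iota D = 0 by rewrite -map_mxM DD map_mx0.
have := @annH_eval _ _ _ a _ _ DD' (@annH_extend _ _ h0 _ _ _ _ aD); rewrite evE.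
have -> : map_mx (meval a) (map_mx iota D) = map_mx ev D.
  by apply/matrixP => i j; rewrite !mxE evE.
move=> aev.
have [||f [g]] := exact_minor eN _ _ aev.
- by rewrite -map_mxM DD map_mx0.
- by rewrite expf_neq0.
have -> : mxsub f g (map_mx ev D) = map_mx ev (mxsub f g D).
  by apply/matrixP => i j; rewrite !mxE.
by rewrite det_map_mx; have /evP -> := h f g; rewrite eqxx.
Qed.

(** * Finiteness *)

Section CombinatorialType.
Variable n : nat.
Implicit Types (A B : {set 'I_n}).

(* At (A, i): is f_i coprime to lcm_A, and does f_i divide lcm_A. *)
Definition ctype := {ffun {set 'I_n} * 'I_n -> bool * bool}.

Definition ctype_of d (E : 'I_n -> 'I_d -> nat) : ctype :=
  [ffun Ai => ([forall t, minn (E Ai.2 t) (lcme E Ai.1 t) == 0],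
               [forall t, E Ai.2 t <= lcme E Ai.1 t])%N].

(** The coefficient ring is arbitrary so that the minors over the integers give the equations over
    all fields at once. *)
Definition type_entry (R : comNzRingType) (tau : ctype) A B : {mpoly R[n]} :=
  \sum_j 'X_j * (if [&& j \notin A, B == j |: A & (tau (A, j)).1] then ksign R j A else 0)%:MP
  - (\sum_(i in A | B == A :\ i) if (tau (B, i)).2 then ksign R i A else 0)%:MP.

Definition type_mx (R : comNzRingType) (tau : ctype) : 'M[{mpoly R[n]}]_#|{set 'I_n}| :=
  fmat (type_entry R tau).

Lemma rmorph_ksign (R T : pzRingType) (h : {rmorphism R -> T}) (i : 'I_n) A :
  h (ksign R i A) = ksign T i A.
Proof. exact: rmorph_sign. Qed.

Lemma type_mx_map (R T : comNzRingType) (h : {rmorphism R -> T}) tau :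
  map_mx (map_mpoly h) (type_mx R tau) = type_mx T tau.
Proof.
apply/matrixP => a b; rewrite !mxE /type_entry rmorphB rmorph_sum /= map_mpolyC; congr (_ - _).
  apply: eq_bigr => j _; rewrite rmorphM /= map_mpolyX map_mpolyC; congr (_ * _%:MP).
  by case: [&& _, _ & _]; [exact: rmorph_ksign | exact: rmorph0].
congr (_%:MP); rewrite raddf_sum /=; apply: eq_bigr => i _.
by case: (tau _).2; [exact: rmorph_ksign | exact: rmorph0].
Qed.

Lemma taylor_type (k : fieldType) (Q : comUnitRingType) d (x : 'I_d -> Q)
    (E : 'I_n -> 'I_d -> nat) (res : {rmorphism Q -> k}) :
  (forall j, res (x j) = 0) ->
  map_mx (map_mpoly res) (ext_D (taylor x E)) = type_mx k (ctype_of E).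
Proof.
move=> x0; apply/matrixP => a b; rewrite !mxE rmorphB /= summxE rmorph_sum /= map_mpolyC.
rewrite /type_entry; congr (_ - _%:MP).
  apply: eq_bigr => j _; rewrite !mxE rmorphM /= map_mpolyX map_mpolyC; congr (_ * _%:MP).
  rewrite /tay_e ffunE /=; set A := enum_val a; set B := enum_val b.
  case: (j \notin A); rewrite /= ?rmorph0 //; case: (B =P j |: A) => [->|_]; rewrite /= ?rmorph0 //.
  rewrite rmorphM rmorph_ksign (res_mono x0) /wt sum_nat_eq0.
  rewrite (_ : [forall i, _] = [forall t, minn (E j t) (lcme E A t) == 0%N]); last first.
    by apply: eq_forallb => t; rewrite lcmeU1; lia.
  by case: [forall t, _]; rewrite ?mulr1 ?mulr0.
rewrite /tay_d raddf_sum /=; apply: eq_bigr => i /andP [iA /eqP ->].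
rewrite -[LHS]/(res (_ * _)) rmorphM rmorph_ksign (res_mono x0) ffunE /= /wt sum_nat_eq0.
rewrite (_ : [forall i0, _] = [forall t, (E i t <= lcme E (enum_val a :\ i) t)%N]); last first.
  apply: eq_forallb => t; have := lcmeU1 E i (enum_val a :\ i) t; rewrite setD1K //.
  by move: (lcme _ _ t) (lcme _ _ t) => u v; lia.
by case: [forall t, _]; rewrite ?mulr1 ?mulr0.
Qed.

Local Notation N := #|{set 'I_n}|.
Local Notation r := (2 ^ n.-1)%N.

Definition type_minors (tau : ctype) : seq {mpoly int[n]} :=
  map (fun fg : {ffun 'I_r -> 'I_N} * {ffun 'I_r -> 'I_N} =>
         \det (mxsub fg.1 fg.2 (type_mx int tau)))
      (enum [set: {ffun 'I_r -> 'I_N} * {ffun 'I_r -> 'I_N}]).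

Lemma type_minorsP (k : fieldType) tau (p : affine k n) :
  zero_locus (type_minors tau) p <->
  forall f g : 'I_r -> 'I_N, p (\det (mxsub f g (type_mx k tau))).
Proof.
have e (f g : 'I_r -> 'I_N) : \det (mxsub f g (type_mx k tau)) =
    map_mpoly (intr : {rmorphism int -> k}) (\det (mxsub f g (type_mx int tau))).
  rewrite -det_map_mx; congr (\det _).
  by rewrite -(type_mx_map (intr : {rmorphism int -> k})); apply/matrixP => i j; rewrite !mxE.
split=> [h f g|h q /mapP [[f g] _ ->]]; last by rewrite -e.
rewrite e; apply: h; apply/mapP; exists ([ffun i => f i], [ffun i => g i]).
  by rewrite mem_enum inE.
by congr (\det _); apply/matrixP => i j; rewrite !mxE /= !ffunE.
Qed.

Lemma card_half : (0 < n)%N -> N = (r + r)%N.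
Proof. by case: n => // m _; rewrite -cardsT -powersetT card_powerset cardsT card_ord expnS mul2n addnn. Qed.

Lemma mp_D_type (k : fieldType) (P : monomial_presentation k n) :
  mp_D P = type_mx k (ctype_of (fun i j => mp_exp P i j)).
Proof. exact: taylor_type (@mp_x_max _ _ P). Qed.

Lemma mp_D_sq (k : fieldType) (P : monomial_presentation k n) : mp_D P *m mp_D P = 0.
Proof.
have e := ext_D_sq (taylor (@mp_x _ _ P) (fun i j => mp_exp P i j)).
rewrite /mp_D; move: e; set T := ext_D _ => e; rewrite -map_mxM e map_scalar_mx rmorphN rmorph_sum big1 ?oppr0 ?raddf0 // => j _.
have z : mp_res P (mono (@mp_x _ _ P) (fun t => mp_exp P j t)) = 0.
  apply: mp_ideal_res; apply/mp_ideal_mid; rewrite -[mono _ _]mul1r; apply: mid_gen.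
  by rewrite has_map; apply/hasP; exists j; [rewrite mem_enum | exact: lem_refl].
by rewrite rmorphM /= map_mpolyC [X in _ * X%:MP](_ : _ = 0) ?mpolyC0 ?mulr0 //; exact: z.
Qed.

Lemma mp_minors (k : fieldType) (P : monomial_presentation k n) (p : affine k n) : (0 < n)%N ->
  (forall s, annH (mp_D P) s -> p s) <->
  zero_locus (type_minors (ctype_of (fun i j => mp_exp P i j))) p.
Proof.
move=> n0; rewrite type_minorsP -mp_D_type.
by apply: annH_minors; [exact: card_half | exact: mp_D_sq].
Qed.

(** What minimality of the generators imposes on the exponents; up to doubling these conditions also
    suffice for [realization]. *)
Definition good_exp d (E : 'I_n -> 'I_d -> nat) :=
  [forall i, (0 < wt (E i))%N] && [forall i, forall j, (i != j) ==> ~~ lem (E i) (E j)].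

Definition share d (E : 'I_n -> 'I_d -> nat) i j := [exists t, (0 < E i t) && (0 < E j t)]%N.

Lemma shareC d (E : 'I_n -> 'I_d -> nat) i j : share E i j = share E j i.
Proof. by apply: eq_existsb => t; rewrite andbC. Qed.

Lemma mp_good_exp (k : fieldType) (P : monomial_presentation k n) :
  good_exp (fun i j => mp_exp P i j).
Proof.
have [_ gmin] := @mp_f_generates _ _ P.
apply/andP; split; apply/forallP => i.
  rewrite lt0n; apply/eqP => w0.
  have /mp_ideal_res : mp_ideal P 1.
    apply/mp_ideal_mid; apply: mid_unit; rewrite has_map; apply/hasP; exists i.
      by rewrite mem_enum.
    by rewrite /= w0.
  by move/eqP; rewrite rmorph1 oner_eq0.
apply/forallP => j; apply/implyP => ij; apply/negP => le_ij.
case: (gmin j); exists (fun l => if l == i then mono (@mp_x _ _ P) (fun t => mp_exp P j t - mp_exp P i t)%N else 0).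
rewrite (bigD1 i) //= eqxx big1 ?addr0; last first.
  by move=> l /andP [_ /negbTE ->]; rewrite mul0r.
exact: mono_lem.
Qed.

(** Doubling puts the generators into the square of the maximal ideal, as a presentation requires,
    and leaves the support unchanged. *)
Lemma ctype_of_double d (E : 'I_n -> 'I_d -> nat) :
  ctype_of (fun i t => (E i t).*2) = ctype_of E.
Proof.
have lcm2 A t : lcme (fun i t => (E i t).*2) A t = (lcme E A t).*2.
  by rewrite /lcme; elim/big_rec2: _ => [|i a b _ ->] //; lia.
by apply/ffunP => -[A i]; rewrite !ffunE /=; congr (_, _); apply: eq_forallb => t; rewrite lcm2; lia.
Qed.

Lemma good_exp_double d (E : 'I_n -> 'I_d -> nat) :
  good_exp E -> good_exp (fun i t => (E i t).*2).
Proof.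
move=> /andP [/forallP h1 /forallP h2]; apply/andP; split; apply/forallP => i.
  have := h1 i; rewrite !lt0n; apply: contra; rewrite /wt !sum_nat_eq0.
  by move=> /forallP h; apply/forallP => t; have := h t; rewrite /= double_eq0.
apply/forallP => j; apply/implyP => ij; have /forallP/(_ j) := h2 i.
rewrite ij /=; apply: contra => /forallP h; apply/forallP => t; have := h t.
by rewrite leq_double.
Qed.

End CombinatorialType.

(** * Realization of combinatorial types in polynomial rings *)

Section Realization.
Variables (k : fieldType) (n d : nat) (E : 'I_n -> 'I_d -> nat).
Local Notation Q := {mpoly k[d]}.
Local Notation X := (fun j : 'I_d => 'X_j : Q).

Lemma variables_whomog j : whomog (fun=> 1%N) ('X_j : Q).
Proof.
exists 1%N => m; rewrite msuppX inE => /eqP ->.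
rewrite (bigD1 j) //= mnm1E eqxx big1 // => i ij.
by rewrite mnm1E eq_sym (negbTE ij).
Qed.

Lemma monomial_whomog (m : 'I_d -> nat) : whomog (fun=> 1%N) (mono X m).
Proof.
exists (\sum_(j < d) 1 * (m j))%N => m'.
have -> : mono X m = 'X_[[multinom m j | j < d]].
  by rewrite mpolyXE_id; apply: eq_bigr => j _; rewrite mnmE.
by rewrite msuppX inE => /eqP ->; apply: eq_bigr => j _; rewrite mnmE.
Qed.

Lemma variables_max j : ('X_j : Q)@_0%MM = 0.
Proof.
rewrite mcoeffX; case: eqP => // /(congr1 (fun m : 'X_{1..d} => m j)).
by rewrite mnm1E eqxx mnm0E.
Qed.

Local Notation kill i := (partial_eval (fun _ : 'I_d => 0 : k) i).

Lemma kill_span (i : nat) a : (i <= d)%N ->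
  exists c : 'I_d -> Q, a - kill i a = \sum_(j < d | (j < i)%N) c j * 'X_j.
Proof.
elim: i => [|i IH] id.
  by exists (fun=> 0); rewrite partial_eval0 subrr big_pred0.
have [c e] := IH (ltnW id).
have [q eq] := partial_eval_diff (fun _ : 'I_d => 0 : k) (Ordinal id) a.
exists (fun j => if j == Ordinal id then q else c j).
rewrite (bigD1 (Ordinal id)) //= eqxx.
rewrite (_ : a - kill i.+1 a = (kill i a - kill i.+1 a) + (a - kill i a)); last first.
  by rewrite [RHS]addrC addrA subrK.
rewrite eq e mpolyC0 subr0 mulrC; congr (_ + _).
apply: eq_big => [j|j]; last by case: eqP => // -> /=; rewrite ltnn.
rewrite ltnS; apply/idP/andP => [ji|[ji ne]].
  by split; [exact: ltnW | apply: contraTneq ji => ->; rewrite /= ltnn].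
by rewrite ltn_neqAle ji andbT; apply: contra ne => /eqP e'; apply/eqP/val_inj.
Qed.

(** Setting the first i variables to 0 detects the ideal they generate, and takes values in a domain
    where X_i remains nonzero. *)
Lemma variables_regular : regular_seq X.
Proof.
split=> [i a /span_mod0 [c e]|/span_mod0 [c /(congr1 (mcoeff 0%MM))]]; last first.
  rewrite raddf_sum /= big1 => [/eqP|j _]; first by rewrite mcoeff1 eqxx oner_eq0.
  by rewrite rmorphM /= variables_max mulr0.
have [c' e'] := kill_span a (ltnW (ltn_ord i)).
apply/span_mod0; exists c'; rewrite -e'.
suff -> : kill i a = 0 by rewrite subr0.
have : kill i ('X_i * a) = 0.
  rewrite e rmorph_sum big1 // => j ji.
  by rewrite rmorphM /= partial_evalX ji mpolyC0 mulr0.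
rewrite rmorphM /= partial_evalX ltnn => /eqP; rewrite mulf_eq0 => /orP [/eqP h|/eqP //].
have := mcoeffXU k i i; rewrite h mcoeff0 eqxx => /eqP; by rewrite eq_sym oner_eq0.
Qed.

Hypothesis gE : good_exp E.
Local Notation E2 := (fun i t => (E i t).*2).
Local Notation I := (mid X [seq E2 i | i <- enum 'I_n]).

Lemma double_ideal_span q : I q <-> exists c, q = \sum_(i < n) c i * mono X (E2 i).
Proof. by have := mid_span X E2 xpredT q; rewrite filter_predT. Qed.

Lemma double_hom_ideal : hom_ideal (whomog (fun=> 1%N)) I.
Proof.
split; first by split; [exact: mid0 | exact: midD | exact: midM].
move=> q /double_ideal_span [c e]; exists n, (fun i => mono X (E2 i)).
split=> [i|]; last by exists c.
split; last exact: monomial_whomog.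
apply/double_ideal_span; exists (fun j => (j == i)%:R).
by rewrite sum_delta.
Qed.

Lemma double_in_max_sq q : I q ->
  ideal_pow (res_ker (mcoeff 0%MM : {rmorphism Q -> k})) 2 q.
Proof.
move=> /double_ideal_span [c ->].
have /andP [/forallP wt0 _] := gE.
have /choice [t ht] : forall i, exists t, (0 < E i t)%N by move=> i; apply/wt_gt0.
exists n, (fun i => 'X_(t i)), (fun i => 'X_(t i) * (c i * mono X (dec (t i) (dec (t i) (E2 i))))).
split=> [i|i|].
- exact: variables_max.
- exists 1%N, (fun=> 'X_(t i)), (fun=> c i * mono X (dec (t i) (dec (t i) (E2 i)))).
  by split=> // [_|]; [exact: variables_max | rewrite big_ord1].
apply: eq_bigr => i _; have := ht i => hi.
rewrite (@mono_dec _ _ X (t i)) ?double_gt0 // (@mono_dec _ _ X (t i)); first by ring.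
by rewrite /dec eqxx; lia.
Qed.

Lemma double_minimal : minimally_generates (fun i => \prod_(j < d) X j ^+ (\matrix_(i, j) (E i j).*2 : 'M[nat]_(n, d)) i j) I.
Proof.
have ef i : \prod_(j < d) X j ^+ (\matrix_(i, j) (E i j).*2 : 'M[nat]_(n, d)) i j = mono X (E2 i).
  by apply: eq_bigr => j _; rewrite mxE.
split=> [q|i [c e]].
  rewrite double_ideal_span; split=> -[c ->]; exists c; apply: eq_bigr => i _; by rewrite ef.
rewrite ef in e.
have hm : mid X [seq E2 j | j <- enum 'I_n & j != i] (mono X (E2 i) * 1).
  apply/mid_span; exists c; rewrite mulr1 e; apply: eq_bigr => j _; by rewrite ef.
have := @mid_mono_res _ _ X (initial_regularP variables_regular)
   (nakayama_graded (w := fun=> 1%N) (fun _ => isT) variables_whomog variables_max)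
   k (mcoeff 0%MM) variables_max _ _ _ hm.
rewrite rmorph1 => h.
suff hn : ~~ has (fun m => lem m (E2 i)) [seq E2 j | j <- enum 'I_n & j != i].
  by move/eqP: (h hn); rewrite oner_eq0.
rewrite has_map; apply/hasPn => j; rewrite mem_filter => /andP [ji _] /=.
have /andP [_ /forallP /(_ j) /forallP /(_ i)] := good_exp_double gE.
by rewrite ji.
Qed.

Definition realization : monomial_presentation k n :=
  @MonomialPresentation k n Q (mcoeff 0%MM) (whomog (fun=> 1%N)) I d X
    (\matrix_(i, j) (E i j).*2)
    (@GradedPresentation k d (fun=> 1%N) I (fun _ => isT) double_hom_ideal double_in_max_sq)
    variables_whomog variables_max variables_regular double_minimal.

Lemma realization_type : ctype_of (fun i j => mp_exp realization i j) = ctype_of E.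
Proof.
rewrite -[RHS]ctype_of_double; congr ctype_of.
by apply: functional_extensionality_dep => i; apply: functional_extensionality_dep => j; exact: mxE.
Qed.

End Realization.

Section FinitelyMany.
Variables (n : nat) (n_gt0 : (0 < n)%N).

Lemma good_exp_id : good_exp (fun i j : 'I_n => (i == j : nat)).
Proof.
apply/andP; split; apply/forallP => i.
  by apply/wt_gt0; exists i; rewrite eqxx.
apply/forallP => j; apply/implyP => ij; apply/negP => /forallP /(_ i).
by rewrite eqxx eq_sym (negbTE ij).
Qed.

(** Exponents that belong to no presentation get a default, the minors for n distinct variables, so
    that the value always lies in the list of realizable ones. *)
Definition minors_of d (E : 'I_n -> 'I_d -> nat) :=
  if good_exp E then type_minors (ctype_of E)
  else type_minors (ctype_of (fun i j : 'I_n => (i == j : nat))).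

Lemma support_zero_locus (k : fieldType) (P : monomial_presentation k n) :
  is_cohomological_support P (zero_locus (minors_of (fun i j => mp_exp P i j))).
Proof.
apply/is_cohomological_supportP => p; rewrite /minors_of mp_good_exp.
exact: mp_minors.
Qed.

Lemma realizable_supports :
  exists (L : seq (seq {mpoly int[n]}))
         (Phi : forall d : nat, 'M[nat]_(n, d) -> seq {mpoly int[n]}),
    [/\ forall (d : nat) (a : 'M[nat]_(n, d)), Phi d a \in L,
        forall (k : fieldType) (P : monomial_presentation k n),
          is_cohomological_support P (zero_locus (Phi (mp_length P) (mp_exp P))) &
        forall (k : fieldType) (Z : affine k n -> Prop),
          realizable Z <->
          exists2 l, l \in L & forall p, Z p <-> zero_locus l p].
Proof.
(* Types are finite in number although d is unbounded; classical logic selects those that occur. *)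
pose real (tau : ctype n) := asbool (exists d (E : 'I_n -> 'I_d -> nat), good_exp E /\ ctype_of E = tau).
exists [seq type_minors tau | tau <- enum [set tau | real tau]].
exists (fun d (a : 'M[nat]_(n, d)) => minors_of (fun i j => a i j)).
have inL d (E : 'I_n -> 'I_d -> nat) :
    minors_of E \in [seq type_minors tau | tau <- enum [set tau | real tau]].
  rewrite /minors_of; case: ifP => gE; apply: map_f; rewrite mem_enum inE; apply/asboolP.
    by exists d, E.
  by exists n, (fun i j => (i == j : nat)); split=> //; apply: good_exp_id.
split=> // [k P|k Z]; first exact: support_zero_locus.
split=> [[P hP]|[l /mapP [tau]]].
  exists (minors_of (fun i j => mp_exp P i j)) => // p.
  have [[F rF] hF] := hP; have [_ hF'] := support_zero_locus P.
  by rewrite -(hF F rF) -(hF' F rF).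
rewrite mem_enum inE => /asboolP [d [E [gE <-]]] -> hZ.
exists (realization k gE); apply/is_cohomological_supportP => p.
by rewrite mp_minors // realization_type hZ.
Qed.

End FinitelyMany.

(** * Embedded deformations *)

Section MonomialGcd.
Variables (k : fieldType) (n : nat) (P : monomial_presentation k n).
Local Notation E := (fun i => mp_exp P i : 'I_(mp_length P) -> nat).
Local Notation f := (mp_f P).
Local Notation x := (@mp_x _ _ P).
Local Notation mono := (mono x).

Let colon := @mid_colon _ _ x (@mp_initial_regular _ _ P) (@mp_nakayama _ _ P).

Lemma mid1 m a : mid x [:: m] a <-> exists c, a = c * mono m.
Proof.
split=> [[c /= /eqP]|[c ->]]; last by exists c; rewrite /= subrr.
by rewrite subr_eq0 => /eqP ->; exists c.
Qed.

Lemma mono_nzd m a : mono m * a = 0 -> a = 0.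
Proof. by move=> e; apply: (@colon [::] m). Qed.

Lemma mono_cancel m a b : mono m * a = mono m * b -> a = b.
Proof.
move=> e; apply/eqP; rewrite -subr_eq0; apply/eqP/(@mono_nzd m).
by rewrite mulrBr e subrr.
Qed.

Lemma mono_coprime u v a b : (forall t, minn (u t) (v t) = 0%N) ->
  mono u * a = b * mono v -> exists c, a = c * mono v.
Proof.
move=> uv e; have /colon /= : mid x [:: v] (mono u * a) by apply/mid1; exists b.
move=> h; apply/mid1; apply: (@mid_ext _ _ x [:: sube u v] [:: v] a _ h) => /=; rewrite andbT.
by apply/andP; split; apply/forallP => t; have := uv t; rewrite /sube; lia.
Qed.

Lemma mono_dvd u v : Defs.dvd (mono u) (mono v) -> lem u v.
Proof.
move=> [c e].
have h : mid x [:: u] (mono v * 1) by rewrite mulr1; apply/mid1; exists c.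
have := mid_mono_res (@mp_initial_regular _ _ P) (@mp_nakayama _ _ P) (@mp_x_max _ _ P) h.
rewrite /= orbF rmorph1 => h1; apply: contraT => /h1 /eqP; by rewrite oner_eq0.
Qed.

Lemma dvd_mono u v : lem u v -> Defs.dvd (mono u) (mono v).
Proof. by move=> /mono_lem e; exists (mono (fun t => v t - u t)%N). Qed.

Local Notation adj := (share E).
Let adjC i j : adj i j = adj j i := shareC E i j.

Lemma adjPn i j : reflect (forall t, minn (E i t) (E j t) = 0%N) (~~ adj i j).
Proof.
rewrite negb_exists; apply: (iffP forallP) => h t; have := h t; lia.
Qed.

Let gexp i j t := minn (E i t) (E j t).
Let rexp i j t := (E i t - E j t)%N.

Lemma mono_gexp i j : f i = mono (gexp i j) * mono (rexp i j).
Proof. by rewrite mp_fE -monoD; apply: mono_ext => t; rewrite /gexp /rexp; lia. Qed.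

Lemma gexpC i j : mono (gexp i j) = mono (gexp j i).
Proof. by apply: mono_ext => t; rewrite /gexp minnC. Qed.

Lemma rexp_coprime i j t : minn (rexp i j t) (rexp j i t) = 0%N.
Proof. by rewrite /rexp; lia. Qed.

(** A common divisor h need not be a monomial. From f_i = a h and f_j = b h the coprime cofactors
    satisfy r_ji a = b r_ij; so r_ij divides a, and cancelling it shows that h divides the
    monomial. *)
Lemma mono_is_gcd i j : is_gcd (mono (gexp i j)) (f i) (f j).
Proof.
split=> [||h [a ea] [b eb]].
- by exists (mono (rexp i j)); rewrite (mono_gexp i j) mulrC.
- by exists (mono (rexp j i)); rewrite (mono_gexp j i) gexpC mulrC.
have e : mono (rexp j i) * a = b * mono (rexp i j).
  apply/eqP; rewrite -subr_eq0; apply/eqP/(@mono_nzd (E i)).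
  rewrite -mp_fE ea (_ : _ * _ = a * (mono (rexp j i) * (a * h) - mono (rexp i j) * (b * h))); last by ring.
  by rewrite -ea -eb (mono_gexp i j) (mono_gexp j i) gexpC; ring.
have [c ec] := mono_coprime (rexp_coprime j i) e.
exists c; apply: (@mono_cancel (rexp i j)).
by rewrite mulrC -mono_gexp ea ec; ring.
Qed.

Lemma gcd_edgeP i j : gcd_edge P i j <-> (i != j) && adj i j.
Proof.
split=> [[ij [g [[ [a ea] [b eb] h] ug]]]|/andP [ij aij]].
  rewrite ij /=; apply: contraT => /adjPn co.
  have e : mono (E i) * b = a * mono (E j) by rewrite -!mp_fE ea eb; ring.
  have [c ec] := mono_coprime co e.
  case/negP: ug; apply/GRing.unitrPr; exists c.
  have e1 : b * (1 - g * c) = 0 by rewrite mulrBr mulr1 {1}ec -mp_fE eb; ring.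
  apply/eqP; rewrite -subr_eq0 -opprB oppr_eq0; apply/eqP/(@mono_nzd (E j)).
  by rewrite -mp_fE eb mulrAC e1 mul0r.
split=> //; exists (mono (gexp i j)); split; first exact: mono_is_gcd.
apply/negP => /(rmorph_unit (mp_res P)); rewrite unitfE (res_mono (@mp_x_max _ _ P)).
have /existsP [t ht] := aij.
suff -> : (wt (gexp i j) == 0)%N = false by rewrite eqxx.
by apply/negbTE; rewrite -lt0n; apply/wt_gt0; exists t; rewrite /gexp; lia.
Qed.

Lemma lcm_dvdP i j l :
  (exists m, is_lcm m (f i) (f j) /\ Defs.dvd (f l) m) <->
  lem (E l) (fun t => maxn (E i t) (E j t)).
Proof.
have fM i' (m : 'I_(mp_length P) -> nat) : lem (E i') m -> Defs.dvd (f i') (mono m).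
  by move=> h; rewrite mp_fE; apply: dvd_mono.
split=> [[m [[_ _ hm] [c ec]]]|h].
  have [||c' e'] := hm (mono (fun t => maxn (E i t) (E j t))).
  - by apply: fM => //; apply/forallP => t; rewrite leq_maxl.
  - by apply: fM => //; apply/forallP => t; rewrite leq_maxr.
  apply: mono_dvd; exists (c' * c); by rewrite e' ec -mp_fE mulrA.
exists (mono (fun t => maxn (E i t) (E j t))); split; last exact: fM.
split=> [||y [a ea] [b eb]].
- by apply: fM => //; apply/forallP => t; rewrite leq_maxl.
- by apply: fM => //; apply/forallP => t; rewrite leq_maxr.
have e : mono (rexp i j) * a = b * mono (rexp j i).
  apply: (@mono_cancel (gexp i j)); rewrite mulrA -mono_gexp mulrC -ea eb.
  by rewrite (mono_gexp j i) gexpC; ring.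
have [c ec] := mono_coprime (rexp_coprime i j) e.
exists c; rewrite ea ec -mulrA; congr (_ * _); rewrite mp_fE -monoD.
by apply: mono_ext => t; rewrite /rexp; lia.
Qed.

Lemma mp_antichain i j : i != j -> ~~ lem (E i) (E j).
Proof.
by move=> ij; have /andP [_ /forallP /(_ i) /forallP /(_ j)] := mp_good_exp P; rewrite ij.
Qed.

Definition isolated : {set 'I_n} := [set i | [forall j, (j != i) ==> ~~ adj i j]].

Lemma isolatedP i : reflect (forall j, j != i -> ~~ adj i j) (i \in isolated).
Proof.
rewrite inE; apply: (iffP forallP) => h j; first by move/implyP: (h j).
by apply/implyP; apply: h.
Qed.

Lemma isolated_nzd (W : pred 'I_n) i a : i \in isolated -> ~~ W i ->
  mid x [seq E l | l <- enum 'I_n & W l] (f i * a) ->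
  mid x [seq E l | l <- enum 'I_n & W l] a.
Proof.
move=> /isolatedP iso nW; rewrite mp_fE => /colon; apply: mid_sub.
rewrite -map_comp all_map; apply/allP => l; rewrite mem_filter => /andP [Wl _] /=.
rewrite has_map; apply/hasP; exists l; first by rewrite mem_filter Wl mem_enum.
have /iso /adjPn co : l != i by apply: contraTneq Wl => ->.
by apply/forallP => t; have := co t; rewrite /= /sube; lia.
Qed.

Local Notation J := (mid x [seq E l | l <- enum 'I_n & l \notin isolated]).
Local Notation g := (fun j : 'I_#|isolated| => f (enum_val j)).

Lemma isolated_span_mod (p : pred 'I_#|isolated|) (W : pred 'I_n) a :
  (forall j, W (enum_val j) = p j) ->
  span_mod J g p a <-> mid x [seq E l | l <- enum 'I_n & (l \notin isolated) || W l] a.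
Proof.
move=> Wp; split=> [[b [Jb [c ->]]]|/mid_span [c ->]].
  apply: midD.
    apply: mid_sub Jb; rewrite all_map; apply/allP => l; rewrite mem_filter => /andP [hl _] /=.
    rewrite has_map; apply/hasP; exists l; last exact: lem_refl.
    by rewrite mem_filter hl mem_enum.
  apply: mid_sum => j pj; apply: mid_gen; rewrite has_map; apply/hasP.
  by exists (enum_val j); [rewrite mem_filter Wp pj orbT mem_enum | exact: lem_refl].
rewrite (bigID (mem (~: isolated))) /=; eexists; split; last first.
  exists (fun j => c (enum_val j)); congr (_ + _).
  under [RHS]eq_bigl => j do rewrite -Wp.
  rewrite -(big_enum_val_cond _ (fun l => c l * f l)).
  apply: eq_big => [l|l _]; last by rewrite mp_fE.
  by rewrite in_setC !inE; case: [forall _, _]; rewrite /= ?andbT ?andbF.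
apply: mid_sum => l /andP [_]; rewrite inE => hl; apply: mid_gen.
by rewrite has_map; apply/hasP; exists l; [rewrite mem_filter hl mem_enum | exact: lem_refl].
Qed.

Lemma mp_f_hom i : mp_hom P (f i).
Proof.
apply: mp_hom_prod => j; rewrite -[mp_exp P i j]card_ord -prodr_const.
apply: mp_hom_prod => _; exact: mp_x_hom.
Qed.

Lemma isolated_embedded_deformation : embedded_deformation P #|isolated|.
Proof.
have predTE a : span_mod J g predT a <-> mp_ideal P a.
  rewrite (@isolated_span_mod predT xpredT) // mp_ideal_mid.
  by rewrite (eq_filter (a2 := predT)) ?filter_predT // => l; rewrite orbT.
exists J; split.
- split; first by split; [exact: mid0 | exact: midD | exact: midM].
  move=> a /mid_span [c ->].
  exists #|~: isolated|, (fun j => f (enum_val j)); split=> [j|].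
    split; last exact: mp_f_hom.
    rewrite mp_fE -[mono _]mul1r; apply: mid_gen; rewrite has_map; apply/hasP.
    exists (enum_val j); last exact: lem_refl.
    by rewrite mem_filter mem_enum andbT; have := enum_valP j; rewrite inE.
  exists (fun j => c (enum_val j)).
  rewrite -(big_enum_val (fun l => c l * mono (E l))).
  by apply: eq_bigl => l; rewrite in_setC.
- move=> a; rewrite mp_ideal_mid; apply: mid_sub; rewrite all_map; apply/allP => l _ /=.
  by rewrite has_map; apply/hasP; exists l; [rewrite mem_enum | exact: lem_refl].
exists g; split=> [i||a]; first exact: mp_f_hom; last by rewrite predTE.
split=> [i a|]; last first.
  by rewrite predTE => /mp_ideal_res /eqP; rewrite rmorph1 oner_eq0.
pose W l := (enum_rank_in (enum_valP i) l < i)%N.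
have hW (j : 'I_#|isolated|) : W (enum_val j) = (j < i)%N by rewrite /W (@enum_valK_in _ _ _ (enum_valP i) j).
rewrite !(@isolated_span_mod (fun j => (j < i)%N) W) //.
apply: isolated_nzd; first exact: enum_valP.
by rewrite negb_or negbK enum_valP hW ltnn.
Qed.

(** Induction on the number of leading coefficients that may be nonzero: regularity expresses the
    last of them through the earlier elements, and substitution moves it into their coefficients. *)
Lemma regular_seq_mod_coef (Q : comUnitRingType) (J' : Q -> Prop) (c : nat) (h : 'I_c -> Q) :
  ideal J' -> regular_seq_mod J' h -> forall q : 'I_c -> Q,
  J' (\sum_j q j * h j) -> forall j, span_mod J' h predT (q j).
Proof.
move=> [J0 JD JM] [reg _].
have JN a : J' a -> J' (- a) by move=> ha; rewrite -mulN1r; apply: JM.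
have spD a b : span_mod J' h predT a -> span_mod J' h predT b -> span_mod J' h predT (a + b).
  move=> [u [hu [cu ->]]] [v [hv [cv ->]]]; exists (u + v); split; first exact: JD.
  exists (fun j => cu j + cv j); under [X in _ = _ + X]eq_bigr => j _ do rewrite mulrDl.
  by rewrite big_split /= addrACA.
have spg a j : span_mod J' h predT (a * h j).
  exists 0; split=> //; exists (fun l => if l == j then a else 0).
  by rewrite add0r (bigD1 j) //= eqxx big1 ?addr0 // => l /negbTE ->; rewrite mul0r.
suff key r : (r <= c)%N -> forall q : 'I_c -> Q, (forall j : 'I_c, (r <= j)%N -> q j = 0) ->
    J' (\sum_j q j * h j) -> forall j, span_mod J' h predT (q j).
  by move=> q; apply: (key c) => // j; rewrite leqNgt ltn_ord.
elim: r => [|r IH] rc q q0 Jq j.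
  by rewrite q0 //; exists 0; split=> //; exists (fun=> 0); rewrite big1 ?addr0 // => l _; rewrite mul0r.
pose i := Ordinal rc.
have split_sum (F : 'I_c -> Q) : (forall l : 'I_c, (r < l)%N -> F l = 0) ->
    \sum_l F l = \sum_(l < c | (l < i)%N) F l + F i.
  move=> F0; rewrite (bigD1 i) //= addrC; congr (_ + _).
  rewrite [LHS]big_mkcond [RHS]big_mkcond; apply: eq_bigr => l _.
  case: (ltngtP l r) => [lr|rl|e]; first by case: eqP => // e; move: lr; rewrite e /= ltnn.
    by rewrite F0 // if_same.
  by rewrite (_ : l = i) ?eqxx //; apply: val_inj.
have [b [hb [d ed]]] : span_mod J' h (fun j => (j < i)%N) (q i).
  apply: reg; exists (\sum_l q l * h l); split=> //; exists (fun l => - q l).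
  rewrite (split_sum (fun l => q l * h l)); last by move=> l rl; rewrite q0 ?mul0r.
  under [X in _ = _ + X]eq_bigr => l _ do rewrite mulNr.
  by rewrite sumrN addrAC subrr add0r mulrC.
(* The substitution removes h_i from the relation and changes the other coefficients only by
   multiples of h_i. *)
pose q' (l : 'I_c) := if (l < i)%N then q l + d l * h i else 0.
have hq' : forall l, span_mod J' h predT (q' l).
  apply: (IH (ltnW rc)) => [l rl|]; first by rewrite /q' ltnNge rl.
  have -> : \sum_l q' l * h l = \sum_l q l * h l - b * h i.
    rewrite (split_sum (fun l => q' l * h l)); last first.
      by move=> l rl; rewrite /q' ltnNge (ltnW rl) mul0r.
    rewrite (split_sum (fun l => q l * h l)); last by move=> l rl; rewrite q0 ?mul0r.
    rewrite /q' ltnn mul0r addr0 ed mulrDl addrCA addrAC subrr add0r addrC mulr_suml -big_split.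
    by apply: eq_bigr => l ->; rewrite /=; ring.
  by apply: JD => //; rewrite mulrC; apply: JN; apply: JM.
case: (ltngtP j r) => [jr|rj|e].
- rewrite (_ : q j = q' j + - d j * h i); last by rewrite /q' jr mulNr addrK.
  exact: spD.
- by rewrite q0 //; exists 0; split=> //; exists (fun=> 0); rewrite big1 ?addr0 // => l _; rewrite mul0r.
have -> : j = i by apply: val_inj.
exists b; split=> //; exists (fun l : 'I_c => if (l < i)%N then d l else 0).
rewrite ed big_mkcond; congr (_ + _); apply: eq_bigr => l _.
by case: ifP => _; rewrite ?mul0r.
Qed.

Lemma embedded_deformation_bound c : embedded_deformation P c -> (c <= #|isolated|)%N.
Proof.
move=> [J' [[iJ _] JI [h [_ hreg hI]]]].
have [gen _] := @mp_f_generates _ _ P.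
have If j : mp_ideal P (f j).
  apply/gen; exists (fun l => (l == j)%:R).
  by rewrite sum_delta.
have Ih i : mp_ideal P (h i).
  have [J0 _ _] := iJ; apply/hI; exists 0; split=> //; exists (fun l => (l == i)%:R).
  by rewrite add0r sum_delta.
have [J0 JD JM] := iJ.
have JN a : J' a -> J' (- a) by move=> ha; rewrite -mulN1r; apply: JM.
have JS (F : 'I_n -> mp_ring P) : (forall j, J' (F j)) -> J' (\sum_j F j).
  by move=> hF; elim/big_ind: _ => // j _.
have /choice [q hq] : forall i, exists q : 'I_n -> mp_ring P, h i = \sum_j q j * f j.
  by move=> i; have /gen [q ->] := Ih i; exists q.
have /choice [B hB] : forall j, exists B : 'I_c -> mp_ring P, J' (f j - \sum_t B t * h t).
  by move=> j; have /hI [b [hb [B ->]]] := If j; exists B; rewrite addrK.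
have coef (q' : 'I_c -> mp_ring P) : J' (\sum_t q' t * h t) -> forall t, mp_res P (q' t) = 0.
  move=> hq' t; apply: mp_ideal_res; apply/hI.
  exact: (regular_seq_mod_coef iJ hreg).
have B0 j t : j \notin isolated -> mp_res P (B j t) = 0.
  rewrite inE negb_forall => /existsP [l]; rewrite negb_imply negbK => /andP [lj ajl].
  have e : mono (rexp l j) * f j = mono (rexp j l) * f l.
    by rewrite (mono_gexp j l) (mono_gexp l j) gexpC; ring.
  have hJ : J' (\sum_t (mono (rexp l j) * B j t - mono (rexp j l) * B l t) * h t).
    rewrite (_ : \sum_t _ = mono (rexp j l) * (f l - \sum_t B l t * h t)
                           - mono (rexp l j) * (f j - \sum_t B j t * h t)).
      by apply: JD; [|apply: JN]; apply: JM.
    rewrite !mulrBr e (_ : forall u v w : mp_ring P, u - v - (u - w) = w - v); last by move=> *; ring.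
    rewrite !mulr_sumr -sumrB.
    by apply: eq_bigr => u _; rewrite mulrBl !mulrA.
  have /hI hI' := regular_seq_mod_coef iJ hreg hJ t.
  (* No generator of this ideal divides f_l / gcd (f_j, f_l): by minimality, and for f_l itself
     because f_j and f_l share a variable. *)
  have hm : mid x (rexp j l :: [seq E i | i <- enum 'I_n]) (mono (rexp l j) * B j t).
    exists (B l t); rewrite [B l t * _]mulrC; exact/mp_ideal_mid.
  apply: (mid_mono_res (@mp_initial_regular _ _ P) (@mp_nakayama _ _ P) (@mp_x_max _ _ P) hm).
  rewrite /= negb_or; apply/andP; split.
    have := @mp_antichain j l; rewrite eq_sym => /(_ lj); apply: contra => /forallP hle.
    by apply/forallP => u; have := hle u; rewrite /rexp; lia.
  rewrite has_map; apply/hasPn => i _ /=; apply/negP => /forallP hle.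
  have [ei|il] := eqVneq i l.
    have /existsP [u hu] := ajl; have := hle u; rewrite ei /rexp; lia.
  case/negP: (mp_antichain il); apply/forallP => u; have := hle u; rewrite /rexp /=; lia.
pose C : 'M[k]_(c, n) := \matrix_(i, j) mp_res P (q i j).
pose BB : 'M[k]_(n, c) := \matrix_(j, t) mp_res P (B j t).
(* Rewriting h through f and f through h again changes the coefficients only modulo I, by [coef].
   The rows of BB outside [isolated] vanish, which bounds its rank. *)
have CB : C *m BB = 1%:M.
  apply/matrixP => i t; rewrite !mxE.
  have hJ : J' (\sum_t ((t == i)%:R - \sum_j q i j * B j t) * h t).
    rewrite (_ : \sum_t _ = \sum_j q i j * (f j - \sum_t B j t * h t)).
      by apply: JS => j; apply: JM.
    under eq_bigr => u _ do rewrite mulrBl.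
    rewrite sumrB sum_delta.
    under [RHS]eq_bigr => j _ do rewrite mulrBr.
    rewrite sumrB -hq; congr (_ - _).
    under eq_bigr => u _ do rewrite mulr_suml.
    rewrite exchange_big; apply: eq_bigr => j _; rewrite mulr_sumr.
    by apply: eq_bigr => u _; rewrite mulrA.
  have := coef _ hJ t; rewrite rmorphB rmorph_sum rmorph_nat => /eqP; rewrite subr_eq0 eq_sym => /eqP e.
  rewrite eq_sym -e; apply: eq_bigr => j _; by rewrite rmorphM !mxE.
have BE : BB = colsub (enum_val (A := mem isolated)) 1%:M *m rowsub (enum_val (A := mem isolated)) BB.
  apply/matrixP => j t; rewrite !mxE.
  under eq_bigr => u _ do rewrite !mxE.
  rewrite -(big_enum_val (fun l => (j == l)%:R * mp_res P (B l t))) /=.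
  rewrite big_mkcond (bigD1 j) //= eqxx mul1r big1 ?addr0; last first.
    by move=> l /negbTE lj; rewrite eq_sym lj mul0r if_same.
  by case: ifP => // /negbT /B0 ->.
rewrite -(mxrank1 k c) -CB BE mulmxA; apply: leq_trans (mxrankM_maxr _ _) _.
exact: rank_leq_row.
Qed.

End MonomialGcd.

(** * At most five generators *)

Section GraphSearch.
Variables (n : nat) (g : seq bitseq).

(* The graph is given by the strictly lower triangular part of its adjacency matrix. *)
Definition gadj i j := nth false (nth [::] g i) j || nth false (nth [::] g j) i.

(** The entry chi_j from a to a + j; [nz] marks the variables that may lie outside p. *)
Definition addable (nz : pred nat) (a : bitseq) j :=
  [&& ~~ nth false a j, nz j & all (fun l => nth false a l ==> ~~ gadj j l) (iota 0 n)].

(** Necessary conditions for f_i to divide lcm_b. No single f_l suffices, so i has two neighbours in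
    b; and a variable common to f_i and f_l occurs in some f_m with m in b. A triple (u, v, w)
    demands that v have a neighbour in b besides u and w. *)
Definition removable (fb : option (nat * nat * nat)) (b : bitseq) i :=
  [&& 1 < count (fun l => nth false b l && gadj i l) (iota 0 n),
      all (fun l => gadj i l ==> nth false b l ||
        has (fun m => [&& nth false b m, gadj i m & gadj m l]) (iota 0 n)) (iota 0 n) &
      if fb is Some (u, v, w) then (i == v) ==>
        has (fun m => [&& nth false b m, gadj i m, m != u & m != w]) (iota 0 n)
      else true]%N.

Definition nbrs nz fb (a : bitseq) : seq bitseq :=
  [seq set_nth false a j true | j <- iota 0 n & addable nz a j] ++
  [seq set_nth false a i false | i <- iota 0 n &
     nth false a i && removable fb (set_nth false a i false) i].

Fixpoint bits m : seq bitseq :=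
  if m is m'.+1 then [seq false :: a | a <- bits m'] ++ [seq true :: a | a <- bits m'] else [:: [::]].

(** Depth-first search for an augmenting path. The state holds the success flag, the columns visited
    and the matching as pairs (column, row), where a new pair shadows the older ones for its
    column. *)
Fixpoint augment (nb : bitseq -> seq bitseq) fuel a
    (st : bool * seq bitseq * seq (bitseq * bitseq)) :=
  if fuel is fuel'.+1 then
    foldl (fun st b => let: (found, seen, m) := st in
      if found || (b \in seen) then st else
      let: (found', seen', m') :=
        if ohead [seq e <- m | e.1 == b] is Some e then augment nb fuel' e.2 (false, b :: seen, m)
        else (true, b :: seen, m) in
      (found', seen', if found' then (b, a) :: m' else m')) st (nb a)
  else st.

(* The vertices reached by failing augmentations: by Koenig's theorem these,
   together with the rows having a neighbour outside, form a minimum cover. *)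
Definition reached nb rows : seq bitseq :=
  (foldl (fun sm a => let: (found, seen, m) := augment nb (size rows) a (false, sm.1, sm.2) in
     (if found then sm.1 else seen, m)) ([::], [::]) rows).1.

(** Whatever Y is, the columns in Y and the rows with an entry outside Y cover all entries; so the
    search that finds Y needs no correctness proof. *)
Definition small_cover nz fb :=
  let rows := bits n in
  let tbl := [seq (a, nbrs nz fb a) | a <- rows] in
  let nb a := if ohead [seq e <- tbl | e.1 == a] is Some e then e.2 else [::] in
  let Y := reached nb rows in
  (size Y + count (fun e => ~~ all (mem Y) e.2) tbl < 2 ^ n.-1)%N.

Definition dominated := has (fun i => all (fun j => (i == j) || gadj i j) (iota 0 n)) (iota 0 n).

Definition nonisolated i := has (gadj i) (iota 0 n).

Definition shape (es : seq (nat * nat)) (v : seq nat) :=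
  all (fun i => all (fun j => gadj (nth 0 v i) (nth 0 v j) == ((i, j) \in es) || ((j, i) \in es))
    (iota 0 5)) (iota 0 5).

End GraphSearch.

Fixpoint graphs n : seq (seq bitseq) :=
  if n is n'.+1 then [seq rcons g r | g <- graphs n', r <- bits n'] else [:: [::]].

(** The bound 1 < n matters: a single vertex is vacuously adjacent to all others, yet isolated.
    Conditionals keep the virtual machine from running the search when an earlier test has
    succeeded. *)
Definition generic_check n g :=
  if (1 < n)%N && dominated n g then true else
  if small_cover n g (nonisolated n g) None then true else
  (n == 5) && has (fun v => has (fun es => shape g es v) exceptional_edges)
    (permutations (iota 0 5)).

Definition exceptional_graph (es : seq (nat * nat)) : seq bitseq :=
  mkseq (fun i => mkseq (fun j => ((i, j) \in es) || ((j, i) \in es)) i) 5.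

Definition mask m : bitseq := mkseq (fun i => odd (m %/ 2 ^ i)) 5.

Definition toggle c (a : bitseq) := set_nth false a c (~~ nth false a c).

(* Entries A -> A + c with c in {0, 4}, or A -> A - 2, of the Taylor matrix that
   sit on the diagonal of a triangular 16 x 16 submatrix; (m, c) encodes the set A
   by the bit mask m together with the element c at which the two sets differ. *)
Definition triangle (es : seq (nat * nat)) : seq (nat * nat) :=
  if size es == 4 then
    [:: (0, 4); (20, 0); (6, 4); (12, 0); (30, 2); (24, 0); (15, 2); (3, 4);
        (4, 4); (28, 0); (7, 4); (14, 2); (2, 4); (31, 2); (16, 0); (8, 0)]%N
  else
    [:: (24, 0); (6, 4); (30, 2); (20, 0); (0, 4); (12, 0); (15, 2); (3, 4);
        (4, 4); (2, 4); (8, 0); (1, 4); (28, 0); (7, 4); (31, 2); (14, 2)]%N.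

(** By the last clause the entries above the diagonal vanish for all exponents with this graph,
    since they are missing even from the superset [nbrs]. *)
Definition triangle_check es :=
  let g := exceptional_graph es in
  let L := triangle es in
  [&& size L == 16,
      all (fun e => let a := mask e.1 in
        if e.2 == 2 then [&& nth false a 1, nth false a 2 & nth false a 3]
        else (e.2 \in [:: 0; 4]) && addable 5 g xpredT a e.2) L &
      pairwise (fun e e' => toggle e'.2 (mask e'.1) \notin nbrs 5 g xpredT None (mask e.1)) L]%N.

(** The three covers serve, in this order, the case that f_3 does not divide lcm (f_2, f_4), the
    case chi_1 in p and the case chi_5 in p. *)
Definition exceptional_check es :=
  let g := exceptional_graph es in
  [&& small_cover 5 g xpredT (Some (1, 2, 3)),
      small_cover 5 g (predC1 0) None, small_cover 5 g (predC1 4) None &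
      triangle_check es]%N.

Lemma exceptional_checks : all exceptional_check exceptional_edges.
Proof. vm_cast_no_check (erefl true). Qed.

Lemma generic_checks : all (fun n => all (generic_check n) (graphs n)) (iota 1 5).
Proof. vm_cast_no_check (erefl true). Qed.

(** * From the finite checks to minors *)

Section Minors.
Variables (R : comUnitRingType) (p : R -> Prop).
Hypothesis prime_p : prime_ideal p.

Let idp : ideal p. Proof. by have [] := prime_p. Qed.

Lemma ideal_sum (I : ideal p) (T : Type) (r : seq T) (P : pred T) (F : T -> R) :
  (forall i, P i -> p (F i)) -> p (\sum_(i <- r | P i) F i).
Proof. by have [p0 pD _] := I => h; elim/big_ind: _. Qed.

Lemma prime_prod (T : finType) (F : T -> R) :
  p (\prod_i F i) -> exists i, p (F i).
Proof.
have [_ p1 pM] := prime_p; move=> h; apply: contrapT => /forallNP hF.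
suff : ~ p (\prod_i F i) by [].
by elim/big_ind: _ => // a b na nb /pM [].
Qed.

(** A term of the Leibniz expansion takes r entries in distinct rows and columns; X and Y are too
    few to meet them all, so some factor lies in p. Repeated rows or columns make the determinant
    0. *)
Lemma cover_minor N r (M : 'M[R]_N) (X Y : {set 'I_N}) (f g : 'I_r -> 'I_N) :
  (forall a b, a \notin X -> b \notin Y -> p (M a b)) -> (#|X| + #|Y| < r)%N ->
  p (\det (mxsub f g M)).
Proof.
move=> hM card_lt; have [p0 pD pM] := idp.
have [/injectiveP f_inj|/injectivePn [a [b ab fab]]] := boolP (injectiveb f); last first.
  by rewrite (determinant_alternate ab) // => j; rewrite !mxE fab.
have [/injectiveP g_inj|/injectivePn [a [b ab gab]]] := boolP (injectiveb g); last first.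
  by rewrite -det_tr (determinant_alternate ab) // => j; rewrite !mxE gab.
apply: ideal_sum => // s _; apply: (pM); change {perm 'I_r} in s.
have [t /andP [ftX gtY]] : exists t, (f t \notin X) && (g (s t) \notin Y).
  apply/existsP; apply: contraLR card_lt => /existsPn h; rewrite -leqNgt.
  rewrite -[X in (X <= _)%N]card_ord -cardsT.
  have -> : [set: 'I_r] = f @^-1: X :|: (g \o s) @^-1: Y.
    by apply/setP => t; rewrite !inE; have := h t; rewrite negb_and !negbK => ->.
  apply: leq_trans (leq_card_setU _ _) _; apply: leq_add.
    rewrite -(card_imset _ f_inj); apply: subset_leq_card.
    by apply/subsetP => _ /imsetP [t ht ->]; rewrite inE in ht.
  rewrite -(card_imset _ (inj_comp g_inj (@perm_inj _ s))); apply: subset_leq_card.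
  by apply/subsetP => _ /imsetP [t ht ->]; rewrite inE in ht.
by rewrite (bigD1 t) //= mulrC; apply: (pM); rewrite mxE; apply: hM.
Qed.

Lemma triangular_minor N r (M : 'M[R]_N) (f g : 'I_r -> 'I_N) :
  (forall s t : 'I_r, (s < t)%N -> M (f s) (g t) = 0) ->
  (forall t, ~ p (M (f t) (g t))) -> ~ p (\det (mxsub f g M)).
Proof.
move=> h0 hd; rewrite det_trig => [/prime_prod [t]|]; first by rewrite mxE; apply: hd.
by apply/is_trig_mxP => s t st; rewrite mxE h0.
Qed.

Lemma prime_sign_mul a b : p (a * (-1) ^+ b) -> p a.
Proof. by have [_ _ pM] := idp => /(pM ((-1) ^+ b)); rewrite mulrCA -expr2 sqrr_sign mulr1. Qed.

End Minors.

Section TypeEntry.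
Variables (k : fieldType) (n : nat) (tau : ctype n).
Implicit Types (A B : {set 'I_n}) (i j : 'I_n).
Local Notation entry := (type_entry k tau).

(** Applied with I = p for the covers and with I = 0 for the zeros of triangular submatrices. *)
Lemma type_entry_notin (I : {mpoly k[n]} -> Prop) A B : ideal I -> ~ I (entry A B) ->
  (exists j, [/\ j \notin A, B = j |: A, (tau (A, j)).1 & ~ I 'X_j]) \/
  (exists i, [/\ i \in A, B = A :\ i & (tau (B, i)).2]).
Proof.
move=> idI nI; have [I0 ID IM] := idI.
apply: contrapT => /not_orP [/forallNP h1 /forallNP h2]; apply: nI.
rewrite /type_entry [X in _ - X%:MP]big1 => [|i /andP [iA /eqP eB]]; last first.
  by case: ifP => // t; case: (h2 i).
rewrite subr0; apply: ideal_sum => // j _.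
case: ifP => [/and3P [jA /eqP eB t]|_]; last by rewrite mulr0.
rewrite mulrC; apply: IM; apply: contrapT => nj; by case: (h1 j).
Qed.

Lemma type_entryU A j : j \notin A -> (tau (A, j)).1 ->
  entry A (j |: A) = 'X_j * (ksign k j A)%:MP.
Proof.
move=> jA t; rewrite /type_entry (bigD1 j) //= jA eqxx t /= big1 => [|l lj]; last first.
  case: ifP => [/and3P [lA /eqP /setP /(_ l)]|_]; last by rewrite mulr0.
  by rewrite !inE (negbTE lA) (negbTE lj) eqxx.
rewrite addr0 [X in _ - X%:MP]big1 ?subr0 // => i /andP [iA /eqP /setP /(_ i)].
by rewrite !inE eqxx iA orbT.
Qed.

Lemma type_entryD A i : i \in A -> (tau (A :\ i, i)).2 ->
  entry A (A :\ i) = - (ksign k i A)%:MP.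
Proof.
move=> iA t; rewrite /type_entry big1 => [|j _]; last first.
  case: ifP => [/and3P [_ /eqP /setP /(_ i)]|_]; last by rewrite mulr0.
  by rewrite !inE eqxx iA orbT.
rewrite sub0r (bigD1 i) /= ?iA ?eqxx // t big1 ?addr0 // => l /andP [/andP [lA /eqP /setP /(_ l)]].
by rewrite !inE lA eqxx andbT => ->.
Qed.

End TypeEntry.

Section Coding.
Variables (n : nat) (s : 'I_n -> 'I_n) (s_inj : injective s).
Implicit Types (A B : {set 'I_n}) (i j : 'I_n).

Lemma all_iota (P : pred nat) : reflect (forall i, P i) (all P (iota 0 n)).
Proof.
apply: (iffP allP) => [h i|h t]; first by apply: h; rewrite mem_iota ltn_ord.
by rewrite mem_iota add0n => /andP [_ tn]; apply: (h (Ordinal tn)).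
Qed.

Lemma has_iota (P : pred nat) : reflect (exists i, P i) (has P (iota 0 n)).
Proof.
apply: (iffP hasP) => [[t]|[i Pi]]; last by exists (val i); rewrite // mem_iota ltn_ord.
by rewrite mem_iota add0n => /andP [_ tn] Pt; exists (Ordinal tn).
Qed.

Lemma count_iota_gt1 (P : pred nat) i j : i != j -> P i -> P j -> (1 < count P (iota 0 n))%N.
Proof.
move=> ij Pi Pj; rewrite -size_filter; apply: (@uniq_leq_size _ [:: val i; val j]).
  by rewrite /= inE ij.
by move=> t; rewrite !inE mem_filter mem_iota => /orP [] /eqP ->; rewrite ?Pi ?Pj ltn_ord.
Qed.

(** The renumbering [s] brings the exceptional graphs into their standard numbering, in which they
    were checked. *)
Definition set_code A : bitseq := [seq s i \in A | i <- enum 'I_n].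

Lemma size_set_code A : size (set_code A) = n.
Proof. by rewrite size_map size_enum_ord. Qed.

Lemma nth_set_code A i : nth false (set_code A) i = (s i \in A).
Proof. by rewrite (nth_map i) ?size_enum_ord // nth_ord_enum. Qed.

Lemma set_code_inj : injective set_code.
Proof.
move=> A B e; apply/setP => j; have [t _ st] := injF_bij s_inj.
by rewrite -(st j) -!nth_set_code e.
Qed.

Lemma set_codeE A (a : bitseq) : size a = n ->
  (forall i, nth false a i = (s i \in A)) -> set_code A = a.
Proof.
move=> sa h; apply: (@eq_from_nth _ false); rewrite size_set_code // => t tn.
by rewrite (nth_set_code A (Ordinal tn)) -(h (Ordinal tn)).
Qed.

Lemma set_codeU A j : set_code (s j |: A) = set_nth false (set_code A) j true.
Proof.
apply: set_codeE => [|i]; first by rewrite size_set_nth size_set_code; apply/maxn_idPr.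
by rewrite nth_set_nth /= nth_set_code !inE (inj_eq s_inj) -val_eqE; case: eqP.
Qed.

Lemma set_codeD A j : set_code (A :\ s j) = set_nth false (set_code A) j false.
Proof.
apply: set_codeE => [|i]; first by rewrite size_set_nth size_set_code; apply/maxn_idPr.
by rewrite nth_set_nth /= nth_set_code !inE (inj_eq s_inj) -val_eqE; case: eqP.
Qed.

Lemma mem_bits m (a : bitseq) : (a \in bits m) = (size a == m).
Proof.
have cons_inj (b : bool) : injective (cons b) by move=> u v [].
have cons_neq (b c : bool) u (r : seq bitseq) : b != c -> (b :: u \in [seq c :: a | a <- r]) = false.
  by move=> bc; apply/negbTE/mapP => -[v _ [e]]; rewrite e eqxx in bc.
elim: m a => [|m IH] [|[] a] //=; rewrite mem_cat.
- by apply/negbTE; rewrite negb_or; apply/andP; split; apply/mapP => -[].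
- by rewrite cons_neq // (mem_map (cons_inj true)) IH.
- by rewrite (mem_map (cons_inj false)) cons_neq // orbF IH.
Qed.

Lemma card_set_code (P : pred bitseq) :
  (#|[set A | P (set_code A)]| <= count P (bits n))%N.
Proof.
rewrite -size_filter cardE -(size_map set_code); apply: uniq_leq_size.
  by rewrite map_inj_uniq ?enum_uniq //; exact: set_code_inj.
move=> a /mapP [A]; rewrite mem_enum inE => PA ->.
by rewrite mem_filter PA mem_bits size_set_code eqxx.
Qed.

Lemma card_set_code_mem (Y : seq bitseq) : (#|[set A | set_code A \in Y]| <= size Y)%N.
Proof.
rewrite cardE -(size_map set_code); apply: uniq_leq_size.
  by rewrite map_inj_uniq ?enum_uniq //; exact: set_code_inj.
by move=> a /mapP [A]; rewrite mem_enum inE => ? ->.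
Qed.

Variable adj : rel 'I_n.
Hypothesis adjC : forall i j, adj i j = adj j i.

Definition nat_adj t u := if (insub t, insub u) is (Some i, Some j) then adj (s i) (s j) else false.

Definition graph_code : seq bitseq := mkseq (fun t => mkseq (nat_adj t) t) n.

Lemma gadj_code i j : gadj graph_code i j = (i != j) && adj (s i) (s j).
Proof.
have row i' j' : nth false (nth [::] graph_code i') j' = (j' < i')%N && adj (s i') (s j').
  rewrite nth_mkseq //; case: ltnP => ji; last by rewrite nth_default ?size_mkseq.
  by rewrite nth_mkseq // /nat_adj !valK.
rewrite /gadj !row [adj (s j) _]adjC -val_eqE /= neq_ltn.
by case: (i < j)%N; case: (j < i)%N; case: (adj _ _).
Qed.

Lemma graph_code_mem : graph_code \in graphs n.
Proof.
suff h m : mkseq (fun t => mkseq (nat_adj t) t) m \in graphs m by exact: h.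
elim: m => [|m IH] //.
rewrite mkseqS; apply/allpairsP; exists (mkseq (fun t => mkseq (nat_adj t) t) m, mkseq (nat_adj m) m).
by rewrite mem_bits size_mkseq eqxx.
Qed.

End Coding.

Section Pattern.
Variables (n d : nat) (E : 'I_n -> 'I_d -> nat).
Implicit Types (A B : {set 'I_n}) (i j l : 'I_n).
Local Notation tau := (ctype_of E).

Lemma lcme_geq A l t : l \in A -> (E l t <= lcme E A t)%N.
Proof. by move=> lA; exact: (@leq_bigmax_cond _ (fun l => l \in A) (fun l => E l t) l lA). Qed.

Lemma lcme_ge A i t : (0 < E i t)%N -> (E i t <= lcme E A t)%N ->
  exists2 l, l \in A & (E i t <= E l t)%N.
Proof.
move=> i0 h; suff /existsP [l /andP [? ?]] : [exists l, (l \in A) && (E i t <= E l t)%N] by exists l.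
apply: contraLR h => /existsPn h; rewrite -ltnNge.
apply: (@leq_ltn_trans (E i t).-1); last by rewrite prednK.
by apply/bigmax_leqP => l lA; have := h l; rewrite lA /= -ltnNge; lia.
Qed.

Lemma ctype_coprimeP A j : reflect (forall l, l \in A -> ~~ share E j l) (tau (A, j)).1.
Proof.
rewrite ffunE /=; apply: (iffP forallP) => [h l lA|h t].
  apply/existsPn => t; have /eqP := h t; have := lcme_geq t lA.
  by move: (lcme E A t) => u; lia.
rewrite -leqn0 leqNgt leq_min; apply/negP => /andP [jt].
rewrite ltnNge => /negP; apply; apply/bigmax_leqP => l lA.
by have /existsPn /(_ t) := h l lA; rewrite jt /= lt0n negbK => /eqP ->.
Qed.

Lemma ctype_dvdP B i : reflect (forall t, E i t <= lcme E B t)%N (tau (B, i)).2.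
Proof. by rewrite ffunE; exact: forallP. Qed.


Hypothesis gE : good_exp E.
Variables (s : 'I_n -> 'I_n) (s_inj : injective s).
Local Notation code := (set_code s).
Local Notation g := (graph_code s (share E)).

Let gE_ne i j : i != j -> exists t, (E j t < E i t)%N.
Proof.
move=> ij; have /andP [_ /forallP /(_ i) /forallP /(_ j)] := gE.
by rewrite ij => /forallPn [t]; rewrite -ltnNge; exists t.
Qed.

Let gE_gt0 i : exists t, (0 < E i t)%N.
Proof. by have /andP [/forallP /(_ i) /wt_gt0] := gE. Qed.

(* fb = Some (u, v, w) records that f_v does not divide lcm (f_u, f_w). *)
Definition lcm_avoids fb := if fb is Some (u, v, w) then forall i : 'I_n, i = v :> nat ->
  exists t, [/\ (0 < E (s i) t)%N,
                forall j : 'I_n, j = u :> nat -> (E (s j) t < E (s i) t)%N &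
                forall j : 'I_n, j = w :> nat -> (E (s j) t < E (s i) t)%N] else True.

Lemma addable_code nz A j : s j \notin A ->
  addable n g nz (code A) j = nz (val j) && (tau (A, s j)).1.
Proof.
move=> jA; rewrite /addable nth_set_code jA /=; congr (_ && _).
apply/all_iota/ctype_coprimeP => h => [l lA|l].
  have [l' _ sl] := injF_bij s_inj; have := h (l' l).
  rewrite nth_set_code sl lA gadj_code ?sl //; last exact: shareC.
  rewrite negb_and => /orP [|//]; rewrite negbK => /eqP jl; by rewrite jl sl lA in jA.
rewrite nth_set_code gadj_code; last exact: shareC.
by apply/implyP => /h /negbTE ->; rewrite andbF.
Qed.

Lemma removable_code fb B i : s i \notin B -> (tau (B, s i)).2 ->
  lcm_avoids fb -> removable n g fb (code B) i.
Proof.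
move=> iB /ctype_dvdP hi hfb.
have nb t : (0 < E (s i) t)%N -> exists2 l, (s l \in B) && gadj g i l & (E (s i) t <= E (s l) t)%N.
  move=> it; have [l lB hl] := lcme_ge it (hi t).
  have [s' _ sl] := injF_bij s_inj; exists (s' l); rewrite sl // lB gadj_code /=; last exact: shareC.
  apply/andP; split; first by apply: contraNneq iB => ->; rewrite sl.
  by rewrite sl; apply/existsP; exists t; rewrite it (leq_trans it hl).
apply/and3P; split.
(* Some neighbour l contains a variable of f_i. Since f_i does not divide f_l, a variable whose
   exponent in f_l is too small requires a second neighbour. *)
- have [t it] := gE_gt0 (s i); have [l /andP [lB il] _] := nb t it.
  have /gE_ne [u hu] : s i != s l by apply: contraNneq iB => ->.
  have [m /andP [mB im] hm] := nb u (leq_ltn_trans (leq0n _) hu).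
  apply: (@count_iota_gt1 _ _ l m); rewrite ?nth_set_code ?lB ?mB //.
  by apply: contraTneq hu => ->; rewrite -leqNgt.
- apply/all_iota => l; rewrite gadj_code; last exact: shareC.
  apply/implyP => /andP [il /existsP [t /andP [it lt]]]; rewrite nth_set_code.
  have [//|lB /=] := boolP (s l \in B); apply/has_iota.
  have [m /andP [mB im] hm] := nb t it; exists m; rewrite nth_set_code mB im gadj_code /=; last exact: shareC.
  apply/andP; split; first by apply: contraNneq lB => <-.
  by apply/existsP; exists t; rewrite lt (leq_trans it hm).
case: fb hfb => [[[u v] w]|//] /= hfb; apply/implyP => /eqP iv.
have [t [it hu hw]] := hfb i iv; apply/has_iota.
have [m /andP [mB im] hm] := nb t it; exists m; rewrite nth_set_code mB im /=.
by apply/andP; split; apply: contraTneq hm => /[dup] ?; rewrite -ltnNge; [apply: hu | apply: hw].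
Qed.

Lemma type_entry_code (k : fieldType) (I : {mpoly k[n]} -> Prop) (nz : pred nat) fb A B : ideal I ->
  (forall i, ~ I 'X_(s i) -> nz (val i)) ->
  lcm_avoids fb ->
  ~ I (type_entry k tau A B) -> code B \in nbrs n g nz fb (code A).
Proof.
move=> idI hnz hfb /(type_entry_notin idI); have [s' _ sK] := injF_bij s_inj.
rewrite mem_cat => -[[j [jA -> t nj]]|[i [iA eB t]]]; apply/orP; [left|right].
  apply/mapP; exists (val (s' j)); last by rewrite -{1}(sK j) set_codeU.
  rewrite mem_filter mem_iota ltn_ord andbT addable_code sK // t andbT.
  by rewrite andbT; apply: hnz; rewrite sK.
apply/mapP; exists (val (s' i)); last by rewrite eB -{1}(sK i) set_codeD.
rewrite mem_filter mem_iota ltn_ord !andbT nth_set_code sK iA /=.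
have -> : set_nth false (code A) (s' i) false = code B by rewrite eB -{2}(sK i) set_codeD.
by apply: removable_code; rewrite ?sK // eB !inE eqxx.
Qed.

End Pattern.

(** * Supports of the generic and the exceptional graphs *)

Section Supports.
Variables (k : fieldType) (n : nat) (n_gt0 : (0 < n)%N) (P : monomial_presentation k n).
Implicit Types (A B : {set 'I_n}) (i j l : 'I_n).
Local Notation E := (fun i => mp_exp P i : 'I_(mp_length P) -> nat).
Local Notation tau := (ctype_of E).
Local Notation entry := (type_entry k tau).
Local Notation N := #|{set 'I_n}|.
Local Notation r := (2 ^ n.-1)%N.
Local Notation S := {mpoly k[n]}.

Let gE : good_exp E := mp_good_exp P.

Definition minors_in (p : affine k n) :=
  forall f g : 'I_r -> 'I_N, p (\det (mxsub f g (type_mx k tau))).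

Lemma support_minors (Z : affine k n -> Prop) :
  (forall p, minors_in p <-> Z p) -> is_cohomological_support P Z.
Proof.
move=> h; apply/is_cohomological_supportP => p; rewrite -h /minors_in -type_minorsP.
exact: mp_minors.
Qed.

Lemma ideal0 : ideal (fun a : S => a = 0).
Proof. by split=> // [a b -> ->|r' a ->]; rewrite ?addr0 ?mulr0. Qed.

Lemma entry_eq0 A B :
  (forall j, j \notin A -> B = j |: A -> ~~ (tau (A, j)).1) ->
  (forall i, i \in A -> B = A :\ i -> ~~ (tau (B, i)).2) -> entry A B = 0.
Proof.
move=> h1 h2; apply: contrapT => /(type_entry_notin ideal0).
by case=> [[j [jA eB t _]]|[i [iA eB t]]];
  [have := h1 j jA eB; rewrite t | have := h2 i iA eB; rewrite t].
Qed.

Lemma spec_sign (p : affine k n) c : ~ p (- (-1) ^+ c).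
Proof.
have [[p0 pD pM] p1 _] := spec_prime p => h; apply: p1.
by have := pM (- (-1) ^+ c) _ h; rewrite mulrNN -expr2 sqrr_sign.
Qed.

Lemma card_enum_val (T : finType) (Q : pred T) :
  #|[set a : 'I_#|T| | Q (enum_val a)]| = #|[set A | Q A]|.
Proof.
rewrite -(card_imset _ (@enum_val_inj T T)); apply: eq_card => A; rewrite inE.
apply/imsetP/idP => [[a]|QA]; first by rewrite inE => ? ->.
by exists (enum_rank A); rewrite ?inE enum_rankK.
Qed.

Lemma small_cover_minors (s : 'I_n -> 'I_n) (p : affine k n) (nz : pred nat) fb :
  injective s -> (forall i, ~ p 'X_(s i) -> nz (val i)) ->
  lcm_avoids E s fb ->
  small_cover n (graph_code s (share E)) nz fb -> minors_in p.
Proof.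
move=> s_inj hnz hfb; rewrite /small_cover; set Y := reached _ _ => hY f g.
have idp : ideal p by have [] := spec_prime p.
pose nb := nbrs n (graph_code s (share E)) nz fb.
pose row A := ~~ all (mem Y) (nb (set_code s A)).
apply: (@cover_minor _ p (spec_prime p) _ _ _ [set a | row (enum_val a)]
  [set b | set_code s (enum_val b) \in Y]) => [a b|].
  rewrite !inE negbK mxE => /allP hA hB; apply: contrapT.
  by move=> /(type_entry_code gE s_inj idp hnz hfb) /hA /=; rewrite (negbTE hB).
rewrite (card_enum_val row) (card_enum_val (fun A => set_code s A \in Y)) addnC; apply: leq_ltn_trans hY.
apply: leq_add; first exact: (card_set_code_mem s_inj).
by rewrite count_map; exact: (card_set_code s_inj (fun a => ~~ all (mem Y) (nb a))).
Qed.

(** The rows A without i and the columns A + i form a diagonal submatrix with entries +-chi_i, of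
    size r. *)
Lemma isolated_support (p : affine k n) i :
  minors_in p -> i \in isolated P -> p 'X_i.
Proof.
move=> hp /isolatedP iso; apply: contrapT => nX.
have card_r : #|[set A : {set 'I_n} | i \notin A]| = r.
  rewrite (_ : [set A | _] = powerset (~: [set i])); last first.
    by apply/setP => A; rewrite !inE subsets_disjoint setCK disjoint_sym disjoints1.
  by rewrite card_powerset cardsC1 card_ord.
pose A (t : 'I_r) := enum_val (cast_ord (esym card_r) t).
have iA t : i \notin A t by have := enum_valP (cast_ord (esym card_r) t); rewrite inE.
have A_inj : injective A by move=> s t /enum_val_inj /cast_ord_inj.
apply: (@triangular_minor _ p (spec_prime p) _ _ (type_mx k tau)
  (fun t => enum_rank (A t)) (fun t => enum_rank (i |: A t)) _ _ (hp _ _)) => [s t st|t].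
  rewrite mxE !enum_rankK; apply: entry_eq0 => [j jA eB|j jA /setP /(_ i)]; last first.
    by rewrite !inE eqxx (negbTE (iA s)) andbF.
  have ij : i = j by have /setP /(_ i) := eB; rewrite !inE eqxx (negbTE (iA s)) orbF => /esym /eqP.
  subst j; suff est : A s = A t by rewrite (A_inj _ _ est) ltnn in st.
  by rewrite -(setU1K (iA s)) -eB setU1K.
rewrite mxE !enum_rankK type_entryU //; last first.
  by apply/ctype_coprimeP => l lA; apply: iso; apply: contraTneq lA => ->.
by rewrite rmorph_sign => /(prime_sign_mul (spec_prime p)).
Qed.

(** The transpose of D has the same minors, and its homology has annihilator 0. The basis vector {i}
    is a cycle because i is adjacent to all others, and every boundary has at each {l} the entry
    +-chi_l w with one common w. If s times {i} is a boundary, its entry 0 at {j} gives w = 0, hence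
    s = 0. *)
Lemma dominated_minors i j : j != i -> (forall l, l != i -> share E i l) ->
  forall p, minors_in p.
Proof.
move=> ji dom p.
have rowi B : entry [set i] B = 0.
  apply: entry_eq0 => [l|l]; rewrite !inE.
    move=> li _; apply/negP => /ctype_coprimeP /(_ i).
    by rewrite inE eqxx shareC dom // => /(_ isT).
  move=> /eqP -> ->; rewrite setDv; apply/negP => /ctype_dvdP h.
  have /andP [/forallP /(_ i) /wt_gt0 [t it] _] := gE.
  by have := h t; rewrite lcme0 leqNgt it.
(* A pair {l, m} does not lead to {l}, because f_m does not divide f_l. *)
have coll l A : A != set0 -> entry A [set l] = 0.
  move=> A0; apply: entry_eq0 => [m mA e|m mA e].
    case/set0Pn: A0 => u uA; have /setP /(_ u) := e; rewrite !inE uA orbT => /eqP eu.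
    by have /setP /(_ m) := e; rewrite !inE eqxx -eu => /eqP em; rewrite em uA in mA.
  apply/negP => /ctype_dvdP h.
  have lm : m != l by apply: contra_eq_neq e => ->; apply/eqP => /setP /(_ l); rewrite !inE eqxx.
  case/negP: (@mp_antichain _ _ P _ _ lm); apply/forallP => t; have := h t.
  by rewrite /lcme big_set1.
have col0 l : entry set0 [set l] = 'X_l * (ksign k l set0)%:MP.
  rewrite -{1}[[set l]]setU0 type_entryU ?inE //.
  by apply/ctype_coprimeP => m; rewrite inE.
pose D := (type_mx k tau)^T.
suff h (f g : 'I_r -> 'I_N) : p (\det (mxsub f g D)).
  move=> f g; rewrite -det_tr (_ : _^T = mxsub g f D) //.
  by apply/matrixP => u v; rewrite !mxE.
have DD : D *m D = 0 by rewrite /D -trmx_mul -mp_D_type mp_D_sq trmx0.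
apply: (proj1 (@annH_minors _ _ _ _ D p (card_half n_gt0) DD) _ f g) => s hs.
have [|eta] := hs (delta_mx (enum_rank [set i]) 0).
  apply/matrixP => a u; rewrite !mxE big1 // => b _; rewrite !mxE ord1.
  by case: eqP => [->|_]; rewrite ?mulr0 // enum_rankK rowi mul0r.
move=> /matrixP e; pose w := eta (enum_rank set0) 0.
have key l : s * (l == i)%:R = 'X_l * (ksign k l set0)%:MP * w.
  have := e (enum_rank [set l]) 0; rewrite !mxE eqxx andbT (inj_eq enum_rank_inj) (inj_eq set1_inj) => ->.
  rewrite (bigD1 (enum_rank set0)) //= !mxE !enum_rankK col0 big1 ?addr0 // => b b0.
  by rewrite !mxE enum_rankK coll ?mul0r //; apply: contraNneq b0 => <-; rewrite enum_valK.
have w0 : w = 0.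
  have := key j; rewrite (negbTE ji) mulr0 => /esym /eqP; rewrite mulf_eq0 => /orP [|/eqP //].
  rewrite rmorph_sign mulf_eq0 signr_eq0 orbF => /eqP X0.
  by have := mcoeffXU k j j; rewrite X0 mcoeff0 eqxx => /eqP; rewrite eq_sym oner_eq0.
have := key i; rewrite eqxx mulr1 w0 mulr0 => ->.
by have [[]] := spec_prime p.
Qed.

End Supports.

Section Exceptional.
Variables (k : fieldType) (P : monomial_presentation k 5).
Local Notation E := (fun i => mp_exp P i : 'I_(mp_length P) -> nat).
Local Notation tau := (ctype_of E).

Lemma exceptional_code (s : 'I_5 -> 'I_5) es : injective s ->
  (forall i j : 'I_5, gcd_edge P (s i) (s j) <->
     ((i : nat, j : nat) \in es) || ((j : nat, i : nat) \in es)) ->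
  graph_code s (share E) = exceptional_graph es.
Proof.
move=> s_inj h; apply: (@eq_from_nth _ [::]) => [|t]; rewrite !size_mkseq // => t5.
rewrite !nth_mkseq //; apply: (@eq_from_nth _ false) => [|u]; rewrite !size_mkseq // => ut.
rewrite !nth_mkseq //; have u5 := ltn_trans ut t5.
have := h (Ordinal t5) (Ordinal u5); rewrite gcd_edgeP => e.
rewrite /nat_adj (insubT (fun i => i < 5)%N t5) (insubT (fun i => i < 5)%N u5) /=.
have ne : s (Ordinal t5) != s (Ordinal u5).
  by rewrite (inj_eq s_inj) -val_eqE /= neq_ltn ut orbT.
by move: e; rewrite ne /= => e; apply/idP/idP => /e.
Qed.

Variables (s : 'I_5 -> 'I_5) (exc : exceptional P s).

Let s_inj : injective s. Proof. by case: exc => /bij_inj. Qed.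

Lemma exceptional_support :
  is_cohomological_support P (fun p => p 'X_(s (inord 0)) \/ p 'X_(s (inord 4))).
Proof.
have [_ [es es_in edges] lcm_cond] := exc.
have code := exceptional_code s_inj edges.
have /and4P [_ cov0 cov4 tri] := allP exceptional_checks es es_in.
apply: support_minors => // p; split=> [hp|]; last first.
  have cov (c : 'I_5) : p 'X_(s c) -> small_cover 5 (exceptional_graph es) (predC1 (c : nat)) None -> minors_in P p.
    move=> pc; rewrite -code; apply: small_cover_minors => // i ni.
    by apply/eqP => ic; apply: ni; rewrite (val_inj ic).
  by case=> h; [apply: (cov _ h); rewrite inordK | apply: (cov _ h); rewrite inordK].
apply: contrapT => /not_orP [n0 n4].
have /lcm_dvdP /forallP lcm24 := lcm_cond.
have /and3P [/eqP size_L /allP diag up] := tri.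
pose L := triangle es; rewrite -/L in size_L diag up.
have {}diag e : e \in L -> if e.2 == 2 then
    [&& nth false (mask e.1) 1, nth false (mask e.1) 2 & nth false (mask e.1) 3]
  else (e.2 \in [:: 0; 4]) && addable 5 (exceptional_graph es) xpredT (mask e.1) e.2.
  exact: diag.
pose e0 := (0, 0)%N : nat * nat.
pose decode (a : bitseq) := [set s i | i : 'I_5 & nth false a i].
have decodeK (a : bitseq) : size a = 5 -> set_code s (decode a) = a.
  move=> sa; apply: set_codeE => // i; rewrite /decode; apply/idP/imsetP => [ai|[j]]; first by exists i; rewrite ?inE.
  by rewrite inE => aj /s_inj ->.
pose A (t : 'I_16) := decode (mask (nth e0 L t).1).
pose B (t : 'I_16) := decode (toggle (nth e0 L t).2 (mask (nth e0 L t).1)).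
have inL (t : 'I_16) : nth e0 L t \in L by rewrite mem_nth ?size_L.
have c5 (t : 'I_16) : ((nth e0 L t).2 < 5)%N.
  have := diag _ (inL t); case: ifP => [/eqP -> //|_ /andP []].
  by rewrite !inE => /orP [] /eqP ->.
have codeA t : set_code s (A t) = mask (nth e0 L t).1 by apply: decodeK; rewrite size_mkseq.
have codeB t : set_code s (B t) = toggle (nth e0 L t).2 (mask (nth e0 L t).1).
  by apply: decodeK; rewrite size_set_nth size_mkseq; apply/maxn_idPr.
apply: (@triangular_minor _ p (spec_prime p) _ 16 (type_mx k tau)
  (fun t => enum_rank (A t)) (fun t => enum_rank (B t)) _ _ (hp _ _)) => [t u tu|t].
  rewrite mxE !enum_rankK; apply: contrapT.
  move=> /(@type_entry_code _ _ _ (mp_good_exp P) _ s_inj _ (fun a => a = 0) xpredT None _ _ (@ideal0 k 5) (fun _ _ => isT) I).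
  apply/negP; rewrite code codeA codeB.
  by have /(pairwiseP e0) := up; apply; rewrite // inE size_L.
rewrite mxE !enum_rankK.
have := diag _ (inL t); move: (codeA t) (codeB t); have := c5 t.
move: (mask (nth e0 L t).1) (nth e0 L t).2 => a c c5t cA cB.
have nthA (i : 'I_5) : (s i \in A t) = nth false a i by rewrite -cA nth_set_code.
case: ifP => [/eqP c2|c2 /andP [c04 add]].
  (* A contains the vertices 1 and 3, and the lcm of their generators is divisible by the one at
     vertex 2; so the entry is +-1. *)
  subst c; case/and3P => m1 m2 m3.
  pose i1 := inord 1 : 'I_5; pose i2 := inord 2 : 'I_5; pose i3 := inord 3 : 'I_5.
  have v1 : i1 = 1%N :> nat by rewrite inordK.
  have v2 : i2 = 2%N :> nat by rewrite inordK.
  have v3 : i3 = 3%N :> nat by rewrite inordK.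
  have A1 : s i1 \in A t by rewrite nthA v1.
  have A2 : s i2 \in A t by rewrite nthA v2.
  have A3 : s i3 \in A t by rewrite nthA v3.
  have -> : B t = A t :\ s i2.
    by apply: (set_code_inj s_inj); rewrite cB set_codeD // cA v2 /toggle m2.
  rewrite type_entryD //; first by rewrite rmorph_sign; exact: spec_sign.
  apply/ctype_dvdP => u; apply: leq_trans (lcm24 u) _; rewrite geq_max.
  rewrite !lcme_geq // !inE (inj_eq s_inj) -val_eqE /= ?v1 ?v2 ?v3 //.
pose i := Ordinal c5t.
have iA : s i \notin A t by rewrite nthA; case/and3P: add.
have -> : B t = s i |: A t.
  apply: (set_code_inj s_inj); rewrite cB set_codeU // cA /toggle.
  by move: iA; rewrite nthA => /negbTE ->.
rewrite type_entryU //; last first.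
  by move: add; rewrite -code -cA (@addable_code _ _ E s s_inj xpredT (A t) i) // => /andP [].
rewrite rmorph_sign => /(prime_sign_mul (spec_prime p)).
move: c04; rewrite !inE => /orP [] /eqP c0; rewrite /i.
  by rewrite (_ : Ordinal c5t = inord 0) //; apply: val_inj; rewrite /= inordK.
by rewrite (_ : Ordinal c5t = inord 4) //; apply: val_inj; rewrite /= inordK.
Qed.

End Exceptional.

Section FewGenerators.
Variable k : fieldType.

(** Renumbered by v the graph is one of the exceptional ones; so only the divisibility condition can
    fail, and then a variable whose exponent in f_3 exceeds those in f_2 and f_4 makes the first
    cover available. *)
Lemma exceptional_shape_minors n (P : monomial_presentation k n) v es p : n = 5%N ->
  perm_eq v (iota 0 5) -> es \in exceptional_edges ->
  shape (graph_code id (share (fun i => mp_exp P i : 'I_(mp_length P) -> nat))) es v ->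
  (forall s, ~ exceptional P s) -> minors_in P p.
Proof.
move=> n5; subst n => v_perm es_in v_shape nexc.
have v_size : size v = 5 by rewrite (perm_size v_perm) size_iota.
pose s (i : 'I_5) : 'I_5 := inord (nth 0%N v i).
have sE (i : 'I_5) : s i = nth 0%N v i :> nat.
  rewrite inordK //; have : nth 0%N v i \in iota 0 5.
    by rewrite -(perm_mem v_perm) mem_nth // v_size.
  by rewrite mem_iota.
have s_inj : injective s.
  move=> i j /(congr1 val) /=; rewrite !sE => /eqP.
  by rewrite nth_uniq ?v_size // ?(perm_uniq v_perm) ?iota_uniq // => /eqP /val_inj.
have edges (i j : 'I_5) : gcd_edge P (s i) (s j) <->
    ((i : nat, j : nat) \in es) || ((j : nat, i : nat) \in es).
  have := v_shape; rewrite /shape => /all_iota /(_ i) /all_iota /(_ j) /eqP <-.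
  by rewrite -!sE gcd_edgeP gadj_code //; exact: shareC.
have code := exceptional_code s_inj edges.
have /and4P [cov _ _ _] := allP exceptional_checks es es_in.
rewrite -code in cov; apply: (small_cover_minors s_inj _ _ cov) => // i i2.
have /lcm_dvdP /negP/forallPn [t] : ~ exists l, is_lcm l (mp_f P (s (inord 1))) (mp_f P (s (inord 3))) /\
    Defs.dvd (mp_f P (s (inord 2))) l.
  by move=> h; apply: (nexc s); split=> //; [exact: injF_bij | exists es].
rewrite -ltnNge gtn_max => /andP [h1 h3]; exists t.
have ie (j : 'I_5) (m : nat) : j = m :> nat -> j = inord m.
  by move=> <-; rewrite inord_val.
rewrite (ie _ _ i2); split=> [|j /ie ->|j /ie ->] //; exact: leq_ltn_trans h1.
Qed.

Variable n : nat.
Hypothesis n_gt0 : (0 < n)%N.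
Variable P : monomial_presentation k n.

Lemma generic_support : (n <= 5)%N -> (forall s, ~ exceptional P s) ->
  is_cohomological_support P (coordinate_subspace (isolated P)).
Proof.
move=> n5 nexc; apply: support_minors => // p; split=> [hp i|hp]; first exact: isolated_support.
set E := (fun i => mp_exp P i : 'I_(mp_length P) -> nat).
pose g := graph_code id (share E).
have gE (i j : 'I_n) : gadj g i j = (i != j) && share E i j by apply: gadj_code; exact: shareC.
have /allP/(_ g (graph_code_mem _ _)) : all (generic_check n) (graphs n).
  by apply: (allP generic_checks); rewrite mem_iota n_gt0 add1n ltnS.
rewrite /generic_check; case: ifP => [/andP [n1 /has_iota [i /all_iota dom]] _|_].
  have [j ji] : exists j, j != i.
    apply/existsP; apply: contraLR n1 => /existsPn h; rewrite -leqNgt -[n]card_ord.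
    by rewrite -cardsT (_ : [set: 'I_n] = [set i]) ?cards1 //; apply/setP => j; rewrite !inE; have := h j; rewrite negbK.
  apply: (@dominated_minors _ _ n_gt0 _ i j) => // l li.
  by have := dom l; rewrite val_eqE eq_sym (negbTE li) gE => /andP [].
case: ifP => [cov _|_ /andP [/eqP n_5 /hasP [v]]].
  apply: (small_cover_minors (@inj_id _) _ _ cov) => // i nXi.
  have : i \notin isolated P by apply/negP => /hp.
  rewrite inE negb_forall => /existsP [j]; rewrite negb_imply negbK => /andP [ji ij].
  by apply/has_iota; exists j; rewrite gE eq_sym ji.
rewrite mem_permutations => v_perm /hasP [es es_in v_shape].
exact: (@exceptional_shape_minors n P v es p n_5 v_perm es_in v_shape nexc).
Qed.

Lemma exceptional_card s : exceptional P s -> n = 5%N.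
Proof. by case=> /bij_eq_card; rewrite !card_ord. Qed.

Lemma exceptional_support_any s : exceptional P s ->
  is_cohomological_support P (fun p => p 'X_(s (inord 0)) \/ p 'X_(s (inord 4))).
Proof.
move=> /[dup] /exceptional_card n5; move: P s n_gt0; rewrite n5 => P' s _; exact: exceptional_support.
Qed.

End FewGenerators.

Theorem theorem3 (n : nat) (n_gt0 : (1 <= n)%N) :
  (exists (L : seq (seq {mpoly int[n]}))
          (Phi : forall d : nat, 'M[nat]_(n, d) -> seq {mpoly int[n]}),
     [/\ forall (d : nat) (a : 'M[nat]_(n, d)), Phi d a \in L,
         forall (k : fieldType) (P : monomial_presentation k n),
           is_cohomological_support P (zero_locus (Phi (mp_length P) (mp_exp P))) &
         forall (k : fieldType) (Z : affine k n -> Prop),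
           realizable Z <->
           exists2 l, l \in L & forall p, Z p <-> zero_locus l p])
  /\
  ((n <= 5)%N ->
   forall (k : fieldType) (P : monomial_presentation k n),
     [/\ exists U : {set {set 'I_n}},
           is_cohomological_support P
             (fun p => exists2 T, T \in U & coordinate_subspace T p),
         forall v : 'I_5 -> 'I_n, exceptional P v ->
           is_cohomological_support P
             (fun p => p 'X_(v (inord 0)) \/ p 'X_(v (inord 4))) &
         (forall v : 'I_5 -> 'I_n, ~ exceptional P v) ->
           exists T : {set 'I_n},
             [/\ is_cohomological_support P (coordinate_subspace T),
                 embedded_deformation P #|T| &
                 forall c : nat, embedded_deformation P c -> (c <= #|T|)%N]]).
Proof.
split=> [|n5 k P]; first exact: realizable_supports.
have congr_support (Z Z' : affine k n -> Prop) : (forall p, Z p <-> Z' p) ->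
    is_cohomological_support P Z -> is_cohomological_support P Z'.
  by move=> e [hF hZ]; split=> // F rF p; rewrite -e; exact: hZ.
split.
- case: (pselect (exists s, exceptional P s)) => [[s exc]|/forallNP nexc].
    exists [set [set s (inord 0)]; [set s (inord 4)]].
    apply: congr_support (exceptional_support_any n_gt0 exc) => p.
    split=> [[h|h]|[T]].
    + by exists [set s (inord 0)]; rewrite ?set21 // => i; rewrite inE => /eqP ->.
    + by exists [set s (inord 4)]; rewrite ?set22 // => i; rewrite inE => /eqP ->.
    by rewrite !inE => /orP [] /eqP -> h; [left | right]; apply: h; rewrite inE.
  exists [set isolated P]; apply: congr_support (generic_support n_gt0 n5 nexc) => p.
  by split=> [h|[T]]; [exists (isolated P); rewrite ?inE | rewrite inE => /eqP ->].
- by move=> s; exact: exceptional_support_any.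
move=> nexc; exists (isolated P); split; first exact: generic_support.
  exact: isolated_embedded_deformation.
exact: embedded_deformation_bound.
Qed.
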